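(* Let $\varphi:\mathbb P^1\to\mathbb P^1$ be a branched Galois covering of degree $6$ with Galois group the dihedral group $D_3$ of order $6$; up to Möbius transformations, $\varphi$ is $[x,y]\mapsto-\alpha_3^2/\gamma^3$, where $\alpha_3=(x^3-y^3)/2$, $\beta_3=(x^3+y^3)/2$, $\gamma=xy$. Let $g([x,y]):\mathbb P^1\to\mathbb P^3$ be a holomorphic curve which is a Galois lift, with covering $\varphi$, of a sextic curve $F$ in $\mathcal V_5$, so $f_1\circ g=F\circ\varphi$. Then $\deg g=7$, and up to Möbius transformations on $\mathbb P^1$, $g$ is $PSL_2$-equivalent to $$g=\begin{pmatrix} a_1 & a_2 & a_3 \\ b_1 & b_2 & b_3 \end{pmatrix}\begin{pmatrix} \alpha_3\beta_3(\frac{\nu_1}{\xi_1}y+x) & \gamma^3(\frac{\nu_1}{\xi_1}y-x) & \alpha_3^2(\frac{\nu_1}{\xi_1}y-x) \\ \alpha_3\beta_3\nu_1(\frac{\nu_2}{\xi_1}y+x) & \gamma^3\nu_1(\frac{\nu_2}{\xi_1}y-x) & \alpha_3^2\nu_1(\frac{\nu_2}{\xi_1}y-x) \end{pmatrix}^T,$$ where $\xi_1=\exp(\frac{\pi i}4)$, $\nu_1=\frac{-1+\sqrt{-1}}{1-\sqrt3}$, $\nu_2=\frac{-1+\sqrt{-1}}{1+\sqrt3}$. Moreover, $\begin{pmatrix} a_1 & a_2 & a_3 \\ b_1 & b_2 & b_3 \end{pmatrix}\in G(2,3)$ is the unique $2$-plane which is perpendicular to $$\Big(\alpha_3\beta_3\nu_1\big(\tfrac{\nu_2}{\xi_1}y+x\big),\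 \gamma^3\nu_1\big(\tfrac{\nu_2}{\xi_1}y-x\big),\ \alpha_3^2\nu_1\big(\tfrac{\nu_2}{\xi_1}y-x\big)\Big)\Big|_{(x,y)=(t,1)}$$ under the usual bilinear inner product. This class depends on one free parameter $t$ and belongs to the exceptional transversal family.
   Context: The ground field is $\mathbb C$. $V_n$ is the space of binary forms of degree $n$ in $u,v$, with $SL_2=SL_2(\mathbb C)$ acting by $(A\cdot f)(u,v)=f(A^{-1}(u,v)^T)$. $\mathcal V_5\subset\mathbb P(V_6)=\mathbb P^6$ is the closure of $PSL_2\cdot[uv(u^4-v^4)]$; it is the disjoint union of this open orbit, the $2$-dimensional orbit $PSL_2\cdot[u^5v]$ and the $1$-dimensional orbit $PSL_2\cdot[u^6]$. A sextic curve is a holomorphic curve $F:\mathbb P^1\to\mathcal V_5\subset\mathbb P^6$ of degree $6$, linearly full in $\mathbb P^6$, not contained in $\overline{PSL_2\cdot[u^5v]}$. It is in the generally ramified family if it is tangent to the $1$-dimensional orbit at some point where it meets that orbit; otherwise it is in the exceptional transversal family. A class of curves $g$ is said to belong to one of these families if the corresponding curves $F$ do. Points of $\mathbb P^3$ are nonzero $2\times2$ matrices $\begin{pmatrix} a & b \\ c & d \end{pmatrix}$ up to scale, and $f_1:\mathbb P^3\dashrightarrow\mathbb P(V_6)$ sends this matrix to $[(du-bv)(av-cu)((du-bv)^4-(av-cu)^4)]$; on $PSL_2$ it is the orbit map of $[uv(u^4-v^4)]$. $S_4^*\subset SU(2)$ is the binary octahedral group (order $48$) generated by $\mathrm{diag}(e^{\pi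 i/4},e^{-\pi i/4})$ and $\frac1{\sqrt2}\begin{pmatrix} 1 & -1 \\ 1 & 1 \end{pmatrix}$; its image in $PSL_2$ is the stabilizer of $[uv(u^4-v^4)]$. A branched covering $\varphi$ is Galois if its group $G=\{\sigma:\varphi\circ\sigma=\varphi\}$ has order $\deg\varphi$. A map $g:\mathbb P^1\to\mathbb P^3$ of degree $n$ is a $2\times2$ matrix of degree-$n$ forms in $x,y$ without common factor. It is a Galois lift of $F$ with covering $\varphi$ if $f_1\circ g=F\circ\varphi$ and the homomorphism $\sigma\mapsto g(\sigma(q))^{-1}g(q)$ (independent of generic $q$) from $G$ to the stabilizer of $[uv(u^4-v^4)]$ is injective. Two curves $g,\tilde g:\mathbb P^1\to\mathbb P^3$ are $PSL_2$-equivalent if $AgB^T=\tilde g$ for some $A\in SL_2$, $B\in S_4^*$. Möbius transformations may be applied to both copies of $\mathbb P^1$ (source and target of $\varphi$). $G(2,k)$ is the Grassmannian of $2$-planes in $\mathbb C^k$; a $2\times k$ matrix of rank $2$ denotes its row space. The bilinear inner product is $\sum_i p_iq_i$ (no conjugation). *)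

(* Defs.v *)
From mathcomp Require Import all_boot all_order all_algebra.
From mathcomp Require Import all_fingroup all_solvable.
From mathcomp Require Import complex reals.
(* The notations of mpoly and of mathcomp-analysis clash, hence no Import. *)
From mathcomp Require trigo.
From mathcomp Require Import mpoly.

Set Implicit Arguments.
Unset Strict Implicit.
Unset Printing Implicit Defensive.

Import Order.TTheory GRing.Theory Num.Theory.
Local Open Scope ring_scope.

(* A point of a projective space is a nonzero matrix up to [proj_eq]; a Moebius
   transformation is an element of [unitmx] up to [proj_eq], the matrix s acting
   on [x, y] by (x, y)^T |-> s (x, y)^T. *)
Definition proj_eq (K : fieldType) m k (a b : 'M[K]_(m, k)) : Prop :=
  exists2 c : K, c != 0 & a = c *: b.

(* A map from P^1 to the projective space of m x k matrices is a matrix of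
   forms in x = 'X_0 and y = 'X_1. *)
Definition no_common_factor (K : fieldType) m k
    (c : 'M[{mpoly K[2]}]_(m, k)) : Prop :=
  forall (h : {mpoly K[2]}) (c' : 'M[{mpoly K[2]}]_(m, k)),
    c = h *: c' -> (msize h <= 1)%N.

Definition holcurve (K : fieldType) m k (n : nat)
    (c : 'M[{mpoly K[2]}]_(m, k)) : Prop :=
  (forall i j, c i j \is n.-homog) /\ no_common_factor c.

(* Equality as rational maps. *)
Definition ratmap_eq (K : fieldType) m k
    (c c' : 'M[{mpoly K[2]}]_(m, k)) : Prop :=
  exists h h' : {mpoly K[2]}, [/\ h != 0, h' != 0 & h *: c = h' *: c'].

Definition eval_curve (K : fieldType) m k (c : 'M[{mpoly K[2]}]_(m, k))
    (q : 'rV[K]_2) : 'M[K]_(m, k) :=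
  map_mx (meval (q 0)) c.

(* The composite of c with phi : P^1 -> P^1. *)
Definition precomp (K : fieldType) m k (c : 'M[{mpoly K[2]}]_(m, k))
    (phi : 'rV[{mpoly K[2]}]_2) : 'M[{mpoly K[2]}]_(m, k) :=
  map_mx (comp_mpoly (mktuple (phi 0))) c.

Definition mobius (K : fieldType) (s : 'M[K]_2) : 'rV[{mpoly K[2]}]_2 :=
  \row_i \sum_j s i j *: 'X_j.

Definition deck (K : fieldType) (phi : 'rV[{mpoly K[2]}]_2)
    (s : 'M[K]_2) : Prop :=
  s \in unitmx /\ ratmap_eq (precomp phi (mobius s)) phi.

(* rho enumerates the deck group, as a subgroup of PGL_2, without repetition. *)
Definition deck_enum (K : fieldType) (I : finType)
    (phi : 'rV[{mpoly K[2]}]_2) (rho : I -> 'M[K]_2) : Prop :=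
  [/\ forall i, deck phi (rho i),
      forall i j, proj_eq (rho i) (rho j) -> i = j
    & forall s, deck phi s -> exists i, proj_eq s (rho i)].

Definition galois_covering (K : fieldType) (n : nat)
    (phi : 'rV[{mpoly K[2]}]_2) : Prop :=
  holcurve n phi /\ exists rho : 'I_n -> 'M[K]_2, deck_enum phi rho.

Definition deck_group_isog (K : fieldType) (gT : finGroupType)
    (phi : 'rV[{mpoly K[2]}]_2) : Prop :=
  exists2 rho : gT -> 'M[K]_2, deck_enum phi rho
    & forall a b : gT, proj_eq (rho (a * b)%g) (rho a *m rho b).

(* Forms in u = 'X_0 and v = 'X_1; V_6 is identified with K^7 through the
   coefficients of u^(6-i) v^i. *)
Definition coef6 (A : comNzRingType) (f : {mpoly A[2]}) : 'rV[A]_7 :=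
  \row_i f@_[multinom [tuple (6 - i)%N; nat_of_ord i]].

Definition act (K : fieldType) (a : 'M[K]_2) (f : {mpoly K[2]}) : {mpoly K[2]} :=
  f \mPo (mktuple (mobius (invmx a) 0)).

Definition octa (K : fieldType) : {mpoly K[2]} :=
  'X_0 * 'X_1 * ('X_0 ^+ 4 - 'X_1 ^+ 4).

Definition orbit (K : fieldType) (f : {mpoly K[2]}) (z : 'rV[K]_7) : Prop :=
  exists2 a : 'M[K]_2, \det a = 1 & proj_eq z (coef6 (act a f)).

(* Zariski closure of the orbit in P^6 (for an orbit over the complex numbers
   this is also the closure in the classical topology). *)
Definition orbit_closure (K : fieldType) (f : {mpoly K[2]})
    (z : 'rV[K]_7) : Prop :=
  forall (d : nat) (p : {mpoly K[7]}), p \is d.-homog ->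
    (forall z', orbit f z' -> p.@[z' 0] = 0) -> p.@[z 0] = 0.

Definition linearly_full (K : fieldType) k (F : 'rV[{mpoly K[2]}]_k) : Prop :=
  forall l : 'cV[K]_k,
    (forall q, q != 0 -> eval_curve F q *m l = 0) -> l = 0.

Definition sextic_curve (K : fieldType) (F : 'rV[{mpoly K[2]}]_7) : Prop :=
  [/\ holcurve 6 F,
      forall q, q != 0 -> orbit_closure (octa K) (eval_curve F q),
      linearly_full F
    & ~ forall q, q != 0 -> orbit_closure ('X_0 ^+ 5 * 'X_1) (eval_curve F q)].

(* The one-dimensional orbit as a parametrized curve: since the matrix
   (a, b; c, d) of determinant 1 maps u^6 to (d u - b v)^6, that orbit is the
   image of [x, y] |-> (x u + y v)^6. *)
Definition sixth_powers (K : fieldType) : 'rV[{mpoly K[2]}]_7 :=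
  coef6 ((('X_0 : {mpoly K[2]})%:MP * 'X_0
          + ('X_1 : {mpoly K[2]})%:MP * 'X_1) ^+ 6).

(* Its row space is the projective tangent line of c at an immersed point q; by
   Euler's formula it contains c(q). *)
Definition tangent_line (K : fieldType) k (c : 'rV[{mpoly K[2]}]_k)
    (q : 'rV[K]_2) : 'M[K]_(2, k) :=
  \matrix_(i, j) (c 0 j)^`M(i).@[q 0].

Definition generally_ramified (K : fieldType) (F : 'rV[{mpoly K[2]}]_7) : Prop :=
  exists q p : 'rV[K]_2,
    [/\ q != 0 /\ p != 0,
        orbit ('X_0 ^+ 6) (eval_curve F q),
        proj_eq (eval_curve F q) (eval_curve (sixth_powers K) p)
      & (tangent_line F q == tangent_line (sixth_powers K) p)%MS].

Definition exceptional_transversal (K : fieldType)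
    (F : 'rV[{mpoly K[2]}]_7) : Prop :=
  ~ generally_ramified F.

(* The rational map f_1, stated over any commutative ring so that it applies to
   matrices of scalars as well as to matrices of forms. *)
Definition f1 (A : comNzRingType) (m : 'M[A]_2) : 'rV[A]_7 :=
  let a := m 0 0 in let b := m 0 1 in let c := m 1 0 in let d := m 1 1 in
  let p := d%:MP * 'X_0 - b%:MP * 'X_1 in
  let q := a%:MP * 'X_1 - c%:MP * 'X_0 in
  coef6 (p * q * (p ^+ 4 - q ^+ 4)).

Definition octa_stab (K : fieldType) (b : 'M[K]_2) : Prop :=
  \det b = 1 /\ proj_eq (coef6 (act b (octa K))) (coef6 (octa K)).

(* b is, up to scale, the value of g(s(q))^-1 g(q) at generic q. *)
Definition monodromy (K : fieldType) (g : 'M[{mpoly K[2]}]_2)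
    (s b : 'M[K]_2) : Prop :=
  forall q : 'rV[K]_2,
    eval_curve g q \in unitmx -> eval_curve g (q *m s^T) \in unitmx ->
    proj_eq (invmx (eval_curve g (q *m s^T)) *m eval_curve g q) b.

Definition galois_lift (K : fieldType) (phi : 'rV[{mpoly K[2]}]_2)
    (F : 'rV[{mpoly K[2]}]_7) (n : nat) (g : 'M[{mpoly K[2]}]_2) : Prop :=
  [/\ holcurve n g,
      ratmap_eq (f1 g) (precomp F phi),
      \det g != 0
    & exists rho : 'M[K]_2 -> 'M[K]_2,
        [/\ forall s, deck phi s -> octa_stab (rho s) /\ monodromy g s (rho s),
            forall s s', deck phi s -> deck phi s' ->
              proj_eq (rho (s *m s')) (rho s *m rho s')
          & forall s s', deck phi s -> deck phi s' ->
              proj_eq (rho s) (rho s') -> proj_eq s s']].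

Definition expi (R : realType) (t : R) : R[i] :=
  (trigo.cos t +i* trigo.sin t)%C.

Inductive S4star (R : realType) : 'M[R[i]]_2 -> Prop :=
| S4star_diag :
    S4star (\matrix_(i, j) if i == j then
              (if i == 0 then expi (trigo.pi / 4) else expi (- (trigo.pi / 4)))
            else 0)
| S4star_rot :
    S4star (((Num.sqrt 2 : R)^-1)%:C%C *:
            \matrix_(i, j) if (i == 0) && (j == 1) then -1 else 1)
| S4star_one : S4star 1%:M
| S4star_mul a b of S4star a & S4star b : S4star (a *m b)
| S4star_inv a of S4star a : S4star (invmx a).

Definition psl2_equiv (R : realType) (g g' : 'M[{mpoly R[i][2]}]_2) : Prop :=
  exists a b : 'M[R[i]]_2,
    [/\ \det a = 1, S4star b
      & ratmap_eq (map_mx (@mpolyC 2 R[i]) a *m g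
                     *m (map_mx (@mpolyC 2 R[i]) b)^T) g'].

Definition alpha3 (K : fieldType) : {mpoly K[2]} :=
  2^-1 *: ('X_0 ^+ 3 - 'X_1 ^+ 3).
Definition beta3 (K : fieldType) : {mpoly K[2]} :=
  2^-1 *: ('X_0 ^+ 3 + 'X_1 ^+ 3).
Definition gamma (K : fieldType) : {mpoly K[2]} := 'X_0 * 'X_1.

(* [z0, z1] stands for the point z0 / z1 of the Riemann sphere. *)
Definition phi_D3 (K : fieldType) : 'rV[{mpoly K[2]}]_2 :=
  \row_(j < 2) if j == 0 then - alpha3 K ^+ 2 else gamma K ^+ 3.

Definition xi1 (R : realType) : R[i] := expi (trigo.pi / 4).
Definition nu1 (R : realType) : R[i] :=
  (-1 + 'i%C) / (1 - (Num.sqrt 3 : R)%:C%C).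
Definition nu2 (R : realType) : R[i] :=
  (-1 + 'i%C) / (1 + (Num.sqrt 3 : R)%:C%C).

Definition base_row (R : realType) (e : R[i]) : 'rV[{mpoly R[i][2]}]_3 :=
  let K := R[i] in
  let p := (e / xi1 R) *: 'X_1 + 'X_0 in
  let m := (e / xi1 R) *: 'X_1 - 'X_0 in
  \row_(j < 3) nth 0 [:: alpha3 K * beta3 K * p; gamma K ^+ 3 * m;
                         alpha3 K ^+ 2 * m] j.

Definition base_mx (R : realType) : 'M[{mpoly R[i][2]}]_(2, 3) :=
  \matrix_(i < 2) if i == 0 then base_row (nu1 R)
                  else (nu1 R)%:MP *: base_row (nu2 R).

Definition g_D3 (R : realType) (ab : 'M[R[i]]_(2, 3)) : 'M[{mpoly R[i][2]}]_2 :=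
  map_mx (@mpolyC 2 R[i]) ab *m (base_mx R)^T.

(* ab represents an element of G(2,3) perpendicular to the second row of
   [base_mx] at (x, y) = (t, 1). *)
Definition perp_plane (R : realType) (t : R[i]) (ab : 'M[R[i]]_(2, 3)) : Prop :=
  \rank ab = 2%N /\
  ab *m (eval_curve (row 1 (base_mx R))
           (\row_(j < 2) if j == 0 then t else 1))^T = 0.

Definition the_perp_plane (R : realType) (t : R[i])
    (ab : 'M[R[i]]_(2, 3)) : Prop :=
  perp_plane t ab /\ forall ab', perp_plane t ab' -> (ab' == ab)%MS.

(* Main.v *)
Require Import Defs.
From mathcomp Require Import all_boot all_order all_algebra.
From mathcomp Require Import all_fingroup all_solvable.
From mathcomp Require Import complex reals.
From mathcomp Require trigo.
From mathcomp Require Import mpoly.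
From mathcomp Require Import ring zify.
From Stdlib Require Import Classical.
Import Order.TTheory GRing.Theory Num.Theory.
Local Open Scope ring_scope.
Set Implicit Arguments.
Unset Strict Implicit.
Unset Printing Implicit Defensive.

(** Write K for the complex numbers, w for a primitive cube root of unity, xi
    for a fourth root of -1, and e0, e1 for the two numbers nu1 / xi and
    nu2 / xi; all that matters of the latter is that e0 e1 = 1 and
    (e0 + e1)^2 = -2.

    Both the deck group of the covering and its image under the monodromy are
    dihedral of order six, and in PGL_2 such a group is conjugate to the
    standard one, generated by the rotation [x, y] -> [w x, y] and the swap
    [x, y] -> [y, x] ([D3_normal]). On the source this makes the components of
    the covering invariant forms of degree six, hence linear combinations of
    alpha_3^2 and gamma^3 ([invariant_form], [covering_normal]). On the side of
    the octahedron, the octahedral sextic becomes a sextic that is invariant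
    under the standard group; up to scale there are only the two sextics
    x^6 - 5 s x^3 y^3 + y^6 with s^2 = -2, exchanged by y -> - y
    ([octa_D3_form]). Hence the standardizing matrix is the explicit [frame] up
    to a symmetry of the octahedron ([adapted_frame]), and the symmetries of
    the octahedron are the elements of S_4^* up to scale ([octa_inv_gen]). So
    one may suppose that the lift is the frame times a curve G of degree n with
    G(w x, y) = G(x, y) diag(w, 1) and G(y, x) = +- G(x, y) (0, 1; 1, 0), up to
    scalars ([lift_frame]).

    The degree comes from the determinant of G, a form of degree 2 n. Comparing
    degrees in f_1 o g = F o phi yields f_1(g) = h (F o phi) with h of degree
    6 n - 36 ([lift_relation]). The sextic f_1(g) is a product of six linear
    factors, one for each vertex of the octahedron, and a zero of h is a common
    zero of the two coefficients of one of them ([peel]). The resulting six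
    divisors of the determinant are pairwise coprime, and coprime to
    x y (x^6 - y^6), which divides the determinant because the eight branch
    points have nontrivial stabilizers. Therefore 6 n - 36 + 8 <= 2 n, that is,
    n <= 7 ([equiv_deg_bound]). The rotation rules out n = 6
    ([equiv_deg_mod]), so n = 7. Equivariant curves of degree seven form the
    family ab N, where N collects three basic covariants ([hD_normal]). As h
    has degree six, it has a zero; the dihedral group moves it to a zero
    [t, 1] at the vertex e1, and vanishing there says that ab is orthogonal to
    the direction of the statement ([vertex_transport]).

    The sextic curve is not tangent to the one-dimensional orbit
    ([not_ramified]). A point of contact lies below a zero of the determinant.
    If it lies below a branch point, the transvectants that cut out the orbit
    closure would force the invariant quadric to vanish to order four along F
    ([Qinv_order4]), hence to order eight upstairs, where it is the sixth power
    of a determinant with simple zeros. Below the other zeros the sextic has a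
    root of multiplicity exactly five ([vertex_factor]).

    Conversely, the coefficients of f_1 of a curve ab N times the frame are
    invariant forms of degree 42, hence forms of degree seven in the components
    of the covering, and they vanish at the image of [t, 1]; dividing by the
    linear form of that point leaves a curve F of degree six
    ([family_sextic]). It is linearly full for all but finitely many t, because
    at t = e1 a suitable renormalization degenerates to the rational normal
    curve of sixth powers ([det_fullmx]). Finally, equivalent members of the
    family have projectively equivalent determinants. The zeros of the
    determinant at the parameter t' include 0, infinity, 1 and t', so that t'
    is one of the finitely many cross ratios of the zeros of the determinant at
    t ([cross_ratio_fibre]). *)

(** * Binary forms *)

(** Pushes evaluations through the syntax of polynomials. Matching is
    syntactic: unification would unfold powers and determinants. *)
Ltac mev1 T v P :=
  let rw H := (pattern T; refine (@eq_ind_r _ _ _ _ T H); cbv beta) in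
  match P with
  | ?p + ?q => rw (mevalD v p q)
  | - ?p => rw (mevalN v p)
  | ?p * ?q => rw (mevalM v p q)
  | ?p ^+ ?k => rw (rmorphXn (meval v) k p : T = meval v p ^+ k)
  | ?c *: ?p => rw (mevalZ v c p)
  | mpolyC _ ?c => rw (mevalC v c)
  | mpolyX _ (mnm1 ?i) => rw (mevalXU v i)
  end.
Ltac mev := repeat match goal with
  |- context [@meval ?n ?R ?v ?P] => mev1 (@meval n R v P) v P
end.

Section BinaryForms.
Variable K : numClosedFieldType.
Implicit Types (f h : {mpoly K[2]}) (q r : 'rV[K]_2) (p : {poly K}) (a b c : K).

Definition pt a b : 'rV[K]_2 := \row_(j < 2) if j == 0 then a else b.

Lemma pt0 a b : pt a b 0 0 = a. Proof. by rewrite mxE. Qed.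
Lemma pt1 a b : pt a b 0 1 = b. Proof. by rewrite mxE. Qed.

Lemma ord2P (P : 'I_2 -> Prop) : P 0 -> P 1 -> forall i, P i.
Proof.
move=> P0 P1 i; have [-> //|i1] : i = 0 \/ i = 1; last by rewrite i1.
by case: i => [[|[|//]] lti]; [left | right]; apply/val_inj.
Qed.

Lemma pt_eta q : q = pt (q 0 0) (q 0 1).
Proof. by apply/rowP; apply: ord2P; rewrite !mxE. Qed.

Lemma pt_eq0 a b : (pt a b == 0) = (a == 0) && (b == 0).
Proof.
apply/eqP/andP => [/rowP e|[/eqP -> /eqP ->]].
  by have := e 0; have := e 1; rewrite !mxE /= => -> ->.
by apply/rowP; apply: ord2P; rewrite !mxE.
Qed.

Lemma pt_scale a b c : c *: pt a b = pt (c * a) (c * b).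
Proof. by apply/rowP; apply: ord2P; rewrite !mxE. Qed.

Lemma mevalXn (v : 'I_2 -> K) f n : (f ^+ n).@[v] = f.@[v] ^+ n.
Proof. exact: rmorphXn. Qed.

Lemma poly_nonroot p : p != 0 -> exists x : K, p.[x] != 0.
Proof.
move=> p0; pose s : seq K := [seq i%:R | i <- iota 0 (size p)].
case: (boolP (all (root p) s)) => [|/allPn[x _ px]]; last by exists x.
move=> /(max_poly_roots p0); rewrite size_map size_iota ltnn => H.
suff: false by []; apply: H.
rewrite map_inj_in_uniq ?iota_uniq // => i j _ _ /eqP.
by rewrite Num.Theory.eqr_nat => /eqP.
Qed.

Lemma poly_eval0 p : (forall x : K, p.[x] = 0) -> p = 0.
Proof.
move=> p0; apply/eqP/negPn/negP => /poly_nonroot[x].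
by rewrite p0 eqxx.
Qed.

Lemma poly_eval_inj p1 p2 : (forall x : K, p1.[x] = p2.[x]) -> p1 = p2.
Proof.
move=> e; apply/eqP; rewrite -subr_eq0; apply/eqP/poly_eval0 => x.
by rewrite hornerD hornerN e subrr.
Qed.

Definition bform n p : {mpoly K[2]} :=
  \sum_(i < n.+1) p`_i *: ('X_0 ^+ i * 'X_1 ^+ (n - i)).

Lemma bform_eval n p q :
  (bform n p).@[q 0] = \sum_(i < n.+1) p`_i * (q 0 0 ^+ i * q 0 1 ^+ (n - i)).
Proof.
rewrite raddf_sum; apply: eq_bigr => i _ /=.
by rewrite mevalZ mevalM !rmorphXn /= !mevalXU.
Qed.

Lemma bform_pt1 n p a : (size p <= n.+1)%N -> (bform n p).@[pt a 1 0] = p.[a].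
Proof.
move=> sp; rewrite bform_eval (horner_coef_wide _ sp); apply: eq_bigr => i _.
by rewrite pt0 pt1 expr1n mulr1.
Qed.

Lemma X_homog (i : 'I_2) : ('X_i : {mpoly K[2]}) \is 1.-homog.
Proof. by rewrite dhomogX /= mdeg1. Qed.

Lemma homogX1 n f : f \is 1.-homog -> f ^+ n \is n.-homog.
Proof. by move=> /(dhomogMn n); rewrite mul1n. Qed.

Lemma bform_homog n p : bform n p \is n.-homog.
Proof.
apply: rpred_sum => i _; apply: rpredZ.
have := dhomogM (homogX1 i (X_homog 0)) (homogX1 (n - i) (X_homog 1)).
by rewrite subnKC // -ltnS.
Qed.

Lemma bformP n f : f \is n.-homog ->
  exists2 p : {poly K}, (size p <= n.+1)%N & f = bform n p.
Proof.
move=> /dhomogP hf; rewrite [f]mpolyE big_seq.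
apply: (big_ind (fun g => exists2 p : {poly K}, (size p <= n.+1)%N & g = bform n p)).
- exists 0; rewrite ?size_poly0 // /bform big1 // => i _.
  by rewrite coef0 scale0r.
- move=> _ _ [p sp ->] [r sr ->]; exists (p + r).
    by rewrite (leq_trans (size_polyD _ _)) // geq_max sp sr.
  by rewrite -big_split; apply: eq_bigr => i _; rewrite coefD scalerDl.
move=> m /hf /= dm; exists (f@_m *: 'X^(m ord0)).
  rewrite (leq_trans (size_scale_leq _ _)) // size_polyXn ltnS.
  by rewrite -dm mdegE (bigD1 ord0) //= leq_addr.
have m0 : (m ord0 < n.+1)%N by rewrite ltnS -dm mdegE (bigD1 ord0) //= leq_addr.
have m1 : m (1 : 'I_2) = (n - m ord0)%N.
  rewrite -dm mdegE !big_ord_recl big_ord0 addn0 addKn.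
  by congr (fun_of_multinom m _); apply/val_inj.
rewrite /bform (bigD1 (Ordinal m0)) //= big1 ?addr0.
  rewrite coefZ coefXn eqxx mulr1; congr (_ *: _).
  rewrite mpolyXE_id !big_ord_recl big_ord0 mulr1 -m1.
  by congr (_ ^+ _ * _); congr ('X_ _ ^+ fun_of_multinom m _); apply/val_inj.
move=> i; rewrite -val_eqE /= => ne; rewrite coefZ coefXn (negPf ne).
by rewrite mulr0 scale0r.
Qed.

Lemma form_eval0 n f : f \is n.-homog ->
  (forall q, f.@[q 0] = 0) -> f = 0.
Proof.
move=> /bformP[p sp ->] f0; suff -> : p = 0.
  by rewrite /bform big1 // => i _; rewrite coef0 scale0r.
by apply: poly_eval0 => x; rewrite -(bform_pt1 x sp).
Qed.

Lemma form_scale n f q c : f \is n.-homog ->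
  f.@[(c *: q) 0] = c ^+ n * f.@[q 0].
Proof.
move=> /bformP[p _ ->]; rewrite !bform_eval mulr_sumr; apply: eq_bigr => i _.
rewrite !mxE !exprMn -[in c ^+ n](subnKC (ltn_ord i : (i <= n)%N)) exprD.
by ring.
Qed.

Lemma mpoly_eval0 f : (forall q, f.@[q 0] = 0) -> f = 0.
Proof.
move=> f0; rewrite (@pihomog_partitionE _ _ mdeg (msize f) f) //.
rewrite big1 // => i _; apply: (@form_eval0 i); first exact: pihomogP.
move=> q; pose p := \poly_(j < msize f) (pihomog mdeg j f).@[q 0].
suff p0 : p = 0.
  by have := congr1 (coefp i) p0; rewrite /= coef_poly ltn_ord coef0.
apply: poly_eval0 => c; have := f0 (c *: q).
rewrite [in X in X -> _](@pihomog_partitionE _ _ mdeg (msize f) f) //.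
rewrite raddf_sum /= horner_poly => {2}<-; apply: eq_bigr => j _.
by rewrite (form_scale _ _ (pihomogP mdeg j f)) mulrC.
Qed.

Lemma mpoly_eval_inj f h : (forall q, f.@[q 0] = h.@[q 0]) -> f = h.
Proof.
move=> e; apply/eqP; rewrite -subr_eq0; apply/eqP/mpoly_eval0 => q.
by rewrite mevalB e subrr.
Qed.

(** The linear form whose only zero is q. *)
Definition lin q : {mpoly K[2]} := q 0 1 *: 'X_0 - q 0 0 *: 'X_1.

Lemma lin_homog q : lin q \is 1.-homog.
Proof. by apply: rpredB; apply: rpredZ; apply: X_homog. Qed.

Lemma lin_eval q r : (lin q).@[r 0] = q 0 1 * r 0 0 - q 0 0 * r 0 1.
Proof. by rewrite mevalB !mevalZ !mevalXU. Qed.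

Lemma lin_self q : (lin q).@[q 0] = 0.
Proof. by rewrite lin_eval mulrC subrr. Qed.

Lemma lin_eval_eq0 q r : q != 0 -> (lin q).@[r 0] = 0 -> exists c, r = c *: q.
Proof.
rewrite lin_eval (pt_eta q) (pt_eta r) pt_eq0 !pt0 !pt1 negb_and.
move: (q 0 0) (q 0 1) (r 0 0) (r 0 1) => a b x y ab0 e.
case: (eqVneq a 0) ab0 e => [-> b0|a0 _] e; [exists (y / b) | exists (x / a)];
  rewrite pt_scale; apply/eqP; rewrite -subr_eq0; apply/eqP.
- have x0 : x = 0.
    move/eqP: e; rewrite mul0r subr0 mulf_eq0 (negPf b0) /=; by move/eqP.
  by rewrite x0 mulr0 divfK // subrr.
apply/rowP; apply: ord2P; rewrite !mxE /= ?divfK ?subrr //.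
apply: (mulfI a0); rewrite mulr0; move/eqP: e; rewrite subr_eq0 => /eqP e.
by rewrite mulrBr -e mulrA mulrCA divff // mulr1 [b * x]mulrC subrr.
Qed.

Lemma lin_neq0 q : q != 0 -> lin q != 0.
Proof.
apply: contra_neq => l0; rewrite (pt_eta q).
have := lin_eval q (pt 1 0); have := lin_eval q (pt 0 1).
rewrite l0 !meval0 !pt0 !pt1 !mulr0 !mulr1 subr0 sub0r => /esym/eqP.
rewrite oppr_eq0 => /eqP -> <-.
by apply/rowP; apply: ord2P; rewrite !mxE.
Qed.

Lemma form_const f : f \is 0.-homog -> exists c, f = c%:MP.
Proof.
move=> /bformP[p _ ->]; exists p`_0; rewrite /bform big_ord1 /= subnn !expr0 mulr1.
by rewrite -mul_mpolyC mulr1.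
Qed.

Lemma form_factor n f q : q != 0 -> f \is n.+1.-homog -> f.@[q 0] = 0 ->
  exists2 h, h \is n.-homog & f = lin q * h.
Proof.
move=> q0 hf f0; have [p sp ef] := bformP hf.
case: (eqVneq (q 0 1) 0) => [q1|q1].
  have q00 : q 0 0 != 0.
    by apply: contraNneq q0 => q00; rewrite (pt_eta q) q00 q1 pt_eq0 eqxx.
  have pn : p`_n.+1 = 0.
    move: f0; rewrite ef bform_eval big_ord_recr big1 /= => [|i _]; last first.
      by rewrite q1 expr0n subn_eq0 leqNgt (ltn_ord i) !mulr0.
    rewrite add0r subnn expr0 mulr1 => /eqP; rewrite mulf_eq0 expf_eq0.
    by rewrite (negPf q00) orbF => /eqP.
  exists (- (q 0 0)^-1 *: bform n p); first by apply/rpredZ/bform_homog.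
  apply: mpoly_eval_inj => r; rewrite ef mevalM mevalZ lin_eval q1 !bform_eval.
  rewrite big_ord_recr /= pn mul0r addr0 mul0r sub0r !mulrA mulrNN.
  rewrite [q 0 0 * _]mulrC mulfK // mulr_sumr; apply: eq_bigr => i _.
  rewrite subSn ?exprS; last by rewrite -ltnS.
  by ring.
have : root p (q 0 0 / q 0 1).
  apply/eqP; rewrite -(bform_pt1 _ sp) -ef.
  have -> : pt (q 0 0 / q 0 1) 1 = (q 0 1)^-1 *: q.
    by rewrite {4}(pt_eta q) pt_scale mulVf // mulrC.
  by rewrite (form_scale _ _ hf) f0 mulr0.
move=> /factor_theorem[r er].
have sr : (size r <= n.+1)%N.
  case: (eqVneq r 0) => [->|r0]; first by rewrite size_poly0.
  by move: sp; rewrite er size_Mmonic ?monicXsubC // size_XsubC addn2.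
exists ((q 0 1)^-1 *: bform n r); first by apply/rpredZ/bform_homog.
suff hp : bform n.+1 p = ((q 0 1)^-1 *: lin q) * bform n r.
  by rewrite ef hp -scalerAl scalerAr.
apply/eqP; rewrite -subr_eq0; apply/eqP/(@form_eval0 n.+1).
  apply: rpredB; first exact: bform_homog.
  by rewrite -[n.+1]add1n; apply: dhomogM; rewrite ?bform_homog // rpredZ ?lin_homog.
move=> s; rewrite mevalB mevalM mevalZ lin_eval !bform_eval.
set u := _ / _ in er; have eu : q 0 0 = u * q 0 1 by rewrite /u divfK.
rewrite eu; set x : K := s 0 0; set y : K := s 0 1.
rewrite er mulrBr; under eq_bigr => i _ do
  rewrite coefB coefMX coefMC mulrBl.
rewrite sumrB big_ord_recl /= mul0r add0r.
rewrite [X in _ - X - _]big_ord_recr /=.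
rewrite [r`_n.+1]nth_default // !mul0r addr0.
have -> : (q 0 1)^-1 * (q 0 1 * x - u * q 0 1 * y) = x - u * y.
  by field.
rewrite mulrBl !mulr_sumr -!sumrB.
rewrite big1 // => i _; rewrite /bump /= add1n subSS.
rewrite subSn ?[in y ^+ _.+1]exprS; last by rewrite -ltnS.
by rewrite exprS; ring.
Qed.

Lemma form_zero n f : f \is n.+1.-homog ->
  exists2 q : 'rV[K]_2, q != 0 & f.@[q 0] = 0.
Proof.
move=> hf; have [p sp ef] := bformP hf.
have [p1|p1] := eqVneq (size p) n.+2; last first.
  exists (pt 1 0); first by rewrite pt_eq0 oner_eq0.
  have pn : p`_n.+1 = 0.
    by rewrite nth_default // -ltnS ltn_neqAle p1.
  rewrite ef bform_eval big_ord_recr /= pn mul0r addr0 big1 // => i _.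
  by rewrite pt1 expr0n subn_eq0 leqNgt (ltn_ord i) !mulr0.
have /closed_rootP[x /eqP px] : size p != 1%N by rewrite p1.
exists (pt x 1); first by rewrite pt_eq0 oner_eq0 andbF.
by rewrite ef bform_pt1.
Qed.

Lemma form_deg_pos n f q : f != 0 -> q != 0 -> f \is n.-homog ->
  f.@[q 0] = 0 -> exists m, n = m.+1.
Proof.
case: n => [|n]; last by exists n.
move=> f0 _ /form_const[c ef]; move: f0; rewrite ef mevalC => f0 e.
by rewrite e mpolyC0 eqxx in f0.
Qed.

End BinaryForms.

(** * Divisibility and common zeros *)

Section Divisibility.
Variable K : numClosedFieldType.
Implicit Types (f h d e : {mpoly K[2]}) (q r : 'rV[K]_2) (p : {poly K}).

(** Induction on the zeros of d: at a zero of d some b i is nonzero, so that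
    e vanishes there too, and the common linear factor can be cancelled. *)
Lemma form_dvd_of_cross n m (I : Type) d e (a b : I -> {mpoly K[2]}) :
  d \is n.-homog -> e \is m.-homog -> d != 0 -> e != 0 ->
  (forall q, q != 0 -> d.@[q 0] = 0 -> exists i, (b i).@[q 0] != 0) ->
  (forall i, d * a i = e * b i) ->
  exists c, [/\ (n <= m)%N, c \is (m - n).-homog & e = d * c].
Proof.
elim: n m d e => [|n IH] m d e hd he d0 e0 nz ab.
  have [c ed] := form_const hd; exists (c^-1 *: e).
  have c0 : c != 0 by apply: contraNneq d0 => c0; rewrite ed c0 mpolyC0.
  rewrite leq0n subn0; split=> //; first by apply: rpredZ.
  by rewrite ed mul_mpolyC scalerA divff // scale1r.
have [q q0 dq] := form_zero hd.
have [i bi] := nz q q0 dq.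
have eq0 : e.@[q 0] = 0.
  have := congr1 (meval (q 0)) (ab i); rewrite /= !mevalM dq mul0r.
  by move=> /esym/eqP; rewrite mulf_eq0 (negPf bi) orbF => /eqP.
have [m' em] := form_deg_pos e0 q0 he eq0; subst m.
have [d' hd' ed] := form_factor q0 hd dq.
have [e' he' ee] := form_factor q0 he eq0.
have d'0 : d' != 0 by apply: contraNneq d0 => z; rewrite ed z mulr0.
have e'0 : e' != 0 by apply: contraNneq e0 => z; rewrite ee z mulr0.
have [||c [lenm hc ec]] := IH m' d' e' hd' he' d'0 e'0.
- by move=> s s0 ds; apply: nz => //; rewrite ed mevalM ds mulr0.
- move=> j; apply: (mulfI (lin_neq0 q0)).
  by rewrite !mulrA -ed -ee ab.
by exists c; rewrite subSS; split=> //; rewrite ee ec ed mulrA.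
Qed.

(** Over an algebraically closed field, a system of binary forms without
    common zero is the same as one without common factor ([nocf_nocz],
    [nocz_nocf]); zeros are what evaluation arguments can see. *)
Definition nocz m k (c : 'M[{mpoly K[2]}]_(m, k)) :=
  forall q, q != 0 -> eval_curve c q != 0.

Lemma nocz_entry m k (c : 'M[{mpoly K[2]}]_(m, k)) q : nocz c -> q != 0 ->
  exists ij, (c ij.1 ij.2).@[q 0] != 0.
Proof.
move=> nc /nc /eqP cq.
case: (boolP [exists ij : 'I_m * 'I_k, (c ij.1 ij.2).@[q 0] != 0]).
  by move=> /existsP.
move=> /existsPn H; case: cq; apply/matrixP => i j; rewrite !mxE.
by apply/eqP; have := H (i, j); rewrite negbK.
Qed.

(** Cross-multiplying with a coordinate of b turns the proportionality into
    divisibility by that coordinate, with a quotient that serves all entries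
    at once. *)
Lemma ratmap_homog m k n1 n2 (a b : 'M[{mpoly K[2]}]_(m, k)) :
  (forall i j, a i j \is n1.-homog) -> (forall i j, b i j \is n2.-homog) ->
  nocz b -> ratmap_eq a b ->
  exists c, [/\ (n2 <= n1)%N, c \is (n1 - n2).-homog, c != 0 & a = c *: b].
Proof.
move=> ha hb nb [h [h' [h0 h'0 eab]]].
have q0 : pt (1 : K) 0 != 0 by rewrite pt_eq0 oner_eq0.
have [[k1 k2] /= bk] := nocz_entry nb q0.
have e i j : h * a i j = h' * b i j.
  by have := congr1 (fun M : 'M_(m, k) => M i j) eab; rewrite /= !mxE.
have bk0 : b k1 k2 != 0 by apply: contraNneq bk => ->; rewrite meval0.
have ak0 : a k1 k2 != 0.
  have : h' * b k1 k2 != 0 by rewrite mulf_neq0.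
  by rewrite -e; apply: contraNneq => ->; rewrite mulr0.
have cr ij : b k1 k2 * a ij.1 ij.2 = a k1 k2 * b ij.1 ij.2.
  apply: (mulfI h0); rewrite mulrCA e mulrA [h * _]mulrA e.
  by rewrite [b _ _ * h']mulrC.
have [|c [le hc ec]] := form_dvd_of_cross (hb _ _) (ha _ _) bk0 ak0 _ cr.
  by move=> q qn0 _; apply: nocz_entry.
exists c; split=> //; first by apply: contraNneq ak0 => c0; rewrite ec c0 mulr0.
apply/matrixP => i j; rewrite mxE; apply: (mulfI bk0).
by rewrite (cr (i, j)) ec mulrA.
Qed.

Lemma ratmap_homog_eq m k n (a b : 'M[{mpoly K[2]}]_(m, k)) :
  (forall i j, a i j \is n.-homog) -> (forall i j, b i j \is n.-homog) ->
  nocz b -> ratmap_eq a b -> exists2 c : K, c != 0 & a = c%:MP *: b.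
Proof.
move=> ha hb nb /(ratmap_homog ha hb nb)[c [_]]; rewrite subnn.
move=> /form_const[c' ->] c0 ->; exists c' => //.
by apply: contraNneq c0 => ->; rewrite mpolyC0.
Qed.

Lemma eval_curveZ m k c (b : 'M[{mpoly K[2]}]_(m, k)) q :
  eval_curve (c *: b) q = c.@[q 0] *: eval_curve b q.
Proof. by apply/matrixP => i j; rewrite !mxE mevalM. Qed.

Lemma eval_curve_inj m k (a b : 'M[{mpoly K[2]}]_(m, k)) :
  (forall q, eval_curve a q = eval_curve b q) -> a = b.
Proof.
move=> e; apply/matrixP => i j; apply: mpoly_eval_inj => q.
by have := congr1 (fun M : 'M_(m, k) => M i j) (e q); rewrite /= !mxE.
Qed.

Lemma nocf_nocz m k n (c : 'M[{mpoly K[2]}]_(m, k)) :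
  holcurve n c -> nocz c.
Proof.
move=> [hc nf] q q0; apply/eqP => cq.
have cij i j : (c i j).@[q 0] = 0.
  by have := congr1 (fun M : 'M_(m, k) => M i j) cq; rewrite /= !mxE.
have [c' ec] : exists c', c = lin q *: c'.
  have [F ef] : exists F : 'I_m * 'I_k -> {mpoly K[2]},
      forall ij, c ij.1 ij.2 = lin q * F ij.
    apply: (@fin_all_exists _ (fun _ => {mpoly K[2]})
      (fun ij u => c ij.1 ij.2 = lin q * u)) => -[i j] /=.
    have [->|c0] := eqVneq (c i j) 0; first by exists 0; rewrite mulr0.
    have [n' en] := form_deg_pos c0 q0 (hc i j) (cij i j).
    have hij := hc i j; rewrite en in hij.
    by have [h _ eh] := form_factor q0 hij (cij i j); exists h.
  exists (\matrix_(i, j) F (i, j)); apply/matrixP => i j.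
  by rewrite !mxE (ef (i, j)).
have := nf _ _ ec; rewrite leqNgt => /negP; apply.
have l0 := lin_neq0 q0; rewrite -(mlead_deg l0) ltnS.
have := mlead_supp l0; move: (lin_homog q) => /dhomogP H /H /= ->.
by [].
Qed.

(** Binary polynomials have no zero divisors, so the components of top degree
    multiply to the top component; this replaces the factors of a form, which
    may be arbitrary polynomials, by forms. *)
Lemma form_top n h f : h * f != 0 -> h * f \is n.-homog ->
  ((msize h).-1 <= n)%N /\
  h * f = pihomog mdeg (msize h).-1 h * pihomog mdeg (n - (msize h).-1) f.
Proof.
move=> hf0 hom_hf.
have [h0 f0] : h != 0 /\ f != 0 by move: hf0; rewrite mulf_eq0 negb_or => /andP.
have en : n = ((msize h).-1 + (msize f).-1)%N.
  have s : msize (h * f) = n.+1.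
    rewrite -(mlead_deg hf0); congr S.
    by have := mlead_supp hf0; move: hom_hf => /dhomogP H /H.
  have : n.+1 = (msize h + msize f).-1.
    by rewrite -s; apply: msizeM_proper; rewrite mulf_neq0 // mleadc_eq0.
  by rewrite -(mlead_deg h0) -(mlead_deg f0); lia.
set d := (msize h).-1 in en *; set e := (msize f).-1 in en.
have eh : h = \sum_(i < d.+1) pihomog mdeg i h.
  by apply: pihomog_partitionE; rewrite /d; case: (msize h).
have ef : f = \sum_(i < e.+1) pihomog mdeg i f.
  by apply: pihomog_partitionE; rewrite /e; case: (msize f).
split; first by rewrite en leq_addr.
rewrite -{1}(pihomog_dE hom_hf) {1}eh {1}ef big_distrlr /= raddf_sum /=.
have hij i j : pihomog mdeg i h * pihomog mdeg j f \is (i + j).-homog.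
  by apply: dhomogM; apply: pihomogP.
rewrite big_ord_recr /= big1 ?add0r => [|i _]; last first.
  rewrite raddf_sum big1 // => j _ /=; rewrite (pihomog_ne0 _ (hij i j)) //.
  by rewrite en; apply/eqP; have := ltn_ord i; have := ltn_ord j; lia.
rewrite raddf_sum big_ord_recr /= big1 ?add0r => [|i _]; last first.
  rewrite (pihomog_ne0 _ (hij d i)) //.
  by rewrite en; apply/eqP; have := ltn_ord i; lia.
by rewrite {2}en addKn pihomog_dE // en.
Qed.

Lemma homog_quot n m h f : h * f != 0 -> h \is n.-homog -> h * f \is m.-homog ->
  (n <= m)%N /\ f \is (m - n).-homog.
Proof.
move=> hf0 hh hhf; have [le e] := form_top hf0 hhf.
have h0 : h != 0 by move: hf0; rewrite mulf_eq0 negb_or => /andP[].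
have sn : (msize h).-1 = n.
  rewrite -(mlead_deg h0) /=.
  by have := mlead_supp h0; move: hh => /dhomogP H /H.
rewrite sn in le e; split=> //; move: e; rewrite (pihomog_dE hh) => /(mulfI h0) ->.
exact: pihomogP.
Qed.

Lemma nocz_nocf m k n (c : 'M[{mpoly K[2]}]_(m, k)) :
  (forall i j, c i j \is n.-homog) -> nocz c -> holcurve n c.
Proof.
move=> hc nc; split=> // h c' ec; case: leqP => // sh.
have q0 : pt (1 : K) 0 != 0 by rewrite pt_eq0 oner_eq0.
have ecij i j : c i j = h * c' i j by rewrite ec mxE.
pose hd := pihomog mdeg (msize h).-1 h.
have hhd : hd \is (msize h).-2.+1.-homog.
  by rewrite (_ : (msize h).-2.+1 = (msize h).-1) ?pihomogP //; lia.
have [q qn0 hq] := form_zero hhd.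
have [[i j] /= /negP[]] := nocz_entry nc qn0.
have [->|cij0] := eqVneq (c i j) 0; first by rewrite meval0.
have hh := hc i j; rewrite ecij in hh cij0 *.
by have [_ ->] := form_top cij0 hh; rewrite mevalM -/hd hq mul0r.
Qed.

Definition coprimeF f h := forall q, q != 0 -> f.@[q 0] = 0 -> h.@[q 0] != 0.

(** Coprimality is by zeros, so the second quotient is divisible by f because
    of [form_dvd_of_cross]. *)
Lemma dvdF_mul n m N f h d : f \is n.-homog -> h \is m.-homog ->
  d \is N.-homog -> d != 0 -> coprimeF f h ->
  (exists d1, d = f * d1) -> (exists d2, d = h * d2) ->
  exists d3, d = f * h * d3.
Proof.
move=> hf hh hd d0 co [d1 e1] [d2 e2].
have f0 : f != 0 by apply: contraNneq d0 => z; rewrite e1 z mul0r.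
have d20 : d2 != 0 by apply: contraNneq d0 => z; rewrite e2 z mulr0.
have hd2 : d2 \is (N - m).-homog.
  rewrite e2 in d0 hd; exact: (homog_quot d0 hh hd).2.
have [q q0 fq||c [_ _ ec]] := @form_dvd_of_cross _ _ unit _ _
   (fun _ => d1) (fun _ => h) hf hd2 f0 d20.
- by exists tt; apply: co.
- by move=> _; rewrite -e1 e2 mulrC.
by exists c; rewrite e2 ec mulrA [h * f]mulrC.
Qed.

End Divisibility.

(** * Binary sextics *)

Section SexticsRing.
Variable A : comNzRingType.

Lemma mon2E (i j : nat) :
  ('X_0 ^+ i * 'X_1 ^+ j : {mpoly A[2]}) = 'X_[[multinom [tuple i; j]]].
Proof.
rewrite [RHS]mpolyXE_id !big_ord_recl big_ord0 mulr1 !mnm_tnth /=.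
by have -> : lift ord0 ord0 = 1 :> 'I_2 by apply/val_inj.
Qed.

Lemma coef6_sum (c : 'I_7 -> A) :
  coef6 (\sum_(i < 7) (c i)%:MP * ('X_0 ^+ (6 - i) * 'X_1 ^+ i)) = \row_i c i.
Proof.
apply/rowP => j; rewrite !mxE raddf_sum /= (bigD1 j) //= big1 ?addr0.
  by rewrite mcoeffCM mon2E mcoeffX; case: eqP => // _; rewrite mulr1.
move=> i ij; rewrite mcoeffCM mon2E mcoeffX; case: eqP; rewrite ?mulr0 //.
move=> /(congr1 (fun m : 'X_{1..2} => m (1 : 'I_2))); rewrite !mnm_tnth /=.
by move=> /eqP; rewrite (inj_eq val_inj) (negPf ij).
Qed.

Definition row7 (z0 z1 z2 z3 z4 z5 z6 : A) : 'rV[A]_7 :=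
  \row_i nth 0 [:: z0; z1; z2; z3; z4; z5; z6] i.

Lemma coef6_row7 z0 z1 z2 z3 z4 z5 z6 :
  coef6 (z0%:MP * 'X_0 ^+ 6 + z1%:MP * ('X_0 ^+ 5 * 'X_1)
    + z2%:MP * ('X_0 ^+ 4 * 'X_1 ^+ 2) + z3%:MP * ('X_0 ^+ 3 * 'X_1 ^+ 3)
    + z4%:MP * ('X_0 ^+ 2 * 'X_1 ^+ 4) + z5%:MP * ('X_0 * 'X_1 ^+ 5)
    + z6%:MP * 'X_1 ^+ 6) = row7 z0 z1 z2 z3 z4 z5 z6.
Proof.
rewrite -[RHS](coef6_sum (fun i => nth 0 [:: z0; z1; z2; z3; z4; z5; z6] i)).
congr (coef6 _); rewrite !big_ord_recl big_ord0 /= addr0 /bump /=.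
by rewrite !expr0 !expr1 !mulr1 mul1r !addrA.
Qed.

Lemma f1E (m : 'M[A]_2) :
  let a := m 0 0 in let b := m 0 1 in let c := m 1 0 in let d := m 1 1 in
  f1 m = row7
   (d * c ^+ 5 - d ^+ 5 * c)
   (d ^+ 5 * a + 5 * d ^+ 4 * b * c - 5 * d * c ^+ 4 * a - b * c ^+ 5)
   (- 5 * d ^+ 4 * b * a - 10 * d ^+ 3 * b ^+ 2 * c
      + 10 * d * c ^+ 3 * a ^+ 2 + 5 * b * c ^+ 4 * a)
   (10 * d ^+ 3 * b ^+ 2 * a + 10 * d ^+ 2 * b ^+ 3 * c
      - 10 * d * c ^+ 2 * a ^+ 3 - 10 * b * c ^+ 3 * a ^+ 2)
   (- 10 * d ^+ 2 * b ^+ 3 * a - 5 * d * b ^+ 4 * c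
      + 5 * d * c * a ^+ 4 + 10 * b * c ^+ 2 * a ^+ 3)
   (5 * d * b ^+ 4 * a + b ^+ 5 * c - d * a ^+ 5 - 5 * b * c * a ^+ 4)
   (b * a ^+ 5 - b ^+ 5 * a).
Proof.
rewrite /f1 /=; move: (m 0 0) (m 0 1) (m 1 0) (m 1 1) => a b c d.
by rewrite -coef6_row7; congr (coef6 _); ring.
Qed.

Definition zc (z : 'rV[A]_7) k : A := z 0 (inord k).

Lemma zc_row7 z0 z1 z2 z3 z4 z5 z6 k : (k < 7)%N ->
  zc (row7 z0 z1 z2 z3 z4 z5 z6) k = nth 0 [:: z0; z1; z2; z3; z4; z5; z6] k.
Proof. by move=> k7; rewrite /zc mxE inordK. Qed.

Lemma row7_eta z :
  z = row7 (zc z 0) (zc z 1) (zc z 2) (zc z 3) (zc z 4) (zc z 5) (zc z 6).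
Proof.
apply/rowP => i; rewrite mxE /zc; case: i => [[|[|[|[|[|[|[|//]]]]]]] lti] /=;
  by congr (z _ _); apply/val_inj; rewrite /= inordK.
Qed.

(** The invariant quadratic form of binary sextics, up to scale. *)
Definition Qinv (z : 'rV[A]_7) : A :=
  120 * zc z 0 * zc z 6 - 20 * zc z 1 * zc z 5
  + 8 * zc z 2 * zc z 4 - 3 * zc z 3 ^+ 2.

(** Three of the five coefficients of the fourth transvectant of a sextic with
    itself, which is the covariant whose vanishing cuts out the closure of the
    octahedral orbit. *)
Definition trv0 (z : 'rV[A]_7) : A :=
  10 * zc z 0 * zc z 4 - 5 * zc z 1 * zc z 3 + 2 * zc z 2 ^+ 2.
Definition trv1 (z : 'rV[A]_7) : A :=
  25 * zc z 0 * zc z 5 - 5 * zc z 1 * zc z 4 + zc z 2 * zc z 3.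
Definition trv2 (z : 'rV[A]_7) : A :=
  50 * zc z 0 * zc z 6 - 2 * zc z 2 * zc z 4 + zc z 3 ^+ 2.

Lemma det22 (m : 'M[A]_2) : \det m = m 0 0 * m 1 1 - m 0 1 * m 1 0.
Proof.
rewrite (expand_det_row _ 0) !big_ord_recl big_ord0 addr0.
rewrite /cofactor !det_mx11 !mxE /= !addn0 expr0 mul1r.
have -> : lift ord0 ord0 = 1 :> 'I_2 by apply/val_inj.
have -> : lift 1 0 = 0 :> 'I_2 by apply/val_inj.
have -> : ord0 = 0 :> 'I_2 by [].
by rewrite expr1 mulN1r mulrN.
Qed.

Lemma Qinv_f1 (m : 'M[A]_2) : Qinv (f1 m) = 20 * \det m ^+ 6.
Proof. by rewrite f1E det22 /Qinv !zc_row7 //=; ring. Qed.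

Lemma trv0_f1 (m : 'M[A]_2) : trv0 (f1 m) = 0.
Proof. by rewrite f1E /trv0 !zc_row7 //=; ring. Qed.
Lemma trv1_f1 (m : 'M[A]_2) : trv1 (f1 m) = 0.
Proof. by rewrite f1E /trv1 !zc_row7 //=; ring. Qed.
Lemma trv2_f1 (m : 'M[A]_2) : trv2 (f1 m) = 0.
Proof. by rewrite f1E /trv2 !zc_row7 //=; ring. Qed.

End SexticsRing.

Lemma f1_map (A B : comNzRingType) (h : {rmorphism A -> B}) (m : 'M[A]_2) :
  map_mx h (f1 m) = f1 (map_mx h m).
Proof.
rewrite !f1E !mxE; apply/rowP => i; rewrite !mxE.
case: i => [[|[|[|[|[|[|[|//]]]]]]] _] /=; ring.
Qed.

Lemma Qinv_map (A B : comNzRingType) (h : {rmorphism A -> B}) (z : 'rV[A]_7) :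
  Qinv (map_mx h z) = h (Qinv z).
Proof. by rewrite /Qinv /zc !mxE; ring. Qed.

Section Sextics.
Variable K : numClosedFieldType.
Implicit Types (z : 'rV[K]_7) (u v : K).

(** The value of a sextic given by its coefficients. Identities between
    sextics are proved by comparing these values ([sx_inj]). *)
Definition sx z u v := \sum_(i < 7) z 0 i * (u ^+ (6 - i) * v ^+ i).

Lemma sx_row7 (z0 z1 z2 z3 z4 z5 z6 : K) u v :
  sx (row7 z0 z1 z2 z3 z4 z5 z6) u v =
  z0 * u ^+ 6 + z1 * u ^+ 5 * v + z2 * u ^+ 4 * v ^+ 2
  + z3 * u ^+ 3 * v ^+ 3 + z4 * u ^+ 2 * v ^+ 4 + z5 * u * v ^+ 5
  + z6 * v ^+ 6.
Proof. by rewrite /sx !big_ord_recl big_ord0 !mxE /= /bump /=; ring. Qed.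

Lemma sxZ c z u v : sx (c *: z) u v = c * sx z u v.
Proof. by rewrite /sx mulr_sumr; apply: eq_bigr => i _; rewrite mxE -mulrA. Qed.

Lemma sxB z z' u v : sx (z - z') u v = sx z u v - sx z' u v.
Proof. by rewrite /sx -sumrB; apply: eq_bigr => i _; rewrite !mxE mulrBl. Qed.

Lemma sx_inj z z' : (forall u v, sx z u v = sx z' u v) -> z = z'.
Proof.
move=> e; apply/eqP; rewrite -subr_eq0; apply/eqP.
set y := z - z'; have {}e v : sx y 1 v = 0 by rewrite sxB e subrr.
pose p := \poly_(i < 7) y 0 (inord i).
have p0 : p = 0.
  apply: poly_eval0 => x; rewrite horner_poly -[RHS](e x); apply: eq_bigr => i _.
  by rewrite expr1n mul1r inord_val.
apply/rowP => i; have := congr1 (coefp i) p0.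
by rewrite /= coef_poly ltn_ord coef0 inord_val => ->; rewrite mxE.
Qed.

Lemma coef6_sx (f : {mpoly K[2]}) u v : f \is 6.-homog ->
  sx (coef6 f) u v = f.@[pt u v 0].
Proof.
move=> /bformP[p _ ->].
have -> : bform 6 p =
    \sum_(i < 7) (p`_(6 - i))%:MP * ('X_0 ^+ (6 - i) * 'X_1 ^+ i).
  rewrite /bform (reindex_inj rev_ord_inj); apply: eq_bigr => i _ /=.
  by rewrite subSS mul_mpolyC subKn // -ltnS.
rewrite coef6_sum raddf_sum; apply: eq_bigr => i _ /=.
by rewrite mxE !mevalM !rmorphXn /= mevalC !mevalXU pt0 pt1.
Qed.

Definition Oc (x y : K) := x * y * (x ^+ 4 - y ^+ 4).

Lemma f1_sx (m : 'M[K]_2) u v :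
  sx (f1 m) u v = Oc (m 1 1 * u - m 0 1 * v) (m 0 0 * v - m 1 0 * u).
Proof. by rewrite f1E sx_row7 /Oc; ring. Qed.

Lemma eval_f1 (g : 'M[{mpoly K[2]}]_2) q :
  eval_curve (f1 g) q = f1 (eval_curve g q).
Proof. exact: f1_map. Qed.

Lemma eval_mobius (s : 'M[K]_2) q : eval_curve (mobius s) q = q *m s^T.
Proof.
apply/rowP => i; rewrite !mxE raddf_sum /=; apply: eq_bigr => j _.
by rewrite mevalZ mevalXU mxE mulrC.
Qed.

Lemma eval_precomp m k (c : 'M[{mpoly K[2]}]_(m, k)) phi q :
  eval_curve (precomp c phi) q = eval_curve c (eval_curve phi q).
Proof.
apply/matrixP => i j; rewrite !mxE comp_mpoly_meval; apply: meval_eq => l.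
by rewrite tnth_mktuple !mxE.
Qed.

Lemma eval_curveM m k l (a : 'M[{mpoly K[2]}]_(m, k)) (b : 'M_(k, l)) q :
  eval_curve (a *m b) q = eval_curve a q *m eval_curve b q.
Proof. exact: map_mxM. Qed.

Lemma eval_curve_const m k (a : 'M[K]_(m, k)) q :
  eval_curve (map_mx (@mpolyC 2 K) a) q = a.
Proof. by apply/matrixP => i j; rewrite !mxE mevalC. Qed.

Lemma eval_curve_det (g : 'M[{mpoly K[2]}]_2) (q : 'rV[K]_2) :
  (\det g).@[q 0] = \det (eval_curve g q).
Proof. by rewrite -det_map_mx. Qed.

Lemma eval_curve_tr m k (a : 'M[{mpoly K[2]}]_(m, k)) q :
  eval_curve a^T q = (eval_curve a q)^T.
Proof. by rewrite /eval_curve map_trmx. Qed.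

End Sextics.

(** * Two by two matrices *)

Section Matrices.
Variable K : numClosedFieldType.
Implicit Types (a b c d x y w : K) (S T Q M N : 'M[K]_2).

Definition mx22 (A : Type) (a b c d : A) : 'M[A]_2 :=
  \matrix_(i, j) if i == 0 then if j == 0 then a else b
                 else if j == 0 then c else d.

Lemma mx2P (A : Type) (M N : 'M[A]_2) : M 0 0 = N 0 0 -> M 0 1 = N 0 1 ->
  M 1 0 = N 1 0 -> M 1 1 = N 1 1 -> M = N.
Proof. by move=> *; apply/matrixP; apply: ord2P; apply: ord2P. Qed.

Lemma mx22_eta (A : Type) (M : 'M[A]_2) : M = mx22 (M 0 0) (M 0 1) (M 1 0) (M 1 1).
Proof. by apply: mx2P; rewrite mxE. Qed.

Lemma sum2 (A : zmodType) (F : 'I_2 -> A) : \sum_i F i = F 0 + F 1.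
Proof.
rewrite !big_ord_recl big_ord0 addr0; congr (F _ + F _); exact/val_inj.
Qed.

Lemma mul22 a b c d a' b' c' d' : mx22 a b c d *m mx22 a' b' c' d' =
  mx22 (a * a' + b * c') (a * b' + b * d') (c * a' + d * c') (c * b' + d * d').
Proof. by apply: mx2P; rewrite !mxE sum2 !mxE. Qed.

Lemma scale22 k a b c d : k *: mx22 a b c d = mx22 (k * a) (k * b) (k * c) (k * d).
Proof. by apply: mx2P; rewrite !mxE. Qed.

Lemma det_22 a b c d : \det (mx22 a b c d) = a * d - b * c.
Proof. by rewrite det22 !mxE. Qed.

Lemma unit22 M : (M \in unitmx) = (\det M != 0).
Proof. by rewrite unitmxE unitfE. Qed.

Lemma one22 : 1%:M = mx22 1 0 0 1 :> 'M[K]_2.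
Proof. by apply: mx2P; rewrite !mxE. Qed.

Lemma pt_mul x y a b c d :
  pt x y *m mx22 a b c d = pt (x * a + y * c) (x * b + y * d).
Proof. by apply/rowP; apply: ord2P; rewrite !mxE sum2 !mxE. Qed.

Lemma powS_neq0 x n : x ^+ n.+1 != 0 -> x != 0.
Proof. by rewrite expf_eq0. Qed.

Definition dg w : 'M[K]_2 := mx22 w 0 0 1.
Definition sw : 'M[K]_2 := mx22 0 1 1 0.

Lemma proj_eq_sym m k (A B : 'M[K]_(m, k)) : proj_eq A B -> proj_eq B A.
Proof.
by move=> [c c0 ->]; exists c^-1; rewrite ?invr_eq0 // scalerA mulVf ?scale1r.
Qed.

Lemma proj_eq_trans m k (A B C : 'M[K]_(m, k)) :
  proj_eq A B -> proj_eq B C -> proj_eq A C.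
Proof.
by move=> [c c0 ->] [e e0 ->]; exists (c * e); rewrite ?mulf_neq0 ?scalerA.
Qed.

Lemma proj_eq_refl m k (A : 'M[K]_(m, k)) : proj_eq A A.
Proof. by exists 1; rewrite ?oner_eq0 ?scale1r. Qed.

Lemma proj_eq_mul m k l (A B : 'M[K]_(m, k)) (C D : 'M[K]_(k, l)) :
  proj_eq A B -> proj_eq C D -> proj_eq (A *m C) (B *m D).
Proof.
move=> [c c0 ->] [e e0 ->]; exists (c * e); rewrite ?mulf_neq0 //.
by rewrite -scalemxAl -scalemxAr scalerA.
Qed.

(** In the eigenbasis of S the relation S T S = T makes T antidiagonal,
    because its entries are multiplied by different powers of w; scaling one
    eigenvector by a square root makes the two entries equal. *)
Lemma D3_normal_eig w mu S T (v1 v2 : 'rV[K]_2) :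
  w ^+ 2 + w + 1 = 0 -> mu != 0 -> v1 != 0 -> v2 != 0 ->
  v1 *m S = (mu * w) *: v1 -> v2 *m S = mu *: v2 ->
  T \in unitmx -> proj_eq (S *m T *m S) T ->
  exists Q, [/\ Q \in unitmx, exists2 k, k != 0 & Q *m S = k *: dg w *m Q
            & exists2 k, k != 0 & Q *m T = k *: sw *m Q].
Proof.
move=> w3 mu0 v10 v20 e1 e2 uT [c c0 eT].
have w1 : w != 1.
  by apply: contra_eq_neq w3 => ->; rewrite expr1n -!mulr2n -mulrSr Num.Theory.pnatr_eq0.
have w0 : w != 0.
  by apply: contra_eq_neq w3 => ->; rewrite expr0n /= !add0r oner_eq0.
pose Q : 'M[K]_2 := \matrix_(i, j) (if i == 0 then v1 else v2) 0 j.
have QS : Q *m S = mu *: dg w *m Q.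
  rewrite -scalemxAl; apply/row_matrixP; apply: ord2P.
    rewrite row_mul (_ : row 0 Q = v1); last by apply/rowP => j; rewrite !mxE.
    by rewrite e1; apply/rowP => j; rewrite !mxE sum2 !mxE /=; ring.
  rewrite row_mul (_ : row 1 Q = v2); last by apply/rowP => j; rewrite !mxE.
  by rewrite e2; apply/rowP => j; rewrite !mxE sum2 !mxE /=; ring.
have uQ : Q \in unitmx.
  rewrite -row_free_unit; apply: inj_row_free => u uQ.
  have eQ : u *m Q = u 0 0 *: v1 + u 0 1 *: v2.
    by apply/rowP => j; rewrite !mxE sum2 !mxE.
  rewrite uQ in eQ.
  have := congr1 (mulmx^~ S) eQ; rewrite /= mul0mx mulmxDl -!scalemxAl e1 e2.
  rewrite !scalerA => eQ'.
  have : (u 0 0 * (w - 1)) *: v1 = 0.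
    apply: (scalerI mu0); rewrite scaler0 [RHS]eQ'.
    have -> : (u 0 1 * mu) *: v2 = - ((u 0 0 * mu) *: v1).
      rewrite ![_ * mu]mulrC -!scalerA -scalerN; congr (_ *: _).
      by apply/eqP; rewrite -addr_eq0 addrC -eQ.
    by rewrite -scalerBl scalerA; congr (_ *: _); ring.
  move=> /eqP; rewrite scaler_eq0 (negPf v10) orbF mulf_eq0 subr_eq0 (negPf w1).
  rewrite orbF => /eqP u0; move: eQ; rewrite u0 scale0r add0r => /esym/eqP.
  rewrite scaler_eq0 (negPf v20) orbF => /eqP u1.
  by rewrite (pt_eta u) u0 u1; apply/eqP; rewrite pt_eq0 eqxx.
pose T' := Q *m T *m invmx Q.
have uT' : T' \in unitmx by rewrite !unitmx_mul uQ uT unitmx_inv uQ.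
have eT' : (mu ^+ 2) *: (dg w *m T' *m dg w) = c *: T'.
  have : Q *m (S *m T *m S) *m invmx Q = c *: T'.
    by rewrite eT -scalemxAr -scalemxAl.
  move=> <-; rewrite !mulmxA QS.
  have iQS : S *m invmx Q = invmx Q *m (mu *: dg w).
    by rewrite -[S in LHS](mulKmx uQ) QS !mulmxA mulmxK // .
  rewrite -[_ *m S *m _]mulmxA iQS !mulmxA -!scalemxAl -!scalemxAr ?mulmxA.
  by rewrite scalerA -expr2.
move: eT'; rewrite (mx22_eta T') /dg !mul22 !scale22.
move: uT'; rewrite unit22 det22.
move eT00: (T' 0 0) => t00; move eT01: (T' 0 1) => t01.
move eT10: (T' 1 0) => t10; move eT11: (T' 1 1) => t11 dT eM.
have := congr1 (fun M : 'M_2 => M 0 0) eM; have := congr1 (fun M : 'M_2 => M 0 1) eM.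
have := congr1 (fun M : 'M_2 => M 1 0) eM; have := congr1 (fun M : 'M_2 => M 1 1) eM.
rewrite !mxE /= !mul0r !mulr0 !mul1r !mulr1 !addr0 !add0r => m11 m10 m01 m00.
have w2 : w ^+ 2 != w.
  by rewrite -subr_eq0 (_ : w ^+ 2 - w = w * (w - 1)) ?mulf_neq0 ?subr_eq0 //; ring.
have m20 : mu ^+ 2 != 0 by rewrite expf_neq0.
have cc k k' t : k * t = c * t -> k' * t = c * t -> t != 0 -> k = k'.
  by move=> E1 E2 t0; apply: (mulIf t0); rewrite E1.
have off t : t != 0 -> mu ^+ 2 * (w * t) = c * t -> c = mu ^+ 2 * w.
  by move=> t0 E; apply: (mulIf t0); rewrite -E mulrA.
have t00_0 : t00 = 0.
  apply/eqP/negPn/negP => t00n.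
  have ec : c = mu ^+ 2 * w ^+ 2 by apply: (mulIf t00n); rewrite -m00; ring.
  have z t : mu ^+ 2 * (w * t) = c * t -> t = 0.
    move=> E; apply/eqP/negPn/negP => tn; move: (off t tn E); rewrite ec.
    by move=> /(mulfI m20)/eqP; rewrite (negPf w2).
  have t01_0 : t01 = 0 by apply: z; rewrite -m01.
  have t10_0 : t10 = 0 by apply: z; rewrite -m10; ring.
  have t11n : t11 != 0.
    by apply: contraNneq dT => ->; rewrite t01_0 mulr0 mul0r subrr.
  have : c = mu ^+ 2 by apply: (mulIf t11n); rewrite -m11.
  rewrite ec -[RHS]mulr1 => /(mulfI m20)/eqP; rewrite sqrf_eq1 (negPf w1) /=.
  move=> /eqP wN; move: w3; rewrite wN sqrrN expr1n subrr add0r => /eqP.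
  by rewrite oner_eq0.
rewrite t00_0 mul0r sub0r oppr_eq0 mulf_eq0 negb_or in dT.
case/andP: dT => t01n t10n.
have ec := off _ t01n m01.
have t11_0 : t11 = 0.
  apply/eqP/negPn/negP => t11n.
  have : c = mu ^+ 2 by apply: (mulIf t11n); rewrite -m11.
  by rewrite ec -[RHS]mulr1 => /(mulfI m20)/eqP; rewrite (negPf w1).
have [k ek] : exists k, k ^+ 2 = t10 / t01.
  by exists (sqrtC (t10 / t01)); rewrite sqrtCK.
have k0 : k != 0.
  by apply: (@powS_neq0 _ 1); rewrite ek mulf_neq0 ?invr_eq0.
have uD : mx22 k 0 0 1 \in unitmx by rewrite unit22 det_22 mulr1 mulr0 subr0.
exists (mx22 k 0 0 1 *m Q); split; first by rewrite unitmx_mul uD.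
  exists mu => //; rewrite -mulmxA QS !mulmxA; congr (_ *m _).
  by rewrite /dg scale22 !mul22; congr mx22; ring.
exists (k * t01); first by rewrite mulf_neq0.
have QT : Q *m T = T' *m Q by rewrite mulmxKV.
clearbody T'; rewrite -mulmxA QT !mulmxA; congr (_ *m _).
rewrite (mx22_eta T') eT00 eT01 eT10 eT11 t00_0 t11_0 /sw scale22 !mul22.
have -> : t10 = k ^+ 2 * t01 by rewrite ek divfK.
by congr mx22; ring.
Qed.

(** If S^3 is the scalar mu^3, then E l in the proof is, up to scale, the
    projection to the eigenspace of S for mu l. The three projections add up
    to a nonzero scalar and S is not scalar, so two of them survive, for
    eigenvalues that can be written mu w l and mu l. *)
Lemma D3_normal w S T :
  w ^+ 2 + w + 1 = 0 -> S \in unitmx -> T \in unitmx ->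
  ~ (exists k, S = k%:M) -> proj_eq (S *m S *m S) 1%:M ->
  proj_eq (S *m T *m S) T ->
  exists Q, [/\ Q \in unitmx, exists2 k, k != 0 & Q *m S = k *: dg w *m Q
            & exists2 k, k != 0 & Q *m T = k *: sw *m Q].
Proof.
move=> w3 uS uT nS [c c0 S3] eT.
have w0 : w != 0.
  by apply: contra_eq_neq w3 => ->; rewrite expr0n /= !add0r oner_eq0.
have w13 : w ^+ 3 = 1.
  have -> : w ^+ 3 = (w - 1) * (w ^+ 2 + w + 1) + 1 by ring.
  by rewrite w3 mulr0 add0r.
have [mu emu] : exists mu, mu ^+ 3 = c by exists (3.-root c); rewrite rootCK.
have mu0 : mu != 0 by apply: (@powS_neq0 _ 2); rewrite emu.
pose E l := mu ^+ 2 *: 1%:M + (l ^+ 2 * mu) *: S + l *: (S *m S).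
have ES l : l ^+ 3 = 1 -> E l *m S = (mu * l) *: E l.
  move=> l3; rewrite /E !mulmxDl !scalerDr -!scalemxAl mul1mx S3 -emu !scalerA.
  have -> : mu * l * (l ^+ 2 * mu) = mu ^+ 2 by rewrite -[RHS]mul1r -l3; ring.
  have -> : mu * l * mu ^+ 2 = l * mu ^+ 3 by ring.
  have -> : mu * l * l = l ^+ 2 * mu by ring.
  by rewrite [LHS]addrC addrA.
have row_ex l : l ^+ 3 = 1 -> E l != 0 ->
    exists2 v : 'rV[K]_2, v != 0 & v *m S = (mu * l) *: v.
  move=> l3 El; have [i ri] : exists i, row i (E l) != 0.
    apply/existsP; rewrite -negb_forall; apply: contra El => /forallP r0.
    by apply/eqP/row_matrixP => i; rewrite (eqP (r0 i)) row0.
  by exists (row i (E l)) => //; rewrite -row_mul ES // !linearZ.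
have mu20 : (3 * mu ^+ 2) != 0.
  by rewrite mulf_neq0 ?expf_neq0 // Num.Theory.pnatr_eq0.
have sumE : E 1 + E w + E (w ^+ 2) = (3 * mu ^+ 2) *: 1%:M.
  have w4 : w ^+ 4 = w by rewrite -[RHS]mul1r -w13; ring.
  apply/matrixP => i j; rewrite !mxE -exprM w4 !expr1n.
  set s1 : K := S i j; set s2 := \sum_k _; set o : K := (i == j)%:R.
  transitivity (3 * mu ^+ 2 * o + (w ^+ 2 + w + 1) * (mu * s1 + s2)); first by ring.
  by rewrite w3 mul0r addr0.
have two l1 l2 l3 : l3 ^+ 3 = 1 -> E l1 = 0 -> E l2 = 0 ->
    E l1 + E l2 + E l3 = (3 * mu ^+ 2) *: 1%:M -> False.
  move=> l33 -> ->; rewrite !add0r => E3; have := ES l3 l33.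
  rewrite E3 -scalemxAl mul1mx scalerA => H; apply: nS; exists (mu * l3).
  rewrite scalemx1 in H; apply: (scalerI mu20); rewrite H.
  by rewrite scale_scalar_mx mulrC.
have one3 : (1 : K) ^+ 3 = 1 by rewrite expr1n.
have w23 : (w ^+ 2) ^+ 3 = 1 by rewrite -exprM mulnC exprM w13 expr1n.
have fin l : l ^+ 3 = 1 -> E (w * l) != 0 -> E l != 0 -> 
  exists Q, [/\ Q \in unitmx, exists2 k, k != 0 & Q *m S = k *: dg w *m Q
            & exists2 k, k != 0 & Q *m T = k *: sw *m Q].
  move=> l3 E1 E2; have [//|v1 v10 e1] := row_ex _ _ E1.
    by rewrite exprMn w13 l3 mul1r.
  have [//|v2 v20 e2] := row_ex _ _ E2.
  apply: (@D3_normal_eig w (mu * l) S T v1 v2) => //.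
    by rewrite mulf_neq0 //; apply: (@powS_neq0 _ 2); rewrite l3 oner_eq0.
  by rewrite e1 mulrA [mu * l * w]mulrAC.
have [E1|E1] := eqVneq (E 1) 0.
  apply: (fin w w13).
    by apply/eqP => E2; apply: (two 1 (w ^+ 2) w) => //; rewrite -?sumE // addrAC.
  by apply/eqP => E2; apply: (two 1 w (w ^+ 2)).
have [Ew|Ew] := eqVneq (E w) 0.
  apply: (fin (w ^+ 2) w23); first by rewrite -exprS w13.
  by apply/eqP => E2; apply: (two w (w ^+ 2) 1) => //; rewrite addrC addrA sumE.
by apply: (fin 1 one3); rewrite ?mulr1.
Qed.

End Matrices.

(** * The octahedral sextic *)

Section Octahedral.
Variable K : numClosedFieldType.
Implicit Types (a b c d x y w : K) (M N P C : 'M[K]_2) (z : 'rV[K]_7).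

(** The octahedral sextic as a function of row vectors, acted upon by
    multiplication on the right. *)
Definition octv (r : 'rV[K]_2) : K := Oc (r 0 0) (r 0 1).

(** Symmetries of the octahedron: their classes modulo scalars form a group
    of order 24. *)
Definition octa_inv M := M \in unitmx /\
  exists l, forall r : 'rV[K]_2, octv (r *m M) = l * octv r.

Lemma octa_inv_mul M N : octa_inv M -> octa_inv N -> octa_inv (M *m N).
Proof.
move=> [uM [l eM]] [uN [k eN]]; split; first by rewrite unitmx_mul uM uN.
by exists (k * l) => r; rewrite mulmxA eN eM mulrA.
Qed.

Lemma octvZ c r : octv (c *: r) = c ^+ 6 * octv r.
Proof. by rewrite /octv /Oc !mxE; ring. Qed.

Lemma octa_inv_scale c M : c != 0 -> octa_inv M -> octa_inv (c *: M).
Proof.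
move=> c0 [uM [l eM]]; split; first by rewrite unitmxZ // unitfE.
by exists (c ^+ 6 * l) => r; rewrite -scalemxAr octvZ eM mulrA.
Qed.

Lemma f1_octv (m : 'M[K]_2) u v : sx (f1 m) u v = octv (pt v (- u) *m m).
Proof.
rewrite f1_sx /octv (mx22_eta m) pt_mul pt0 pt1 !mxE /=.
by rewrite /Oc; ring.
Qed.

Lemma f1_mul_inv (m M : 'M[K]_2) l :
  (forall r : 'rV[K]_2, octv (r *m M) = l * octv r) ->
  f1 (m *m M) = l *: f1 m.
Proof. by move=> eM; apply: sx_inj => u v; rewrite sxZ !f1_octv mulmxA eM. Qed.

Lemma f1Z c (m : 'M[K]_2) : f1 (c *: m) = c ^+ 6 *: f1 m.
Proof.
by apply: sx_inj => u v; rewrite sxZ !f1_octv -scalemxAr octvZ.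
Qed.

Lemma octv_mulE M x y : octv (pt x y *m M) =
  sx (f1 (mx22 (M 1 1) (- M 1 0) (- M 0 1) (M 0 0))) x y.
Proof.
rewrite f1_sx (mx22_eta M) pt_mul /octv pt0 pt1 !mxE /=.
by rewrite /Oc; ring.
Qed.

Lemma octv_sx x y : octv (pt x y) = sx (row7 0 1 0 0 0 (-1) 0) x y.
Proof. by rewrite sx_row7 /octv pt0 pt1 /Oc; ring. Qed.

(** A triangular symmetry fixes one vertex and therefore the opposite one,
    which makes it diagonal. *)
Lemma octa_inv_tri M : octa_inv M -> M 0 1 = 0 ->
  exists a t, [/\ a != 0, t ^+ 4 = 1 & M = a *: mx22 1 0 0 t].
Proof.
move=> [uM [l eM]] m01.
have := uM; rewrite unit22 det22 m01 mul0r subr0 mulf_eq0 negb_or.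
case/andP=> m00 m11.
have e : f1 (mx22 (M 1 1) (- M 1 0) (- M 0 1) (M 0 0))
         = l *: row7 0 1 0 0 0 (-1) 0.
  by apply: sx_inj => x y; rewrite -octv_mulE eM octv_sx sxZ.
have ek k : (k < 7)%N -> zc (f1 (mx22 (M 1 1) (- M 1 0) (- M 0 1) (M 0 0))) k =
    l * nth 0 [:: 0; 1; 0; 0; 0; -1; 0] k.
  by move=> k7; rewrite e /zc mxE -/(zc _ k) zc_row7.
have e1 := ek 1%N isT; have e2 := ek 2%N isT; have e5 := ek 5%N isT.
rewrite f1E !zc_row7 //= !mxE /= m01 in e1 e2 e5.
have m10 : M 1 0 = 0.
  have h : (5 * M 0 0 ^+ 4 * M 1 1) * M 1 0 = 0.
    by rewrite -[RHS](mulr0 l) -e2; ring.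
  move/eqP: h; rewrite mulf_eq0 (negPf (_ : 5 * M 0 0 ^+ 4 * M 1 1 != 0)).
    by move=> /eqP.
  by rewrite !mulf_neq0 ?expf_neq0 ?pnatr_eq0.
exists (M 0 0), (M 1 1 / M 0 0); split=> //; last first.
  by apply: mx2P; rewrite !mxE /= ?m01 ?m10; field.
rewrite m10 in e1 e5.
have : M 0 0 * M 1 1 * M 1 1 ^+ 4 = M 0 0 * M 1 1 * M 0 0 ^+ 4.
  have e1' : l = M 0 0 ^+ 5 * M 1 1 by rewrite -[l]mulr1 -e1; ring.
  have e5' : l = M 0 0 * M 1 1 ^+ 5.
    by apply: oppr_inj; rewrite -[LHS]mulrN1 -e5; ring.
  by transitivity l; [rewrite e5'|rewrite e1']; ring.
move=> /mulfI => /(_ (mulf_neq0 m00 m11)) e4.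
by rewrite expr_div_n e4 divff // expf_neq0.
Qed.

Section Generated.
Variables (xi k : K) (G : 'M[K]_2 -> Prop).
Hypotheses (xi4 : xi ^+ 4 = -1) (k0 : k != 0).
Let D := mx22 xi 0 0 xi^-1.
Let E := k *: mx22 1 (-1) 1 1.
Hypotheses (GD : G D) (GE : G E) (G1 : G 1%:M).
Hypotheses (GM : forall M N, G M -> G N -> G (M *m N)).
Hypotheses (GV : forall M, G M -> G (invmx M)).

Let xi0 : xi != 0.
Proof. by apply: (@powS_neq0 _ _ 3); rewrite xi4 oppr_eq0 oner_eq0. Qed.

Let octa_inv_D : octa_inv D.
Proof.
split; first by rewrite unit22 det_22 mulfV // mulr0 subr0 oner_eq0.
exists (-1) => r; rewrite (pt_eta r) /D pt_mul /octv !pt0 !pt1 /Oc.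
move: (r 0 0) (r 0 1) => x y; rewrite !mulr0 addr0 add0r.
have -> : x * xi * (y / xi) = x * y by field.
rewrite !exprMn xi4 exprVn xi4 invrN1; ring.
Qed.

Let octa_inv_E : octa_inv E.
Proof.
apply: octa_inv_scale => //; split.
  by rewrite unit22 det_22 mulr1 mulN1r opprK -[1 + 1]/2%:R pnatr_eq0.
exists (-8) => r; rewrite (pt_eta r) pt_mul /octv !pt0 !pt1 /Oc.
by move: (r 0 0) (r 0 1) => x y; ring.
Qed.

Let xi2_cases t : t ^+ 4 = 1 -> exists j, t = xi ^+ (2 * j).
Proof.
move=> t4; have : (t ^+ 2 - 1) * (t ^+ 2 + 1) = 0 by ring: t4.
move=> /eqP; rewrite mulf_eq0 => /orP[|] /eqP h.
- have : (t - 1) * (t - xi ^+ (2 * 2)) = 0.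
    rewrite xi4; have -> : (t - 1) * (t - -1) = t ^+ 2 - 1 by ring.
    exact: h.
  move=> /eqP; rewrite mulf_eq0 !subr_eq0 => /orP[] /eqP ->; last by exists 2.
  by exists 0%N; rewrite expr0.
- have : (t - xi ^+ (2 * 1)) * (t - xi ^+ (2 * 3)) = 0.
    have -> : xi ^+ (2 * 3) = - xi ^+ 2 by ring: xi4.
    have -> : (t - xi ^+ (2 * 1)) * (t - - xi ^+ 2) = t ^+ 2 - xi ^+ 4 by ring.
    by rewrite xi4 opprK.
  by move=> /eqP; rewrite mulf_eq0 !subr_eq0 => /orP[] /eqP ->; [exists 1%N|exists 3].
Qed.

Let Dpow j : mx22 (xi ^+ j) 0 0 (xi^-1 ^+ j) = iter j (mulmx D) 1%:M.
Proof.
elim: j => [|j IH]; first by rewrite !expr0 one22.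
by rewrite iterS -IH /D mul22 !exprS; congr mx22; ring.
Qed.

Let G_Dpow j : G (mx22 (xi ^+ j) 0 0 (xi^-1 ^+ j)).
Proof. by rewrite Dpow; elim: j => //= j IH; apply: GM. Qed.

Let octa_Dpow j : octa_inv (mx22 (xi ^+ j) 0 0 (xi^-1 ^+ j)).
Proof.
rewrite Dpow; elim: j => /= [|j IH]; last exact: octa_inv_mul.
by split; [exact: unitmx1|exists 1 => r; rewrite mulmx1 mul1r].
Qed.

(** The six zeros of the octahedral sextic are permuted transitively by the
    group generated by D and E, so one may suppose that M fixes the zero
    [1, 0]; a triangular matrix that preserves the sextic is diagonal. *)
Lemma octa_inv_gen M : octa_inv M -> exists2 c, c != 0 & G (c *: M).
Proof.
move=> oM.
suff [F [oF GF MF]] : exists F, [/\ octa_inv F, G F & (M *m F) 0 1 = 0].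
  have [a [t [a0 /xi2_cases[j et] e]]] := octa_inv_tri (octa_inv_mul oM oF) MF.
  have xj0 : xi ^+ j != 0 by rewrite expf_neq0.
  have uF : F \in unitmx by case: oF.
  exists (a * xi ^+ j)^-1; first by rewrite invr_eq0 mulf_neq0.
  have -> : (a * xi ^+ j)^-1 *: M =
      invmx (mx22 (xi ^+ j) 0 0 (xi^-1 ^+ j)) *m invmx F.
    apply: (canRL (mulmxK uF)); rewrite -scalemxAl e scalerA.
    have uD : mx22 (xi ^+ j) 0 0 (xi^-1 ^+ j) \in unitmx by case: (octa_Dpow j).
    apply: (can_inj (mulKmx uD)).
    rewrite mulmxV // scale22 mul22 one22 et exprM exprVn.
    have -> : (xi ^+ 2) ^+ j = xi ^+ j * xi ^+ j by rewrite -exprMn.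
    by move: (xi ^+ j) xj0 => X X0; congr mx22; field; rewrite ?a0 ?X0.
  by apply: GM; apply: GV.
have h0 : octv (pt 1 0 *m M) = 0.
  by case: oM => _ [l ->]; rewrite /octv pt0 pt1 /Oc; ring.
move: h0; rewrite (mx22_eta M) pt_mul /octv pt0 pt1 /Oc.
rewrite !mul1r !mul0r !addr0.
set a : K := M 0 0; set b : K := M 0 1 => /eqP; rewrite !mulf_eq0 => /orP[/orP[]|].
- move=> /eqP a0; exists (E *m E); split; [exact: octa_inv_mul|exact: GM|].
  by rewrite a0 /E scale22 !mul22 mxE /=; ring.
- move=> /eqP b0; exists 1%:M; rewrite mulmx1 !mxE /=; split=> //.
  by split; [exact: unitmx1|exists 1 => r; rewrite mulmx1 mul1r].
have [b0 _|b0] := eqVneq b 0.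
  exists 1%:M; rewrite mulmx1 !mxE /=; split=> //.
  by split; [exact: unitmx1|exists 1 => r; rewrite mulmx1 mul1r].
rewrite subr_eq0 => /eqP e4.
have a0 : a != 0.
  by apply: (@powS_neq0 _ _ 3); rewrite e4 expf_neq0.
have [j ej] : exists j, b / a = xi ^+ (2 * j).
  by apply: xi2_cases; rewrite expr_div_n e4 divff // expf_neq0.
exists (mx22 (xi ^+ j) 0 0 (xi^-1 ^+ j) *m E); split.
- exact: octa_inv_mul.
- exact: GM.
have eb : b = a * xi ^+ j * xi ^+ j.
  by rewrite -mulrA -expr2 -exprM mulnC -ej mulrC divfK.
rewrite /E scale22 !mul22 !mxE /= eb exprVn.
by field; rewrite expf_neq0.
Qed.

End Generated.

(** A sextic in the octahedral orbit that is invariant up to scale under a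
    dihedral group of order six in standard position has only the monomials
    x^6, x^3 y^3, y^6; the transvectant and the invariant then leave two
    possibilities. *)
Lemma octa_D3_form w P : w ^+ 2 + w + 1 = 0 -> P \in unitmx ->
  (exists l, forall x y, octv (pt (w * x) y *m P) = l * octv (pt x y *m P)) ->
  (exists l, forall x y, octv (pt y x *m P) = l * octv (pt x y *m P)) ->
  exists m s, [/\ m != 0, s ^+ 2 = -2 &
    forall x y, octv (pt x y *m P) =
                m * (x ^+ 6 - 5 * s * x ^+ 3 * y ^+ 3 + y ^+ 6)].
Proof.
move=> w3 uP [l el] [l' el'].
set N := mx22 (P 1 1) (- P 1 0) (- P 0 1) (P 0 0).
have detN : \det N = \det P by rewrite det_22 det22; ring.
have dP : \det P != 0 by rewrite -unit22.
have [z ez] : exists z, z = f1 N by exists (f1 N).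
have t0 := trv2_f1 N; have q0 := Qinv_f1 N.
have Q0 : Qinv z != 0.
  by rewrite ez q0 detN mulf_neq0 ?expf_neq0 // pnatr_eq0.
rewrite -ez in t0 q0.
have E x y : octv (pt x y *m P) = sx z x y by rewrite octv_mulE ez.
clear ez q0; move: Q0 t0 E.
rewrite /Qinv /trv2 (row7_eta z).
move: (zc z 0) (zc z 1) (zc z 2) (zc z 3) (zc z 4) (zc z 5) (zc z 6).
move=> z0 z1 z2 z3 z4 z5 z6; rewrite !zc_row7 //= => Q0 t0 E.
(* Compare coefficients in the two invariance conditions. *)
have e1 : row7 (w ^+ 6 * z0) (w ^+ 5 * z1) (w ^+ 4 * z2) (w ^+ 3 * z3)
     (w ^+ 2 * z4) (w * z5) z6 = l *: row7 z0 z1 z2 z3 z4 z5 z6.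
  apply: sx_inj => x y; rewrite sxZ -E -el E !sx_row7; ring.
have e2 : row7 z6 z5 z4 z3 z2 z1 z0 = l' *: row7 z0 z1 z2 z3 z4 z5 z6.
  apply: sx_inj => x y; rewrite sxZ -E -el' E !sx_row7; ring.
have w1 : w != 1.
  by apply: contra_eq_neq w3 => ->; rewrite expr1n -!mulr2n -mulrSr pnatr_eq0.
have w13 : w ^+ 3 = 1.
  have -> : w ^+ 3 = (w - 1) * (w ^+ 2 + w + 1) + 1 by ring.
  by rewrite w3 mulr0 add0r.
have w0 : w != 0 by apply: (@powS_neq0 _ _ 2); rewrite w13 oner_eq0.
have w21 : w ^+ 2 != 1.
  by apply: contraNneq w1 => h; rewrite -w13 exprS h mulr1.
have w2w : w ^+ 2 != w.
  by apply: contraNneq w1 => h; apply/eqP/(mulfI w0); rewrite mulr1 -expr2.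
have c1 k : (k < 7)%N -> nth 0 [:: w ^+ 6 * z0; w ^+ 5 * z1; w ^+ 4 * z2;
    w ^+ 3 * z3; w ^+ 2 * z4; w * z5; z6] k =
    l * nth 0 [:: z0; z1; z2; z3; z4; z5; z6] k.
  by move=> k7; rewrite -!zc_row7 // e1 /zc mxE.
have c2 k : (k < 7)%N -> nth 0 [:: z6; z5; z4; z3; z2; z1; z0] k =
    l' * nth 0 [:: z0; z1; z2; z3; z4; z5; z6] k.
  by move=> k7; rewrite -!zc_row7 // e2 /zc mxE.
have := (c1 0%N isT, c1 1%N isT, c1 2%N isT, c1 3%N isT,
         (c1 4%N isT, c1 5%N isT, c1 6%N isT)).
have -> : w ^+ 6 = 1 by ring: w13.
have -> : w ^+ 5 = w ^+ 2 by ring: w13.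
have -> : w ^+ 4 = w by ring: w13.
rewrite w13 /= !mul1r => -[[[[h0 h1] h2] h3] [[h4 h5] h6]].
have nz (k t : K) : k != l -> k * t = l * t -> t = 0.
  move=> kl /eqP; rewrite -subr_eq0 -mulrBl mulf_eq0 subr_eq0 (negPf kl).
  by move=> /eqP.
(* If the multiplier of the rotation were not 1, too many coefficients would
   vanish for the invariant Q to be nonzero. *)
have [l1|l1] := eqVneq 1 l; last first.
  have z00 : z0 = 0 by apply: (nz 1); rewrite ?mul1r.
  have z30 : z3 = 0 by apply: (nz 1); rewrite ?mul1r.
  have z60 : z6 = 0 by apply: (nz 1); rewrite ?mul1r.
  have [z15 z24] : z1 * z5 = 0 /\ z2 * z4 = 0.
    have [lw|lw] := eqVneq (w ^+ 2) l.
      have z20 : z2 = 0 by apply: (nz w) => //; rewrite -lw eq_sym.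
      have z50 : z5 = 0 by apply: (nz w) => //; rewrite -lw eq_sym.
      by rewrite z20 z50 mulr0 mul0r.
    have z10 : z1 = 0 by apply: (nz (w ^+ 2)).
    have z40 : z4 = 0 by apply: (nz (w ^+ 2)).
    by rewrite z10 z40 mulr0 mul0r.
  case/eqP: Q0; rewrite z00 z30.
  by ring: z15 z24.
have z0_ k t : k != 1 -> k * t = l * t -> t = 0 by rewrite l1; apply: nz.
have {h1}z10 : z1 = 0 by apply: (z0_ (w ^+ 2)).
have {h2}z20 : z2 = 0 by apply: (z0_ w).
have {h4}z40 : z4 = 0 by apply: (z0_ (w ^+ 2)).
have {h5}z50 : z5 = 0 by apply: (z0_ w).
rewrite z10 z20 z40 z50 in Q0 t0 E.
have s3 : z3 ^+ 2 = - (50 * z0 * z6).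
  by apply/eqP; rewrite -subr_eq0; apply/eqP; rewrite -[RHS]t0; ring.
have Q1 : 270 * z0 * z6 != 0.
  apply: contraNneq Q0 => h; apply/eqP; rewrite -[RHS]h.
  by ring: s3.
move: Q1; rewrite !mulf_eq0 !negb_or -andbA => /and3P[_ z00 z60].
have z30 : z3 != 0.
  apply: (@powS_neq0 _ _ 1); rewrite s3 oppr_eq0 !mulf_neq0 //.
  by rewrite pnatr_eq0.
have l'1 : l' = 1.
  by apply: (mulIf z30); rewrite -(c2 3%N isT) /= mul1r.
have z6E : z6 = z0 by have /= -> := c2 0%N isT; rewrite l'1 mul1r.
exists z0, (- z3 / (5 * z0)); split=> //.
  by rewrite expr_div_n sqrrN s3 z6E; field.
by move=> x y; rewrite E sx_row7 z6E; field.
Qed.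

End Octahedral.

(** * Contents of products of linear forms *)

Section Peel.
Variable K : numClosedFieldType.
Implicit Types (f h d e : {mpoly K[2]}) (q r : 'rV[K]_2) (p : {poly K}).

Lemma form_factor_pred n f q : q != 0 -> f \is n.-homog -> f.@[q 0] = 0 ->
  exists2 h, h \is n.-1.-homog & f = lin q * h.
Proof.
move=> q0 hf fq; have [->|f0] := eqVneq f 0.
  by exists 0; rewrite ?mulr0 // rpred0.
have [m em] := form_deg_pos f0 q0 hf fq; rewrite em in hf *.
exact: form_factor.
Qed.

(** The product is a polynomial in x with nonzero linear factors. *)
Lemma prod_lin_neq0 (I : finType) (a b : I -> K) :
  (forall i, (a i != 0) || (b i != 0)) ->
  exists x, \prod_i (a i - x * b i) != 0.
Proof.
move=> ab; pose p := \prod_i ((a i)%:P - 'X * (b i)%:P).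
have p0 : p != 0.
  apply/prodf_neq0 => i _; apply/eqP => e0.
  have := congr1 (coefp 0%N) e0; have := congr1 (coefp 1%N) e0.
  rewrite /= !coefB !coefC !coefXM !coefC /= sub0r subr0.
  move=> /eqP; rewrite oppr_eq0 => /eqP bi ai.
  by have := ab i; rewrite ai bi eqxx.
have [x px] := poly_nonroot p0.
exists x; move: px; rewrite horner_prod; congr (_ != _); apply: eq_bigr => i _.
by rewrite hornerD hornerN hornerM !hornerC hornerX.
Qed.

(** At a zero of h, one of the factors v G j 0 - u G j 1 vanishes for all u
    and v, that is, G j 0 and G j 1 have a common zero. Removing the linear
    factor from h and from this pair, and repeating, distributes the zeros of
    h over common divisors c j of the pairs. *)
Lemma peel (I : finType) (d : nat) h (G : I -> 'I_2 -> {mpoly K[2]}) (n : I -> nat)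
    (B : K -> K -> {mpoly K[2]}) :
  (forall j i, G j i \is (n j).-homog) -> h \is d.-homog -> h != 0 ->
  (forall u v, \prod_j (v *: G j 0 - u *: G j 1) = h * B u v) ->
  exists (c : I -> {mpoly K[2]}) (m : I -> nat),
    [/\ (\sum_j m j)%N = d, forall j, c j \is (m j).-homog
      & forall j i, exists k, G j i = c j * k].
Proof.
elim: d h G n => [|d IH] h G n hG hh h0 eB.
  exists (fun _ => 1), (fun _ => 0%N); split=> [|j|j i].
  - by rewrite big1.
  - exact: dhomog1.
  - by exists (G j i); rewrite mul1r.
have [q q0 hq] := form_zero hh.
have [j Gj] : exists j, forall i, (G j i).@[q 0] = 0.
  case: (pickP (fun j => ((G j 0).@[q 0] == 0) && ((G j 1).@[q 0] == 0))).
    by move=> j /andP[/eqP a /eqP b]; exists j; apply: ord2P.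
  move=> nz; have [i|x] := @prod_lin_neq0 I (fun j => (G j 0).@[q 0])
    (fun j => (G j 1).@[q 0]).
    by have /negbT := nz i; rewrite negb_and.
  have := congr1 (meval (q 0)) (eB x 1); rewrite /= mevalM hq mul0r rmorph_prod.
  move=> e /negP[]; apply/eqP; rewrite -[RHS]e; apply: eq_bigr => i _ /=.
  by rewrite mevalB !mevalZ mul1r.
have [h' hh' eh] := form_factor q0 hh hq.
have [g0 hg0 eg0] := form_factor_pred q0 (hG j 0) (Gj 0).
have [g1 hg1 eg1] := form_factor_pred q0 (hG j 1) (Gj 1).
pose G' l i := if l == j then if i == 0 then g0 else g1 else G l i.
pose n' l := if l == j then (n j).-1 else n l.
have [||||c [m [sm hc ec]]] := IH h' G' n'.
- move=> l i; rewrite /G' /n'; case: eqP => // _.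
  by case: eqP.
- exact: hh'.
- by apply: contraNneq h0 => z; rewrite eh z mulr0.
- move=> u v; apply: (mulfI (lin_neq0 q0)); rewrite mulrA -eh -eB.
  rewrite (bigD1 j) //= [RHS](bigD1 j) //= mulrA /G' eqxx /=.
  congr (_ * _).
    by rewrite eg0 eg1 mulrBr !scalerAr.
  by apply: eq_bigr => l /negPf->.
exists (fun l => if l == j then lin q * c l else c l).
exists (fun l => if l == j then (m l).+1 else m l); split.
- rewrite -sm (bigD1 j) //= [in RHS](bigD1 j) //= !eqxx addSn; congr (_ + _).+1.
  by apply: eq_bigr => l /negPf->.
- move=> l; case: eqP => // _; rewrite -[(m l).+1]add1n.
  by apply: dhomogM; rewrite ?lin_homog.
- move=> l i; have [k ek] := ec l i; move: ek; rewrite /G'.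
  case: eqP => [->|_ ek]; last by exists k.
  move: i; apply: ord2P => /= ek; exists k.
    by rewrite eg0 ek mulrA.
  by rewrite eg1 ek mulrA.
Qed.

Lemma prod_homog (I : Type) (r : seq I) (f : I -> {mpoly K[2]}) (n : I -> nat) :
  (forall i, f i \is (n i).-homog) ->
  \prod_(i <- r) f i \is (\sum_(i <- r) n i)%N.-homog.
Proof.
move=> hf; elim: r => [|i r IH]; first by rewrite !big_nil dhomog1.
by rewrite !big_cons dhomogM.
Qed.

Lemma prod_dvd (I : eqType) (r : seq I) (f : I -> {mpoly K[2]}) (n : I -> nat)
    N d :
  uniq r -> (forall i, f i \is (n i).-homog) ->
  (forall i j, i != j -> coprimeF (f i) (f j)) ->
  d \is N.-homog -> d != 0 -> (forall i, exists k, d = f i * k) ->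
  exists k, d = (\prod_(i <- r) f i) * k.
Proof.
move=> + hf co hd d0 dv; elim: r => [_|i r IH /= /andP[ir ur]].
  by exists d; rewrite big_nil mul1r.
rewrite big_cons.
apply: (dvdF_mul (hf i) (prod_homog r hf) hd d0 _ (dv i) (IH ur)).
move=> q q0 fi; rewrite rmorph_prod /= prodf_seq_neq0; apply/allP => j jr /=.
by apply: (co i j) => //; apply: contraNneq ir => ->.
Qed.

Lemma coprime_lin q r : q != 0 -> (lin r).@[q 0] != 0 -> coprimeF (lin q) (lin r).
Proof.
move=> q0 rq s s0 /(lin_eval_eq0 q0)[c es].
rewrite es (form_scale _ _ (lin_homog r)) expr1 mulf_neq0 //.
by apply: contraNneq s0 => c0; rewrite es c0 scale0r.
Qed.

End Peel.

(** * Curves that are equivariant under the dihedral group *)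

Section CubeRoot.
Variables (K : numClosedFieldType) (w : K).
Hypothesis w3 : w ^+ 2 + w + 1 = 0.

Lemma cube_root1 : w ^+ 3 = 1.
Proof.
have -> : w ^+ 3 = (w - 1) * (w ^+ 2 + w + 1) + 1 by ring.
by rewrite w3 mulr0 add0r.
Qed.

Lemma cube_root_neq0 : w != 0.
Proof. by apply: (@powS_neq0 _ _ 2); rewrite cube_root1 oner_eq0. Qed.

Lemma cube_root_neq1 : w != 1.
Proof.
by apply: contra_eq_neq w3 => ->; rewrite expr1n -!mulr2n -mulrSr pnatr_eq0.
Qed.

Lemma cube_root_sq_neq1 : w ^+ 2 != 1.
Proof.
apply: contraNneq cube_root_neq1 => h.
by rewrite -cube_root1 exprS h mulr1.
Qed.

Lemma cube_root_exp n : w ^+ n = w ^+ (n %% 3).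
Proof.
by rewrite {1}(divn_eq n 3) exprD mulnC exprM cube_root1 expr1n mul1r.
Qed.

Lemma cube_root_exp_eq1 n : w ^+ n = 1 -> (n %% 3 = 0)%N.
Proof.
rewrite cube_root_exp; have := ltn_pmod n (isT : 0 < 3)%N.
case: (n %% 3)%N => [|[|[|//]]] // _ /eqP.
  by rewrite expr1 (negPf cube_root_neq1).
by rewrite (negPf cube_root_sq_neq1).
Qed.

Lemma cube_roots x : x ^+ 3 = 1 -> exists k, x = w ^+ k.
Proof.
move=> x3; have : (x - 1) * ((x - w) * (x - w ^+ 2)) = 0.
  have -> : (x - 1) * ((x - w) * (x - w ^+ 2)) =
     (x ^+ 3 - 1) - (w ^+ 2 + w + 1) * (x ^+ 2 - w * x + (w - 1)) by ring.
  by rewrite x3 w3 mul0r !subrr.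
move=> /eqP; rewrite !mulf_eq0 !subr_eq0 => /or3P[] /eqP ->.
- by exists 0%N; rewrite expr0.
- by exists 1%N.
- by exists 2.
Qed.

End CubeRoot.

Section Equivariant.
Variables (K : numClosedFieldType) (w : K).
Hypothesis w3 : w ^+ 2 + w + 1 = 0.
Variables (n : nat) (g : 'M[{mpoly K[2]}]_2) (c c' : K).
Hypotheses (hg : forall i j, g i j \is n.-homog) (ng : nocz g).
Hypotheses (c0 : c != 0) (c'0 : c' != 0).
Hypothesis eg : forall x y,
  eval_curve g (pt (w * x) y) = c *: (eval_curve g (pt x y) *m dg w).
Hypothesis egs : forall x y,
  eval_curve g (pt y x) = c' *: (eval_curve g (pt x y) *m sw K).

Let A i j x y := (g i j).@[pt x y 0].

Let A_scale i j t x y : A i j (t * x) (t * y) = t ^+ n * A i j x y.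
Proof. by rewrite /A -pt_scale (form_scale _ _ (hg i j)). Qed.

Let E0 i x y : A i 0 (w * x) y = c * w * A i 0 x y.
Proof.
have := congr1 (fun M : 'M_2 => M i 0) (eg x y).
by rewrite /= !mxE sum2 !mxE /= mulr0 addr0 -!/(A _ _ _ _) => ->; ring.
Qed.

Let E1 i x y : A i 1 (w * x) y = c * A i 1 x y.
Proof.
have := congr1 (fun M : 'M_2 => M i 1) (eg x y).
by rewrite /= !mxE sum2 !mxE /= mulr0 add0r -!/(A _ _ _ _) => ->; ring.
Qed.

Let S0 i x y : A i 0 y x = c' * A i 1 x y.
Proof.
have := congr1 (fun M : 'M_2 => M i 0) (egs x y).
by rewrite /= !mxE sum2 !mxE /= mulr0 add0r -!/(A _ _ _ _) => ->; ring.
Qed.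

Let S1 i x y : A i 1 y x = c' * A i 0 x y.
Proof.
have := congr1 (fun M : 'M_2 => M i 1) (egs x y).
by rewrite /= !mxE sum2 !mxE /= mulr0 addr0 -!/(A _ _ _ _) => ->; ring.
Qed.

Let A_nz x y : pt x y != 0 -> exists i, (A i 0 x y != 0) || (A i 1 x y != 0).
Proof.
move=> q0; have [[i j] /=] := nocz_entry ng q0; rewrite -/(A i j x y).
by move: j; apply: ord2P => h; exists i; rewrite h ?orbT.
Qed.

Let w0 := cube_root_neq0 w3.

Let A10_0 i : A i 0 1 0 != 0 -> c = 1 /\ w ^+ n = w.
Proof.
move=> a0; have c1 : c = 1.
  have a1 : A i 1 0 1 != 0 by rewrite S1 mulf_neq0.
  by apply: (mulIf a1); rewrite -E1 mulr0 mul1r.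
split=> //; apply: (mulIf a0); rewrite -A_scale mulr1 mulr0.
by have := E0 i 1 0; rewrite mulr1 c1 mul1r.
Qed.

Let A10_1 i : A i 1 1 0 != 0 -> w ^+ n.+1 = 1.
Proof.
move=> a1; have cn : w ^+ n = c.
  by apply: (mulIf a1); rewrite -A_scale -E1 mulr1 mulr0.
have a0 : A i 0 0 1 != 0 by rewrite S0 mulf_neq0.
rewrite exprSr cn; apply: (mulIf a0); rewrite -E0 mulr0 mul1r //.
Qed.

(** The rotation fixes the point [1, 0], where it multiplies g by w^n and the
    two columns of g by c w and c; one of the columns is nonzero there. The
    same at [0, 1] shows that c or w c equals 1. So w^n is w or its inverse. *)
Lemma equiv_deg_mod : (n %% 3 != 0)%N.
Proof.
have [|i /orP[/A10_0[_]|/A10_1]] := @A_nz 1 0; first by rewrite pt_eq0 oner_eq0.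
- move=> wn; apply/eqP => n0; move: wn.
  rewrite (cube_root_exp w3) n0 expr0 => /esym/eqP.
  by rewrite (negPf (cube_root_neq1 w3)).
- by move=> /(cube_root_exp_eq1 w3); lia.
Qed.

Lemma equiv_deg1 : (n %% 3 = 1)%N -> c = 1.
Proof.
move=> n1; have [|i /orP[/A10_0[-> //]|/A10_1]] := @A_nz 1 0.
  by rewrite pt_eq0 oner_eq0.
by move=> /(cube_root_exp_eq1 w3); lia.
Qed.

Lemma equiv_swap_sq : c' ^+ 2 = 1.
Proof.
have [|i /orP[] a] := @A_nz 1 0; first by rewrite pt_eq0 oner_eq0.
  by apply: (mulIf a); rewrite mul1r [in RHS]S0 S1; ring.
by apply: (mulIf a); rewrite mul1r [in RHS]S1 S0; ring.
Qed.

(** Representatives of the points of the line with nontrivial stabilizer in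
    the dihedral group: the zeros of x y (x^6 - y^6). *)
Definition branch q := q = pt 1 0 \/ exists z : K, (z = 0 \/ z ^+ 6 = 1) /\ q = pt z 1.

Let Ewk i k x y : A i 0 (w ^+ k * x) y = c ^+ k * w ^+ k * A i 0 x y
  /\ A i 1 (w ^+ k * x) y = c ^+ k * A i 1 x y.
Proof.
elim: k => [|k [IH0 IH1]]; first by rewrite !expr0 !mul1r.
by rewrite exprS -mulrA E0 E1 IH0 IH1 !exprS; split; ring.
Qed.

(** An element of the dihedral group that fixes the branch point q up to
    scale acts on the rows of g at q as on an eigenvector. Hence these rows
    lie on one eigenline of a rotation or of a reflection. *)
Lemma branch_col q : branch q ->
  exists a b : K, [/\ forall i, a * (g i 0).@[q 0] = b * (g i 1).@[q 0],
     (a != 0) || (b != 0) & a = 0 \/ b = 0 \/ (a / b) ^+ 6 = 1].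
Proof.
case=> [-> | [z [[->|z6] ->]]].
- have [|i /orP[a|a]] := @A_nz 1 0; first by rewrite pt_eq0 oner_eq0.
    exists 0, 1; split; rewrite ?oner_eq0 ?orbT //; last by left.
    move=> l; rewrite mul0r mul1r; apply/esym/eqP/negPn/negP => b.
    have [_ wn] := A10_0 a; have := A10_1 b; rewrite exprSr wn -expr2.
    by move=> /eqP; rewrite (negPf (cube_root_sq_neq1 w3)).
  exists 1, 0; split; rewrite ?oner_eq0 //; last by right; left.
  move=> l; rewrite mul0r mul1r; apply/eqP/negPn/negP => b.
  have [_ wn] := A10_0 b; have := A10_1 a; rewrite exprSr wn -expr2.
  by move=> /eqP; rewrite (negPf (cube_root_sq_neq1 w3)).
- have [|i /orP[a|a]] := @A_nz 1 0; first by rewrite pt_eq0 oner_eq0.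
    exists 1, 0; split; rewrite ?oner_eq0 //; last by right; left.
    move=> l; rewrite mul0r mul1r -/(A l 0 0 1) S0; apply/eqP.
    rewrite mulf_eq0 (negPf c'0) /=; apply/negPn/negP => b.
    have [_ wn] := A10_0 a; have := A10_1 b; rewrite exprSr wn -expr2.
    by move=> /eqP; rewrite (negPf (cube_root_sq_neq1 w3)).
  exists 0, 1; split; rewrite ?oner_eq0 ?orbT //; last by left.
  move=> l; rewrite mul0r mul1r -/(A l 1 0 1) S1; apply/esym/eqP.
  rewrite mulf_eq0 (negPf c'0) /=; apply/negPn/negP => b.
  have [_ wn] := A10_0 b; have := A10_1 a; rewrite exprSr wn -expr2.
  by move=> /eqP; rewrite (negPf (cube_root_sq_neq1 w3)).
have z0 : z != 0 by apply: (@powS_neq0 _ _ 5); rewrite z6 oner_eq0.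
have [k ek] : exists k, z ^- 2 = w ^+ k.
  by apply: (cube_roots w3); rewrite exprVn -exprM z6 invr1.
have wk0 : w ^+ k != 0 by rewrite expf_neq0.
have e1 : pt 1 z = z *: pt (w ^+ k * z) 1.
  by rewrite pt_scale mulr1 -ek; congr pt; field.
have s0 i : c' * A i 1 z 1 = z ^+ n * (c ^+ k * w ^+ k * A i 0 z 1).
  rewrite -S0 /A e1 (form_scale _ _ (hg i 0)) -/(A i 0 _ 1); congr (_ * _).
  by have [-> _] := Ewk i k z 1.
have s1 i : c' * A i 0 z 1 = z ^+ n * (c ^+ k * A i 1 z 1).
  rewrite -S1 /A e1 (form_scale _ _ (hg i 1)) -/(A i 1 _ 1); congr (_ * _).
  by have [_ ->] := Ewk i k z 1.
have a0 : z ^+ n * c ^+ k != 0 by rewrite mulf_neq0 ?expf_neq0.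
exists c', (z ^+ n * c ^+ k); split; rewrite ?c'0 //.
  by move=> i; rewrite -!/(A _ _ _ _) s1 !mulrA.
right; right.
have [|i ai] := @A_nz z 1; first by rewrite pt_eq0 oner_eq0 andbF.
have ai0 : A i 0 z 1 != 0.
  case/orP: ai => // ai; apply: contraNneq ai => a00.
  have := s0 i; rewrite a00 !mulr0 => /eqP; rewrite mulf_eq0 (negPf c'0) /=.
  by [].
have : c' ^+ 2 * A i 0 z 1 = (z ^+ n * c ^+ k) ^+ 2 * w ^+ k * A i 0 z 1.
  by rewrite expr2 -mulrA s1 mulrCA [c' * _]mulrCA s0; ring.
move=> /(mulIf ai0) e2.
rewrite -[6%N]/(2 * 3)%N exprM expr_div_n e2 mulrAC divff ?expf_neq0 // mul1r -exprM mulnC exprM.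
by rewrite (cube_root1 w3) expr1n.
Qed.

Lemma branch_neq0 q : branch q -> q != 0.
Proof.
case=> [-> | [z [_ ->]]]; rewrite pt_eq0 oner_eq0 //.
by rewrite andbF.
Qed.

Lemma branch_det q : branch q -> (\det g).@[q 0] = 0.
Proof.
move=> /branch_col[a [b [ab ab0 _]]].
rewrite det22 mevalB !mevalM.
have := ab 0; have := ab 1.
move: (g 0 0).@[_] (g 0 1).@[_] (g 1 0).@[_] (g 1 1).@[_] => r s t u e1 e0.
case/orP: ab0 => h; apply: (mulfI h); rewrite mulr0.
  transitivity ((a * r) * u - s * (a * t)); first by ring.
  by rewrite e0 e1; ring.
transitivity (r * (b * u) - (b * s) * t); first by ring.
by rewrite -e0 -e1; ring.
Qed.

(** A vertex of the octahedron, at - e with e different from 0 and e^6 from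
    1, is not fixed by any nontrivial element of the dihedral group. *)
Lemma branch_vertex q e : branch q -> e != 0 -> e ^+ 6 != 1 ->
  exists i, (g i 0).@[q 0] + e * (g i 1).@[q 0] != 0.
Proof.
move=> bq e0 e6; have [a [b [ab ab0 ab6]]] := branch_col bq.
apply/existsP; rewrite -negb_forall; apply/negP => /forallP z.
have zi i : (g i 0).@[q 0] = - e * (g i 1).@[q 0].
  by apply/eqP; rewrite mulNr -addr_eq0 z.
have all0 i : (g i 1).@[q 0] = 0.
  have : (a * e + b) * (g i 1).@[q 0] = 0.
    by rewrite mulrDl -ab zi; ring.
  move=> /eqP; rewrite mulf_eq0 => /orP[|/eqP //].
  rewrite addr_eq0 => /eqP eab; exfalso.
  case: ab6 => [a00|[b00|r6]].
  - by move: ab0 eab; rewrite a00 mul0r eqxx /= => b0 /eqP; rewrite eq_sym oppr_eq0 (negPf b0).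
  - move: ab0 eab; rewrite b00 eqxx orbF oppr0 => a0 /eqP.
    by rewrite mulf_eq0 (negPf a0) (negPf e0).
  - have b0 : b != 0.
      by apply: contra_eq_neq r6 => ->; rewrite invr0 mulr0 expr0n eq_sym oner_eq0.
    have ee : (a / b) * e = -1 by rewrite mulrAC eab mulNr divff.
    have : ((a / b) * e) ^+ 6 = 1 by rewrite ee -signr_odd expr0.
    by rewrite exprMn r6 mul1r => /eqP; rewrite (negPf e6).
have [[i j] /= /negP[]] := nocz_entry ng (branch_neq0 bq).
by move: j; apply: ord2P; rewrite ?zi all0 ?mulr0.
Qed.

(** The zeros of h are common zeros of the pairs attached to the six
    vertices. The resulting divisors of the determinant are pairwise coprime,
    since common zeros of two pairs are common zeros of g, and they avoid the
    eight branch points, at which the determinant vanishes as well. Counting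
    degrees gives 6 n - 36 + 8 <= 2 n. *)
Lemma equiv_deg_bound (eps : 'I_6 -> K) h (B : K -> K -> {mpoly K[2]}) :
  injective eps -> (forall j, eps j != 0) -> (forall j, eps j ^+ 6 != 1) ->
  \det g != 0 -> (36 <= 6 * n)%N -> h \is (6 * n - 36).-homog -> h != 0 ->
  (forall u v, \prod_j (v *: (g 0 0 + eps j *: g 0 1)
                        - u *: (g 1 0 + eps j *: g 1 1)) = h * B u v) ->
  (n <= 7)%N.
Proof.
move=> ie e0 e6 d0 n6 hh h0 eB.
pose G j i := g i 0 + eps j *: g i 1.
have hG j i : G j i \is n.-homog by rewrite rpredD ?rpredZ.
have [f [m [sm hf ef]]] := peel (n := fun _ => n) hG hh h0 eB.
have hD : \det g \is (n + n).-homog.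
  by rewrite det22; apply: rpredB; apply: dhomogM.
(* The sixth root of unity - w is primitive. *)
have [z [z6 zi]] : exists z : K, z ^+ 6 = 1 /\ forall i j : 'I_6, z ^+ i = z ^+ j -> i = j.
  have z6 : (- w) ^+ 6 = 1.
    by rewrite exprNn -signr_odd expr0 mul1r -[6%N]/(3 * 2)%N exprM (cube_root1 w3) expr1n.
  exists (- w); split=> // i j.
  wlog ij : i j / (i <= j)%N.
    by move=> H; case/orP: (leq_total i j) => ?; [exact: H|move=> /esym/H->].
  move=> e; apply/val_inj => /=.
  have zn : - w != 0 by rewrite oppr_eq0.
  have : (- w) ^+ (j - i) = 1.
    by apply: (mulfI (expf_neq0 i zn)); rewrite mulr1 -exprD subnKC.
  have : (j - i < 6)%N by have := ltn_ord j; lia.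
  case: (j - i)%N (subnKC ij) => [|k] <-; first by rewrite addn0.
  move=> k6 e1; exfalso.
  have : w ^+ (2 * k.+1) = 1 by rewrite exprM -(sqrrN w) -exprM mulnC exprM e1 expr1n.
  move=> /(cube_root_exp_eq1 w3) km.
  have k3 : k = 2 by lia.
  move: e1; rewrite k3 exprNn (cube_root1 w3) mulr1 -signr_odd expr1 => /eqP.
  by rewrite eqNr oner_eq0.
(* The eight branch points: infinity, 0 and the sixth roots of unity. *)
pose bp (i : 'I_8) : 'rV[K]_2 :=
  match val i with 0 => pt 1 0 | 1 => pt 0 1 | k.+2 => pt (z ^+ k) 1 end.
have bbp i : branch (bp i).
  rewrite /bp; case: (val i) => [|[|k]]; first by left.
    by right; exists 0; split=> //; left.
  right; exists (z ^+ k); split=> //; right.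
  by rewrite -exprM mulnC exprM z6 expr1n.
have zk l : z ^+ l != 0.
  by apply: expf_neq0; apply: (@powS_neq0 _ _ 5); rewrite z6 oner_eq0.
have inj_bp i j : i != j -> (lin (bp j)).@[bp i 0] != 0.
  move=> ij; rewrite lin_eval subr_eq0; apply: contra ij => /eqP; rewrite /bp.
  case: i j => [[|[|k]] hk] [[|[|l]] hl] //=; rewrite !pt0 !pt1 ?mulr1 ?mul1r ?mul0r ?mulr0.
  1-6: by move=> /eqP; rewrite ?(eq_sym 0) ?oner_eq0 ?(negPf (zk _)).
  have kl : (k < 6)%N by []. have ll : (l < 6)%N by [].
  move=> /(zi (Ordinal kl) (Ordinal ll)) /(congr1 val) /= e.
  by apply/eqP/val_inj; rewrite /= e.
(* Fourteen divisors of the determinant, of total degree 6 n - 36 + 8. *)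
pose fam (s : 'I_6 + 'I_8) := match s with inl j => f j | inr i => lin (bp i) end.
pose deg (s : 'I_6 + 'I_8) := match s with inl j => m j | inr i => 1%N end.
have hfam s : fam s \is (deg s).-homog.
  by case: s => [j|i] /=; rewrite ?hf ?lin_homog.
have fG j q : (f j).@[q 0] = 0 -> forall i, (G j i).@[q 0] = 0.
  by move=> fq i; have [k ->] := ef j i; rewrite mevalM fq mul0r.
have fbr j q : branch q -> (f j).@[q 0] != 0.
  move=> bq; apply/eqP => /fG Gq; have [i /negP[]] := branch_vertex bq (e0 j) (e6 j).
  by have := Gq i; rewrite mevalD mevalZ => ->.
have co s t : s != t -> coprimeF (fam s) (fam t).
  case: s t => [i|i] [j|j] /= ij.
  - move=> q q0 /fG Gi; apply/eqP => /fG Gj.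
    have ee : eps i - eps j != 0 by rewrite subr_eq0 (inj_eq ie).
    have z1 l : (g l 1).@[q 0] = 0.
      apply: (mulfI ee); rewrite mulr0.
      have := Gi l; have := Gj l; rewrite /G !mevalD !mevalZ => a b.
      transitivity (((g l 0).@[q 0] + eps i * (g l 1).@[q 0])
                    - ((g l 0).@[q 0] + eps j * (g l 1).@[q 0])); first by ring.
      by rewrite a b subrr.
    have z0 l : (g l 0).@[q 0] = 0.
      by have := Gi l; rewrite mevalD mevalZ z1 mulr0 addr0.
    have [[l k] /= /negP[]] := nocz_entry ng q0.
    by move: k; apply: ord2P; rewrite ?z0 ?z1.
  - move=> q q0 fq; apply/eqP => /lin_eval_eq0 [|d ed].
      exact: branch_neq0 (bbp j).
    move: fq; rewrite ed (form_scale _ _ (hf i)) => /eqP.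
    have d0' : d != 0 by apply: contraNneq q0 => d00; rewrite ed d00 scale0r.
    by rewrite mulf_eq0 expf_eq0 (negPf d0') andbF (negPf (fbr _ _ (bbp j))).
  - move=> q q0 /lin_eval_eq0[|d ed]; first exact: branch_neq0 (bbp i).
    have d0' : d != 0 by apply: contraNneq q0 => d00; rewrite ed d00 scale0r.
    by rewrite ed (form_scale _ _ (hf j)) mulf_neq0 ?expf_neq0 ?fbr.
  - by apply: coprime_lin (branch_neq0 (bbp i)) _; apply: inj_bp.
have dv s : exists k, \det g = fam s * k.
  case: s => [j|i] /=.
    have [k0 ek0] := ef j 0; have [k1 ek1] := ef j 1.
    exists (k0 * g 1 1 - g 0 1 * k1).
    rewrite det22; transitivity (G j 0 * g 1 1 - g 0 1 * G j 1).
      by rewrite /G -!mul_mpolyC; ring.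
    by rewrite ek0 ek1; ring.
  have [k _ ->] := form_factor_pred (branch_neq0 (bbp i)) hD (branch_det (bbp i)).
  by exists k.
have [k ek] := prod_dvd (index_enum_uniq _) hfam co hD d0 dv.
have hp := prod_homog (index_enum ('I_6 + 'I_8)%type) hfam.
rewrite ek in d0 hD; have [le _] := homog_quot d0 hp hD.
move: le; rewrite big_sumType /= sm sum_nat_const card_ord.
by move: n6; clear; lia.
Qed.

End Equivariant.

(** * The dihedral covering and its equivariant curves of degree seven *)

Section DihedralForms.
Variable K : numClosedFieldType.
Implicit Types (x y t : K) (q : 'rV[K]_2) (ab : 'M[K]_(2, 3)).

Definition al x y : K := (x ^+ 3 - y ^+ 3) / 2.
Definition be x y : K := (x ^+ 3 + y ^+ 3) / 2.
Definition ga x y : K := x * y.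

Lemma alpha3_eval x y : (alpha3 K).@[pt x y 0] = al x y.
Proof. by rewrite mevalZ mevalB !rmorphXn /= !mevalXU pt0 pt1 mulrC. Qed.
Lemma beta3_eval x y : (beta3 K).@[pt x y 0] = be x y.
Proof. by rewrite mevalZ mevalD !rmorphXn /= !mevalXU pt0 pt1 mulrC. Qed.
Lemma gamma_eval x y : (gamma K).@[pt x y 0] = ga x y.
Proof. by rewrite mevalM !mevalXU pt0 pt1. Qed.

Lemma alpha3_homog : alpha3 K \is 3.-homog.
Proof. by apply: rpredZ; apply: rpredB; apply/homogX1/X_homog. Qed.
Lemma beta3_homog : beta3 K \is 3.-homog.
Proof. by apply: rpredZ; apply: rpredD; apply/homogX1/X_homog. Qed.
Lemma gamma_homog : gamma K \is 2.-homog.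
Proof. exact: dhomogM (X_homog _ 0) (X_homog _ 1). Qed.

Lemma phi_D3_eval x y :
  eval_curve (phi_D3 K) (pt x y) = pt (- al x y ^+ 2) (ga x y ^+ 3).
Proof.
apply/rowP; apply: ord2P; rewrite !mxE /=.
  by rewrite mevalN rmorphXn /= alpha3_eval.
by rewrite rmorphXn /= gamma_eval.
Qed.

Lemma phi_D3_homog i j : phi_D3 K i j \is 6.-homog.
Proof.
rewrite mxE; case: ifP => _.
  by rewrite rpredN; apply: (dhomogMn 2 alpha3_homog).
exact: (dhomogMn 3 gamma_homog).
Qed.

Lemma phi_D3_nocz : nocz (phi_D3 K).
Proof.
move=> q; rewrite (pt_eta q) phi_D3_eval !pt_eq0 oppr_eq0 !expf_eq0 /=.
apply: contraNN => /andP[]; rewrite /al /ga !mulf_eq0 invr_eq0 pnatr_eq0 orbF.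
rewrite subr_eq0 => /eqP a0 /orP[] /eqP z; move: a0; rewrite z expr0n /=.
  by move=> /esym/eqP; rewrite expf_eq0 /= => ->; rewrite eqxx.
by move=> /eqP; rewrite expf_eq0 /= => ->; rewrite eqxx.
Qed.

(** The three covariants of degree seven: the identity [x, y] times an
    invariant, and [-x, y] times two semi-invariants. *)
Definition Nmx : 'M[{mpoly K[2]}]_(3, 2) :=
  \matrix_(i, j) nth 0 (if j == 0
     then [:: alpha3 K * beta3 K * 'X_0; - (gamma K ^+ 3 * 'X_0);
              - (alpha3 K ^+ 2 * 'X_0)]
     else [:: alpha3 K * beta3 K * 'X_1; gamma K ^+ 3 * 'X_1;
              alpha3 K ^+ 2 * 'X_1]) i.

Definition hD ab : 'M[{mpoly K[2]}]_2 := map_mx (@mpolyC 2 K) ab *m Nmx.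

Lemma ord3P (P : 'I_3 -> Prop) : P 0 -> P 1 -> P (inord 2) -> forall i, P i.
Proof.
move=> P0 P1 P2 [[|[|[|//]]] lti].
- by rewrite (_ : Ordinal lti = 0) //; apply/val_inj.
- by rewrite (_ : Ordinal lti = 1) //; apply/val_inj.
- by rewrite (_ : Ordinal lti = inord 2) //; apply/val_inj; rewrite /= inordK.
Qed.

Lemma sum3 (A : zmodType) (F : 'I_3 -> A) :
  \sum_i F i = F 0 + F 1 + F (inord 2).
Proof.
rewrite !big_ord_recl big_ord0 addr0 addrA; congr (F _ + F _ + F _);
  by apply/val_inj; rewrite /= ?inordK.
Qed.

Lemma hD_eval ab x y i :
  (hD ab i 0).@[pt x y 0] = x * (ab i 0 * (al x y * be x y)
     - ab i 1 * ga x y ^+ 3 - ab i (inord 2) * al x y ^+ 2) /\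
  (hD ab i 1).@[pt x y 0] = y * (ab i 0 * (al x y * be x y)
     + ab i 1 * ga x y ^+ 3 + ab i (inord 2) * al x y ^+ 2).
Proof.
have i2 : nat_of_ord (inord 2 : 'I_3) = 2%N by rewrite inordK.
split; rewrite mxE sum3 !mxE /= i2 /=; mev; rewrite alpha3_eval beta3_eval gamma_eval
  ?pt0 ?pt1; ring.
Qed.

Lemma hD_homog ab i j : hD ab i j \is 7.-homog.
Proof.
rewrite mxE; apply: rpred_sum => k _; rewrite !mxE mul_mpolyC; apply: rpredZ.
have h1 l : alpha3 K * beta3 K * 'X_l \is 7.-homog.
  exact: dhomogM (dhomogM alpha3_homog beta3_homog) (X_homog _ l).
have h2 l : gamma K ^+ 3 * 'X_l \is 7.-homog.
  exact: dhomogM (dhomogMn 3 gamma_homog) (X_homog _ l).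
have h3 l : alpha3 K ^+ 2 * 'X_l \is 7.-homog.
  exact: dhomogM (dhomogMn 2 alpha3_homog) (X_homog _ l).
by case: ifP => _; move: k; apply: ord3P; rewrite ?inordK //= ?rpredN;
  [exact: h1|exact: h2|exact: h3|exact: h1|exact: h2|exact: h3].
Qed.

Lemma eval2_eq (g : 'M[{mpoly K[2]}]_2) q (M : 'M[K]_2) :
  (forall i, (g i 0).@[q 0] = M i 0 /\ (g i 1).@[q 0] = M i 1) ->
  eval_curve g q = M.
Proof.
by move=> e; apply/matrixP => i; apply: ord2P; rewrite mxE; case: (e i).
Qed.

Lemma evE m k (g : 'M[{mpoly K[2]}]_(m, k)) (q : 'rV[K]_2) i j :
  eval_curve g q i j = (g i j).@[q 0].
Proof. by rewrite mxE. Qed.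

Lemma mul_dg w (M : 'M[K]_2) i :
  ((M *m dg w) i 0 = M i 0 * w) * ((M *m dg w) i 1 = M i 1).
Proof. by split; rewrite mxE sum2 !mxE /=; ring. Qed.

Lemma mul_sw (M : 'M[K]_2) i :
  ((M *m sw K) i 0 = M i 1) * ((M *m sw K) i 1 = M i 0).
Proof. by split; rewrite mxE sum2 !mxE /=; ring. Qed.

Lemma hD_rot w ab x y : w ^+ 3 = 1 ->
  eval_curve (hD ab) (pt (w * x) y) = eval_curve (hD ab) (pt x y) *m dg w.
Proof.
move=> w3; apply: eval2_eq => i; rewrite !mul_dg !evE.
have [-> ->] := hD_eval ab x y i; have [-> ->] := hD_eval ab (w * x) y i.
rewrite /al /be /ga !exprMn w3 !mul1r; split; ring.
Qed.

Lemma hD_swap ab x y :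
  eval_curve (hD ab) (pt y x) = - (eval_curve (hD ab) (pt x y) *m sw K).
Proof.
apply: eval2_eq => i; rewrite ![(- _ : 'M_2) _ _]mxE !mul_sw !evE.
have [-> ->] := hD_eval ab x y i; have [-> ->] := hD_eval ab y x i.
by rewrite /al /be /ga; split; ring.
Qed.

Definition cross ab : 'rV[K]_3 :=
  \row_i nth 0 [:: ab 0 1 * ab 1 (inord 2) - ab 0 (inord 2) * ab 1 1;
                   ab 0 (inord 2) * ab 1 0 - ab 0 0 * ab 1 (inord 2);
                   ab 0 0 * ab 1 1 - ab 0 1 * ab 1 0] i.

Lemma crossE ab : [/\ cross ab 0 0 = ab 0 1 * ab 1 (inord 2) - ab 0 (inord 2) * ab 1 1,
  cross ab 0 1 = ab 0 (inord 2) * ab 1 0 - ab 0 0 * ab 1 (inord 2)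
  & cross ab 0 (inord 2) = ab 0 0 * ab 1 1 - ab 0 1 * ab 1 0].
Proof. by split; rewrite mxE ?inordK. Qed.

(** The product of al, be and ga, of degree eight, collects the branch
    points; the remaining factor is pulled back from the target of the
    covering. *)
Lemma hD_det ab x y : (\det (hD ab)).@[pt x y 0] =
  2 * (al x y * be x y * ga x y)
  * (cross ab 0 (inord 2) * ga x y ^+ 3 - cross ab 0 1 * al x y ^+ 2).
Proof.
have [_ -> ->] := crossE ab; rewrite det22 mevalB !mevalM.
have [-> ->] := hD_eval ab x y 0; have [-> ->] := hD_eval ab x y 1.
by rewrite /ga; ring.
Qed.

Lemma cross_neq0 ab : \rank ab = 2%N -> cross ab != 0.
Proof.
move=> r2; apply/eqP => c0.
have [c1 c2 c3] := crossE ab; rewrite c0 !mxE in c1 c2 c3.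
have fr : row_free ab by rewrite /row_free r2.
have minor k l : ab 0 k * ab 1 l = ab 0 l * ab 1 k.
  apply/eqP; rewrite -subr_eq0.
  move: k l; apply: ord3P; apply: ord3P; rewrite ?subrr // -?c1 -?c2 -?c3 ?eqxx //;
   by rewrite -opprB oppr_eq0 -?c1 -?c2 -?c3.
have a0 k : ab 0 k = 0.
  have : pt (ab 1 k) (- ab 0 k) *m ab = 0.
    by apply/rowP => l; rewrite !mxE sum2 !mxE /= [ab 1 k * _]mulrC minor; ring.
  move=> /eqP; rewrite -[X in _ == X](mul0mx _ ab) => /eqP/(row_free_inj fr)/eqP.
  by rewrite pt_eq0 oppr_eq0 => /andP[_ /eqP].
have : pt 1 0 *m ab = 0.
  by apply/rowP => l; rewrite !mxE sum2 !mxE /= a0; ring.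
move=> /eqP; rewrite -[X in _ == X](mul0mx _ ab) => /eqP/(row_free_inj fr)/eqP.
by rewrite pt_eq0 oner_eq0.
Qed.

(** Both vectors are orthogonal to the two independent rows of ab. *)
Lemma cross_perp ab (v : 'rV[K]_3) : \rank ab = 2%N -> v != 0 ->
  ab *m v^T = 0 -> exists2 k, k != 0 & cross ab = k *: v.
Proof.
move=> r2 v0 av.
have c0 := cross_neq0 r2.
have e i : ab i 0 * v 0 0 + ab i 1 * v 0 1 + ab i (inord 2) * v 0 (inord 2) = 0.
  have := congr1 (fun M : 'M_(2, 1) => M i 0) av.
  by rewrite /= !mxE sum3 !mxE.
have [c1 c2 c3] := crossE ab.
have par i j : cross ab 0 i * v 0 j = cross ab 0 j * v 0 i.
  apply/eqP; rewrite -subr_eq0; apply/eqP.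
  have e0 := e 0; have e1 := e 1.
  have P01 : cross ab 0 0 * v 0 1 - cross ab 0 1 * v 0 0 = 0.
    rewrite c1 c2; transitivity (ab 1 (inord 2) * 0 - ab 0 (inord 2) * 0); last by ring.
    by rewrite -{1}e0 -e1; ring.
  have P02 : cross ab 0 0 * v 0 (inord 2) - cross ab 0 (inord 2) * v 0 0 = 0.
    rewrite c1 c3; transitivity (ab 0 1 * 0 - ab 1 1 * 0); last by ring.
    by rewrite -{1}e1 -e0; ring.
  have P12 : cross ab 0 1 * v 0 (inord 2) - cross ab 0 (inord 2) * v 0 1 = 0.
    rewrite c2 c3; transitivity (ab 1 0 * 0 - ab 0 0 * 0); last by ring.
    by rewrite -{1}e0 -e1; ring.
  move: i j; apply: ord3P; apply: ord3P; rewrite ?subrr //;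
    by rewrite -opprB ?P01 ?P02 ?P12 oppr0.
have [j vj] : exists j, v 0 j != 0.
  apply/existsP; rewrite -negb_forall; apply: contra v0 => /forallP z.
  by apply/eqP/rowP => i; rewrite (eqP (z i)) mxE.
have ec : cross ab = (cross ab 0 j / v 0 j) *: v.
  apply/rowP => i; rewrite [RHS]mxE mulrAC -par mulfK //.
exists (cross ab 0 j / v 0 j) => //.
by apply: contraNneq c0 => k0; rewrite ec k0 scale0r.
Qed.

(** Invariance under the rotation leaves the monomials x^7, x^4 y^3 and x y^6
    in the first column, and the swap determines the second column from the
    first. So the equivariant curves depend on three coefficients per row, as
    many as there are covariants. *)
Lemma hD_normal w (g : 'M[{mpoly K[2]}]_2) : w ^+ 2 + w + 1 = 0 ->
  (forall i j, g i j \is 7.-homog) ->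
  (forall x y, eval_curve g (pt (w * x) y) = eval_curve g (pt x y) *m dg w) ->
  (forall x y, eval_curve g (pt y x) = - (eval_curve g (pt x y) *m sw K)) ->
  exists ab, g = hD ab.
Proof.
move=> w3 hg eg egs.
have ex i : exists p1 p4 p7 : K, forall x y,
    (g i 0).@[pt x y 0] = p1 * x * y ^+ 6 + p4 * x ^+ 4 * y ^+ 3 + p7 * x ^+ 7.
  have [p sp ep] := bformP (hg i 0); exists p`_1, p`_4, p`_7 => x y.
  have pw : \poly_(k < 8) (p`_k * w ^+ k) = w *: p.
    apply: poly_eval_inj => z; rewrite horner_poly hornerZ -(bform_pt1 _ sp) -ep.
    have := congr1 (fun M : 'M_2 => M i 0) (eg z 1).
    rewrite /= !mxE sum2 !mxE /= mulr0 addr0 => E; rewrite [RHS]mulrC -E.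
    rewrite ep bform_eval; apply: eq_bigr => k _.
    by rewrite pt0 pt1 expr1n mulr1 exprMn mulrA.
  have pk k : (k < 8)%N -> p`_k * w ^+ k = w * p`_k.
    by move=> k8; have := congr1 (coefp k) pw; rewrite /= coef_poly k8 coefZ.
  have w0 := cube_root_neq0 w3.
  have z k : (k < 8)%N -> w ^+ k != w -> p`_k = 0.
    move=> /pk e wk; apply/eqP; move/eqP: e; rewrite mulrC -subr_eq0 -mulrBl.
    by rewrite mulf_eq0 subr_eq0 (negPf wk).
  have w1 := cube_root_neq1 w3.
  have w21 : w ^+ 2 != w.
    by apply: contraNneq w1 => e; apply/eqP/(mulfI w0); rewrite mulr1 -expr2.
  have w13 := cube_root1 w3.
  have p0 : p`_0 = 0 by apply: z => //; rewrite expr0 eq_sym.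
  have p2 : p`_2 = 0 by apply: z.
  have p3 : p`_3 = 0 by apply: z => //; rewrite w13 eq_sym.
  have p5 : p`_5 = 0 by apply: z => //; rewrite (cube_root_exp w3).
  have p6 : p`_6 = 0 by apply: z => //; rewrite (cube_root_exp w3) expr0 eq_sym.
  rewrite ep bform_eval !big_ord_recl big_ord0 /bump /= p0 p2 p3 p5 p6 pt0 pt1.
  by ring.
have [p1 [p4 [p7 ep]]] := ex 0; have [r1 [r4 [r7 er]]] := ex 1.
(* Inverts the change of basis from x al be, - x ga^3, - x al^2 to x y^6, x^4
   y^3, x^7. *)
pose R3 (a1 a4 a7 : K) : 'rV[K]_3 :=
  \row_j nth 0 [:: 2 * (a7 - a1); - (a7 + a1) - a4; - (2 * (a7 + a1))] j.
exists (\matrix_(i, j) (if i == 0 then R3 p1 p4 p7 else R3 r1 r4 r7) 0 j).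
apply: eval_curve_inj => q; rewrite (pt_eta q); move: (q 0 0) (q 0 1) => x y.
apply: eval2_eq => i.
have -> : (g i 1).@[pt x y 0] = - (g i 0).@[pt y x 0].
  have := congr1 (fun M : 'M_2 => M i 0) (egs x y).
  by rewrite /= !mxE sum2 !mxE /= mulr0 add0r mulr1 => ->; rewrite opprK.
set AB := \matrix_(_, _) _.
have [e1 e2] := hD_eval AB x y i.
rewrite !evE e1 e2 /AB; move: i {e1 e2}; apply: ord2P => /=;
  rewrite !mxE /= !inordK //= ?ep ?er /al /be /ga; by split; field.
Qed.

End DihedralForms.

(** * Invariant forms of the dihedral group *)

Section Invariants.
Variable K : numClosedFieldType.
Implicit Types (f : {mpoly K[2]}) (q : 'rV[K]_2).

Lemma comp_homog n m f (t : 2.-tuple {mpoly K[2]}) : f \is n.-homog ->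
  (forall i, tnth t i \is m.-homog) -> f \mPo t \is (m * n).-homog.
Proof.
move=> /bformP[p _ ->] ht; rewrite raddf_sum; apply: rpred_sum => i _ /=.
rewrite comp_mpolyZ rmorphM !rmorphXn /= !comp_mpolyXU -!tnth_nth.
apply: rpredZ.
have := dhomogM (dhomogMn i (ht 0)) (dhomogMn (n - i) (ht 1)).
by rewrite -mulnDr subnKC // -ltnS.
Qed.

Lemma precomp_homog m k n d (c : 'M[{mpoly K[2]}]_(m, k)) (phi : 'rV_2) :
  (forall i j, c i j \is n.-homog) -> (forall i j, phi i j \is d.-homog) ->
  forall i j, precomp c phi i j \is (d * n).-homog.
Proof.
move=> hc hp i j; rewrite mxE; apply: comp_homog => // l.
by rewrite tnth_mktuple.
Qed.

Lemma mul_const_homog n m k l (A : 'M[{mpoly K[2]}]_(m, k)) (M : 'M[K]_(k, l)) :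
  (forall i j, A i j \is n.-homog) ->
  forall i j, (A *m map_mx (@mpolyC 2 K) M) i j \is n.-homog.
Proof.
move=> hA i j; rewrite mxE; apply: rpred_sum => s _.
by rewrite [map_mx _ M _ _]mxE mulrC mul_mpolyC rpredZ.
Qed.

Lemma mobius_homog (s : 'M[K]_2) i j : mobius s i j \is 1.-homog.
Proof. by rewrite mxE; apply: rpred_sum => l _; apply/rpredZ/X_homog. Qed.

Lemma precomp_mobius_homog m k n (c : 'M[{mpoly K[2]}]_(m, k)) s :
  (forall i j, c i j \is n.-homog) ->
  forall i j, precomp c (mobius s) i j \is n.-homog.
Proof.
move=> hc i j; have := precomp_homog hc (mobius_homog s) i j.
by rewrite mul1n.
Qed.

Lemma eval_precomp_mobius m k (c : 'M[{mpoly K[2]}]_(m, k)) s q :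
  eval_curve (precomp c (mobius s)) q = eval_curve c (q *m s^T).
Proof. by rewrite eval_precomp eval_mobius. Qed.

Lemma precomp_mobius_nocz m k (c : 'M[{mpoly K[2]}]_(m, k)) s :
  s \in unitmx -> nocz c -> nocz (precomp c (mobius s)).
Proof.
move=> us nc q q0; rewrite eval_precomp_mobius; apply: nc.
apply: contraNneq q0 => e; apply/eqP.
by rewrite -[q](mulmxK (_ : s^T \in unitmx)) ?unitmx_tr // e mul0mx.
Qed.

Lemma eval_curve_scale m k n (c : 'M[{mpoly K[2]}]_(m, k)) q a :
  (forall i j, c i j \is n.-homog) ->
  eval_curve c (a *: q) = a ^+ n *: eval_curve c q.
Proof.
by move=> hc; apply/matrixP => i j; rewrite !mxE (form_scale _ _ (hc i j)).
Qed.

(** The form z 1 * phi 0 - z 0 * phi 1 has a zero q, and phi is a nonzero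
    multiple of z there. *)
Lemma curve_onto n (phi : 'rV[{mpoly K[2]}]_2) (z : 'rV[K]_2) :
  (forall i j, phi i j \is n.+1.-homog) -> nocz phi -> z != 0 ->
  exists (q : 'rV[K]_2) (k : K), [/\ q != 0, k != 0 & eval_curve phi q = k *: z].
Proof.
move=> hp np z0.
have [|q q0 e] := @form_zero _ n (z 0 1 *: phi 0 0 - z 0 0 *: phi 0 1).
  by apply: rpredB; apply: rpredZ; apply: hp.
have e' : (lin z).@[eval_curve phi q 0] = 0.
  by rewrite lin_eval !evE -e mevalB !mevalZ.
have [k ek] := lin_eval_eq0 z0 e'.
exists q, k; split=> //; apply: contraNneq (np q q0) => k0.
by rewrite ek k0 scale0r.
Qed.

Definition rotF (w : K) f :=
  f \mPo ([tuple w *: 'X_0; 'X_1] : 2.-tuple {mpoly K[2]}).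
Definition swp f := f \mPo [tuple 'X_1; 'X_0 : {mpoly K[2]}].

Lemma rotF_eval w f x y : (rotF w f).@[pt x y 0] = f.@[pt (w * x) y 0].
Proof.
rewrite comp_mpoly_meval; apply: meval_eq; apply: ord2P;
  by rewrite (tnth_nth 0) /= ?mevalZ mevalXU !mxE.
Qed.

Lemma swp_eval f x y : (swp f).@[pt x y 0] = f.@[pt y x 0].
Proof.
rewrite comp_mpoly_meval; apply: meval_eq; apply: ord2P;
  by rewrite (tnth_nth 0) /= mevalXU !mxE.
Qed.

Lemma rotFM w f h : rotF w (f * h) = rotF w f * rotF w h.
Proof. exact: rmorphM. Qed.
Lemma rotFX0 w : rotF w 'X_0 = w *: 'X_0.
Proof. exact: comp_mpolyXU. Qed.
Lemma rotFX1 w : rotF w 'X_1 = 'X_1.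
Proof. exact: comp_mpolyXU. Qed.

Lemma X_neq0 (i : 'I_2) : ('X_i : {mpoly K[2]}) != 0.
Proof. by rewrite -msize_poly_eq0 msizeX. Qed.

Lemma factorX0 n f : f \is n.-homog -> f.@[pt 0 1 0] = 0 ->
  exists2 h, h \is n.-1.-homog & f = 'X_0 * h.
Proof.
move=> hf f0; have [|h hh ->] := form_factor_pred _ hf f0.
  by rewrite pt_eq0 oner_eq0 andbF.
by exists h => //; rewrite /lin pt0 pt1 scale1r scale0r subr0.
Qed.

Lemma factorX1 n f : f \is n.-homog -> f.@[pt 1 0 0] = 0 ->
  exists2 h, h \is n.-1.-homog & f = 'X_1 * h.
Proof.
move=> hf f0; have [|h hh ->] := form_factor_pred _ hf f0.
  by rewrite pt_eq0 oner_eq0.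
exists (- h); rewrite ?rpredN // /lin pt0 pt1 scale1r scale0r sub0r.
by rewrite mulrN mulNr.
Qed.

Lemma rotF_X0 w l f : w != 0 -> rotF w ('X_0 * f) = l *: ('X_0 * f) ->
  rotF w f = (l / w) *: f.
Proof.
move=> w0; rewrite rotFM rotFX0 => e; apply: (mulfI (X_neq0 0)).
apply: (scalerI w0); by rewrite scalerAl e -scalerAr scalerA [w * _]mulrC divfK.
Qed.

Lemma rotF_X1 w l f : rotF w ('X_1 * f) = l *: ('X_1 * f) -> rotF w f = l *: f.
Proof.
by rewrite rotFM rotFX1 => e; apply: (mulfI (X_neq0 1)); rewrite e scalerAr.
Qed.

(** A semi-invariant vanishes at a fixed point at which its multiplier
    differs from that of the point. *)
Lemma rotF_01 w l f : rotF w f = l *: f -> l != 1 -> f.@[pt 0 1 0] = 0.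
Proof.
move=> e l1; have := rotF_eval w f 0 1; rewrite e mevalZ mulr0 => /eqP.
rewrite -subr_eq0 -[X in _ - X]mul1r -mulrBl mulf_eq0 subr_eq0 (negPf l1).
by move=> /eqP.
Qed.

Lemma rotF_10 w n l f : f \is n.-homog -> rotF w f = l *: f -> l != w ^+ n ->
  f.@[pt 1 0 0] = 0.
Proof.
move=> hf e l1; have := rotF_eval w f 1 0; rewrite e mevalZ.
have -> : pt (w * 1) 0 = w *: pt 1 0 by rewrite pt_scale mulr0.
rewrite (form_scale _ _ hf) => /eqP.
by rewrite -subr_eq0 -mulrBl mulf_eq0 subr_eq0 (negPf l1) => /eqP.
Qed.

(** Subtracting from an invariant form a suitable multiple of a power of the
    first component of the covering makes it vanish at the two points over
    infinity; invariance under the rotation then forces zeros of order three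
    there, which is the second component. *)
Lemma invariant_form w d f : w ^+ 2 + w + 1 = 0 -> f \is (6 * d).-homog ->
  (forall x y, f.@[pt (w * x) y 0] = f.@[pt x y 0]) ->
  (forall x y, f.@[pt y x 0] = f.@[pt x y 0]) ->
  exists2 p, p \is d.-homog &
    forall q, f.@[q 0] = p.@[eval_curve (phi_D3 K) q 0].
Proof.
move=> w3; have w13 := cube_root1 w3; have w0 := cube_root_neq0 w3.
have w1 := cube_root_neq1 w3; have w21 := cube_root_sq_neq1 w3.
elim: d f => [|d IH] f hf fr fs.
  rewrite muln0 in hf; have [c ->] := form_const hf.
  by exists c%:MP => [|q]; rewrite ?mevalC // -[c%:MP]mulr1 mul_mpolyC rpredZ ?dhomog1.
have w6d : w ^+ (6 * d) = 1.
  by rewrite -[6%N]/(3 * 2)%N -mulnA exprM w13 expr1n.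
(* The first component of the covering takes the value -1/4 at [0, 1]. *)
pose c := (-4) ^+ d.+1 * f.@[pt 0 1 0].
pose p0 : {mpoly K[2]} := c *: 'X_0 ^+ d.+1.
have hp0 : p0 \is d.+1.-homog by apply/rpredZ/homogX1/X_homog.
pose f0 : {mpoly K[2]} := c *: (- alpha3 K ^+ 2) ^+ d.+1.
have ef0 q : f0.@[q 0] = p0.@[eval_curve (phi_D3 K) q 0].
  rewrite !mevalZ !mevalXn mevalXU evE [phi_D3 _ _ _]mxE /=; done.
have hf0 : f0 \is (6 * d.+1).-homog.
  apply: rpredZ; apply: dhomogMn; rewrite rpredN.
  exact: (dhomogMn 2 (alpha3_homog K)).
have f0E x y : f0.@[pt x y 0] = c * (- al x y ^+ 2) ^+ d.+1.
  by rewrite mevalZ mevalXn mevalN mevalXn alpha3_eval.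
pose f' := f - f0.
have hf' : f' \is (6 * d.+1).-homog by rewrite rpredB.
have f'r : rotF w f' = 1 *: f'.
  apply: mpoly_eval_inj => q; rewrite scale1r (pt_eta q) rotF_eval !mevalB fr !f0E.
  by rewrite /al [(w * _) ^+ 3]exprMn w13 mul1r.
have f's x y : f'.@[pt y x 0] = f'.@[pt x y 0].
  rewrite !mevalB fs !f0E; congr (_ - _ * _ ^+ _); rewrite /al; ring.
have z01 : f'.@[pt 0 1 0] = 0.
  rewrite mevalB f0E /c /al expr0n expr1n /= sub0r mulrAC -exprMn.
  have -> : -4 * - (-1 / 2) ^+ 2 = 1 :> K by field.
  by rewrite expr1n mul1r subrr.
have z10 : f'.@[pt 1 0 0] = 0 by rewrite f's.
have [f1 h1 e1] := factorX0 hf' z01.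
have r1 : rotF w f1 = (1 / w) *: f1 by apply: rotF_X0; rewrite -?e1.
have z1 : f1.@[pt 0 1 0] = 0.
  apply: (rotF_01 r1); rewrite mul1r; apply: contraNneq w1 => h.
  by rewrite -[w]invrK h invr1.
have [f2 h2 e2] := factorX0 h1 z1.
have r2 : rotF w f2 = (1 / w / w) *: f2 by apply: rotF_X0; rewrite -?e2.
have z2 : f2.@[pt 0 1 0] = 0.
  apply: (rotF_01 r2); rewrite mul1r -invfM -expr2; apply: contraNneq w21 => h.
  by rewrite -[w ^+ 2]invrK h invr1.
have [f3 h3 e3] := factorX0 h2 z2.
have r3 : rotF w f3 = 1 *: f3.
  have -> : 1 = 1 / w / w / w :> K.
    by rewrite mul1r -!invfM -expr2 -exprSr w13 invr1.
  by apply: rotF_X0; rewrite -?e3.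
have e30 : f' = 'X_0 ^+ 3 * f3 by rewrite e1 e2 e3; ring.
have z3 : f3.@[pt 1 0 0] = 0.
  by move: z10; rewrite e30 mevalM mevalXn mevalXU pt0 expr1n mul1r.
have [f4 h4 e4] := factorX1 h3 z3.
have r4 : rotF w f4 = 1 *: f4 by apply: rotF_X1; rewrite -e4.
have z4 : f4.@[pt 1 0 0] = 0.
  apply: (rotF_10 h4 r4); rewrite eq_sym.
  have -> : (6 * d.+1).-1.-1.-1.-1 = (2 + 6 * d)%N by rewrite mulnS.
  by rewrite exprD w6d mulr1.
have [f5 h5 e5] := factorX1 h4 z4.
have r5 : rotF w f5 = 1 *: f5 by apply: rotF_X1; rewrite -e5.
have z5 : f5.@[pt 1 0 0] = 0.
  apply: (rotF_10 h5 r5); rewrite eq_sym.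
  have -> : (6 * d.+1).-1.-1.-1.-1.-1 = (1 + 6 * d)%N by rewrite mulnS.
  by rewrite exprD w6d mulr1.
have [f6 h6 e6] := factorX1 h5 z5.
have r6 : rotF w f6 = 1 *: f6 by apply: rotF_X1; rewrite -e6.
have e36 : f' = gamma K ^+ 3 * f6 by rewrite e30 e4 e5 e6 /gamma; ring.
have h6' : f6 \is (6 * d).-homog.
  have -> : (6 * d)%N = (6 * d.+1).-1.-1.-1.-1.-1.-1 by rewrite mulnS.
  exact: h6.
have g0 : gamma K ^+ 3 != 0 by rewrite expf_neq0 // mulf_neq0 ?X_neq0.
have s6 : swp f6 = f6.
  apply: (mulfI g0); apply: mpoly_eval_inj => q; rewrite (pt_eta q).
  rewrite [LHS]mevalM swp_eval -[in RHS]e36 -[RHS]f's e36 [RHS]mevalM.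
  congr (_ * _).
  by rewrite !mevalXn !gamma_eval /ga mulrC.
have [||p hp ep] := IH f6 h6'.
- by move=> x y; rewrite -rotF_eval r6 scale1r.
- by move=> x y; rewrite -{2}s6 swp_eval.
exists (p0 + 'X_1 * p).
  by rewrite rpredD // -[d.+1]add1n dhomogM // X_homog.
move=> q; rewrite mevalD -ef0 mevalM -ep mevalXU -[f](subrK f0) -/f' e36.
by rewrite mevalD mevalM addrC evE [phi_D3 _ _ _]mxE.
Qed.

Lemma linear_form (p : {mpoly K[2]}) : p \is 1.-homog ->
  exists a b, forall q, p.@[q 0] = a * q 0 0 + b * q 0 1.
Proof.
move=> /bformP[r _ ->]; exists r`_1, r`_0 => q.
by rewrite bform_eval !big_ord_recl big_ord0 /bump /=; ring.
Qed.

(** At the fixed points [1, 0] and [1, 1] the covering does not vanish, which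
    forces the multipliers c and c' to be 1. So the components are invariants
    of degree six, which are linear combinations of the components of the
    standard covering. *)
Lemma covering_normal w (phi : 'rV[{mpoly K[2]}]_2) c c' : w ^+ 2 + w + 1 = 0 ->
  (forall i j, phi i j \is 6.-homog) -> nocz phi ->
  (forall x y, eval_curve phi (pt (w * x) y) = c *: eval_curve phi (pt x y)) ->
  (forall x y, eval_curve phi (pt y x) = c' *: eval_curve phi (pt x y)) ->
  exists2 nu, nu \in unitmx &
    forall q, eval_curve phi q = eval_curve (phi_D3 K) q *m nu^T.
Proof.
move=> w3 hp np er es.
have nz1 : pt (1 : K) 0 != 0 by rewrite pt_eq0 oner_eq0.
have nz2 : pt (1 : K) 1 != 0 by rewrite pt_eq0 oner_eq0.
have c1 : c = 1.
  have := er 1 0; have -> : pt (w * 1) 0 = w *: pt 1 0 by rewrite pt_scale mulr0.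
  rewrite (eval_curve_scale _ _ hp) (cube_root_exp w3) expr0 => /eqP.
  rewrite -subr_eq0 -scalerBl scaler_eq0 (negPf (np _ nz1)) orbF subr_eq0.
  by move=> /eqP.
have c'1 : c' = 1.
  have /eqP := es 1 1; rewrite -[X in X == _]scale1r -subr_eq0 -scalerBl.
  by rewrite scaler_eq0 (negPf (np _ nz2)) orbF subr_eq0 => /eqP.
have lf j : exists a b, forall q, (phi 0 j).@[q 0] =
    a * eval_curve (phi_D3 K) q 0 0 + b * eval_curve (phi_D3 K) q 0 1.
  have [|||p h1 ep] := @invariant_form w 1 (phi 0 j) w3.
  - exact: hp.
  - move=> x y; have := congr1 (fun M : 'rV_2 => M 0 j) (er x y).
    by rewrite /= c1 scale1r !evE.
  - move=> x y; have := congr1 (fun M : 'rV_2 => M 0 j) (es x y).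
    by rewrite /= c'1 scale1r !evE.
  have [a [b eab]] := linear_form h1.
  by exists a, b => q; rewrite ep eab.
have [a0 [b0 e0]] := lf 0; have [a1 [b1 e1]] := lf 1.
pose nu := mx22 a0 b0 a1 b1.
have enu q : eval_curve phi q = eval_curve (phi_D3 K) q *m nu^T.
  apply/rowP; apply: ord2P; rewrite !mxE sum2 ?e0 ?e1 !mxE /=; ring.
exists nu => //; apply/negPn/negP => nu0.
have [z z0 zn] : exists2 z : 'rV[K]_2, z != 0 & z *m nu^T = 0.
  have : ~~ row_free nu^T by rewrite row_free_unit unitmx_tr.
  rewrite -kermx_eq0 => /rowV0Pn[z /sub_kermxP zn z0].
  by exists z.
have [q [k [q0 k0 eq]]] := curve_onto (@phi_D3_homog K) (@phi_D3_nocz K) z0.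
by have := np q q0; rewrite enu eq -scalemxAl zn scaler0 eqxx.
Qed.

End Invariants.

(** * The octahedron in dihedral position *)

Section Frame.
Variables (K : numClosedFieldType) (w xi e0 e1 : K).
Hypotheses (w3 : w ^+ 2 + w + 1 = 0) (xi4 : xi ^+ 4 = -1).
Hypotheses (e01 : e0 * e1 = 1) (e01s : (e0 + e1) ^+ 2 = -2).

(** Coordinates in which the octahedral sextic is invariant under the
    standard dihedral group, with a vertex at [- e0, 1]. *)
Definition frame : 'M[K]_2 := mx22 1 (e0 * xi) e0 xi.

Lemma e0_neq0 : e0 != 0.
Proof. by apply: contra_eq_neq e01 => ->; rewrite mul0r eq_sym oner_eq0. Qed.

Lemma e0_4 : e0 ^+ 4 = - 4 * e0 ^+ 2 - 1.
Proof.
apply/eqP; rewrite -subr_eq0; apply/eqP.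
have -> : e0 ^+ 4 - (- 4 * e0 ^+ 2 - 1) =
  e0 ^+ 2 * ((e0 + e1) ^+ 2 + 2)
  + (1 - e0 * e1) * (e0 * e1 + 1 + 2 * e0 ^+ 2) by ring.
by rewrite e01s e01; ring.
Qed.

Lemma e0_6 : e0 ^+ 6 != 1.
Proof.
rewrite -subr_eq0; apply/negP => /eqP h.
have h5 : 5 * e0 ^+ 2 = -1.
  have : 3 * (5 * e0 ^+ 2 + 1) = 0 by rewrite -[RHS]h; ring: e0_4.
  by move=> /eqP; rewrite mulf_eq0 pnatr_eq0 /= addr_eq0 => /eqP.
have : (6 : K) = 0.
  transitivity (25 * (e0 ^+ 4 - (- 4 * e0 ^+ 2 - 1))); last by rewrite e0_4; ring.
  transitivity ((5 * e0 ^+ 2) ^+ 2 + 20 * (5 * e0 ^+ 2) + 25); first by rewrite h5; ring.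
  by ring.
by move/eqP; rewrite pnatr_eq0.
Qed.

Lemma xi_neq0 : xi != 0.
Proof. by apply: (@powS_neq0 _ _ 3); rewrite xi4 oppr_eq0 oner_eq0. Qed.

(** The value at [1, 0] of the octahedral sextic in the coordinates of the
    frame. *)
Definition frame_lc := - 4 * e0 ^+ 3 * xi.

Lemma frame_lc_neq0 : frame_lc != 0.
Proof.
by rewrite !mulf_neq0 ?expf_neq0 ?xi_neq0 ?e0_neq0 // oppr_eq0 pnatr_eq0.
Qed.

Lemma octv_frame x y : octv (pt x y *m frame) =
  frame_lc * (x ^+ 6 - 5 * (e0 + e1) * x ^+ 3 * y ^+ 3 + y ^+ 6).
Proof.
rewrite /frame pt_mul /octv /Oc pt0 pt1 /frame_lc.
have s : e0 ^+ 3 * (e0 + e1) = - 3 * e0 ^+ 2 - 1.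
  transitivity (e0 ^+ 4 + e0 ^+ 2 * (e0 * e1)); first by ring.
  by rewrite e01 e0_4; ring.
transitivity (- 4 * xi * (e0 ^+ 3 * (x ^+ 6 + y ^+ 6)
   - 5 * (e0 ^+ 3 * (e0 + e1)) * x ^+ 3 * y ^+ 3)); last by ring.
by rewrite s; ring: e0_4 xi4.
Qed.

Lemma frame_unit : frame \in unitmx.
Proof.
rewrite unit22 det_22; have -> : 1 * xi - e0 * xi * e0 = xi * (1 - e0 ^+ 2) by ring.
rewrite mulf_neq0 ?xi_neq0 // subr_eq0 eq_sym; apply: contraNneq e0_6 => h.
by rewrite -[6%N]/(2 * 3)%N exprM h expr1n.
Qed.

(** The six vertices of the octahedron in the coordinates of the frame: the
    points [- eps j, 1]. They form one orbit of the dihedral group, because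
    e0 e1 = 1. *)
Definition eps (j : 'I_6) : K :=
  if (j < 3)%N then e0 * w ^+ j else e1 * w ^+ (j - 3).

Lemma prod_cube a x y : (x + a * y) * (x + a * w * y) * (x + a * w ^+ 2 * y)
  = x ^+ 3 + a ^+ 3 * y ^+ 3.
Proof.
have w2 : w ^+ 2 = - w - 1 by apply/eqP; rewrite -subr_eq0 -w3; apply/eqP; ring.
by ring: w2.
Qed.

Lemma octv_frame_prod x y : octv (pt x y *m frame) =
  frame_lc * \prod_j (x + eps j * y).
Proof.
rewrite octv_frame; congr (_ * _); rewrite !big_ord_recl big_ord0 /eps /bump /=.
rewrite !expr0 !expr1 !mulr1 !mulrA -[RHS]/((_ * _ * _) * _ * _ * _).
transitivity ((x ^+ 3 + e0 ^+ 3 * y ^+ 3) * (x ^+ 3 + e1 ^+ 3 * y ^+ 3)).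
  have s3 : e0 ^+ 3 + e1 ^+ 3 = - 5 * (e0 + e1).
    transitivity ((e0 + e1) * ((e0 + e1) ^+ 2 - 3 * (e0 * e1))); first by ring.
    by rewrite e01s e01; ring.
  transitivity (x ^+ 6 + (e0 ^+ 3 + e1 ^+ 3) * x ^+ 3 * y ^+ 3
     + (e0 * e1) ^+ 3 * y ^+ 6); last by ring.
  by rewrite s3 e01; ring.
by rewrite -!prod_cube; ring.
Qed.

End Frame.

Section EpsFacts.
Variables (K : numClosedFieldType) (w e0 e1 : K).
Hypotheses (w3 : w ^+ 2 + w + 1 = 0).
Hypotheses (e01 : e0 * e1 = 1) (e01s : (e0 + e1) ^+ 2 = -2).

Lemma eps_cases j : exists k,
  eps w e0 e1 j = e0 * w ^+ k \/ eps w e0 e1 j = e1 * w ^+ k.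
Proof. by rewrite /eps; case: ifP => _; [exists j; left|exists (j - 3)%N; right]. Qed.

Let e10 : e1 * e0 = 1. Proof. by rewrite mulrC. Qed.
Let e10s : (e1 + e0) ^+ 2 = -2. Proof. by rewrite addrC. Qed.

Lemma eps_neq0 j : eps w e0 e1 j != 0.
Proof.
have w0 := cube_root_neq0 w3; have [k [] ->] := eps_cases j;
rewrite mulf_neq0 ?expf_neq0 //; [exact: e0_neq0 e01|exact: e0_neq0 e10].
Qed.

Lemma eps_6 j : eps w e0 e1 j ^+ 6 != 1.
Proof.
have w6 k : (w ^+ k) ^+ 6 = 1.
  by rewrite -exprM mulnC -[6%N]/(3 * 2)%N !exprM (cube_root1 w3) !expr1n.
have [k [] ->] := eps_cases j; rewrite exprMn w6 mulr1;
 [exact: e0_6 e01 e01s|exact: e0_6 e10 e10s].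
Qed.

Lemma eps_inj : injective (eps w e0 e1).
Proof.
have w0 := cube_root_neq0 w3.
have pw i j : (i <= j < 3)%N -> w ^+ i = w ^+ j -> i = j.
  move=> /andP[ij j3] e; have : w ^+ (j - i) = 1.
    by apply: (mulfI (expf_neq0 i w0)); rewrite mulr1 -exprD subnKC.
  by move=> /(cube_root_exp_eq1 w3); rewrite modn_small; lia.
have pw' i j : (i < 3)%N -> (j < 3)%N -> w ^+ i = w ^+ j -> i = j.
  move=> i3 j3 e; case/orP: (leq_total i j) => ij.
    by apply: pw => //; rewrite ij.
  by apply/esym/pw => //; rewrite ij.
have ne i j : e0 * w ^+ i != e1 * w ^+ j.
  apply: contraNneq (e0_6 e01 e01s) => /(congr1 (fun z => z ^+ 3)).
  rewrite !exprMn -!exprM ![(_ * 3)%N]mulnC !exprM (cube_root1 w3) !expr1n !mulr1.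
  move=> e; rewrite -[6%N]/(3 + 3)%N exprD {2}e -exprMn e01 expr1n //.
move=> i j; rewrite /eps; case: (ltnP i 3) => i3; case: (ltnP j 3) => j3 /eqP.
- by move=> /eqP/(mulfI (e0_neq0 e01))/(pw' _ _ i3 j3)/val_inj.
- by rewrite (negPf (ne _ _)).
- by rewrite eq_sym (negPf (ne _ _)).
move=> /eqP/(mulfI (e0_neq0 e10)) /pw' h; apply/val_inj => /=.
by have := ltn_ord i; have := ltn_ord j; move: (h); lia.
Qed.

End EpsFacts.

Section Substitution.
Variable K : numClosedFieldType.

(** Linear substitutions act linearly on the coefficients of sextics. *)
Lemma sx_subst (a b c d : K) : exists M : 'M[K]_7, forall z u v,
  sx (z *m M) u v = sx z (a * u + b * v) (c * u + d * v).
Proof.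
pose fm (i : nat) : {mpoly K[2]} :=
  (a *: 'X_0 + b *: 'X_1) ^+ (6 - i) * (c *: 'X_0 + d *: 'X_1) ^+ i.
have hf (i : 'I_7) : fm i \is 6.-homog.
  have h1 p q : (p *: 'X_0 + q *: 'X_1 : {mpoly K[2]}) \is 1.-homog.
    by rewrite rpredD // rpredZ // X_homog.
  have := dhomogM (homogX1 (6 - i) (h1 a b)) (homogX1 i (h1 c d)).
  by rewrite subnK // -ltnS.
exists (\matrix_i coef6 (fm i)) => z u v.
rewrite /sx; under eq_bigr => j _ do rewrite mxE mulr_suml.
rewrite exchange_big; apply: eq_bigr => i _ /=.
have -> : (a * u + b * v) ^+ (6 - i) * (c * u + d * v) ^+ i = sx (coef6 (fm i)) u v.
  by rewrite coef6_sx // /fm; mev; rewrite pt0 pt1.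
rewrite /sx mulr_sumr; apply: eq_bigr => j _.
by rewrite -mulrA; congr (_ * _); rewrite !mxE.
Qed.

Lemma f1_subst (a b c d : K) (M : 'M[K]_7) m :
  (forall z u v, sx (z *m M) u v = sx z (a * u + b * v) (c * u + d * v)) ->
  f1 m *m M = f1 (mx22 d (- b) (- c) a *m m).
Proof.
move=> eM; apply: sx_inj => u v; rewrite eM !f1_octv mulmxA pt_mul.
by congr (octv (pt _ _ *m _)); ring.
Qed.

Lemma f1_homog n (g : 'M[{mpoly K[2]}]_2) : (forall i j, g i j \is n.-homog) ->
  forall i, f1 g 0 i \is (6 * n).-homog.
Proof.
move=> hg i; have hm (a b c d : nat) : (a + b + c + d = 6)%N ->
    g 1 1 ^+ a * g 0 1 ^+ b * g 0 0 ^+ c * g 1 0 ^+ d \is (6 * n).-homog.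
  move=> <-; rewrite mulnC !mulnDr.
  exact: (dhomogM (dhomogM (dhomogM (dhomogMn a (hg 1 1)) (dhomogMn b (hg 0 1)))
    (dhomogMn c (hg 0 0))) (dhomogMn d (hg 1 0))).
have mon (m : {mpoly K[2]}) (k : int) (a b c d : nat) : (a + b + c + d = 6)%N ->
    m = k%:~R * (g 1 1 ^+ a * g 0 1 ^+ b * g 0 0 ^+ c * g 1 0 ^+ d) ->
    m \is (6 * n).-homog.
  move=> s ->; have := hm _ _ _ _ s; rewrite mulrzl => h.
  by case: k => k; rewrite ?NegzE ?mulrNz ?rpredN rpredMn.
rewrite f1E mxE; case: i => [[|[|[|[|[|[|[|//]]]]]]] lti] /=.
- apply: rpredB; [apply: (@mon _ 1 1 0 0 5)|apply: (@mon _ 1 5 0 0 1)] => //; ring.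
- repeat first [apply: rpredB | apply: rpredD].
  + by apply: (@mon _ 1 5 0 1 0) => //; ring.
  + by apply: (@mon _ 5 4 1 0 1) => //; ring.
  + by apply: (@mon _ 5 1 0 1 4) => //; ring.
  + by apply: (@mon _ 1 0 1 0 5) => //; ring.
- repeat first [apply: rpredB | apply: rpredD].
  + by apply: (@mon _ (-5) 4 1 1 0) => //; ring.
  + by apply: (@mon _ 10 3 2 0 1) => //; ring.
  + by apply: (@mon _ 10 1 0 2 3) => //; ring.
  + by apply: (@mon _ 5 0 1 1 4) => //; ring.
- repeat first [apply: rpredB | apply: rpredD].
  + by apply: (@mon _ 10 3 2 1 0) => //; ring.
  + by apply: (@mon _ 10 2 3 0 1) => //; ring.
  + by apply: (@mon _ 10 1 0 3 2) => //; ring.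
  + by apply: (@mon _ 10 0 1 2 3) => //; ring.
- repeat first [apply: rpredB | apply: rpredD].
  + by apply: (@mon _ (-10) 2 3 1 0) => //; ring.
  + by apply: (@mon _ 5 1 4 0 1) => //; ring.
  + by apply: (@mon _ 5 1 0 4 1) => //; ring.
  + by apply: (@mon _ 10 0 1 3 2) => //; ring.
- repeat first [apply: rpredB | apply: rpredD].
  + by apply: (@mon _ 5 1 4 1 0) => //; ring.
  + by apply: (@mon _ 1 0 5 0 1) => //; ring.
  + by apply: (@mon _ 1 1 0 5 0) => //; ring.
  + by apply: (@mon _ 5 0 1 4 1) => //; ring.
- apply: rpredB; [apply: (@mon _ 1 0 1 5 0)|apply: (@mon _ 1 0 5 1 0)] => //; ring.
Qed.

Lemma QinvZ (k : K) z : Qinv (k *: z) = k ^+ 2 * Qinv z.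
Proof. by rewrite /Qinv /zc !mxE; ring. Qed.
Lemma Qinv_f1_eq0 (m : 'M[K]_2) : Qinv (f1 m) = 0 -> \det m = 0.
Proof. by rewrite Qinv_f1 => /eqP; rewrite mulf_eq0 pnatr_eq0 /= expf_eq0 => /eqP. Qed.

Lemma trv0Z (k : K) z : trv0 (k *: z) = k ^+ 2 * trv0 z.
Proof. by rewrite /trv0 /zc !mxE; ring. Qed.
Lemma trv1Z (k : K) z : trv1 (k *: z) = k ^+ 2 * trv1 z.
Proof. by rewrite /trv1 /zc !mxE; ring. Qed.
Lemma trv2Z (k : K) z : trv2 (k *: z) = k ^+ 2 * trv2 z.
Proof. by rewrite /trv2 /zc !mxE; ring. Qed.

Lemma Qinv_eval (F : 'rV[{mpoly K[2]}]_7) (q : 'rV[K]_2) :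
  (Qinv F).@[q 0] = Qinv (eval_curve F q).
Proof. by rewrite -Qinv_map. Qed.
Lemma trv0_eval (F : 'rV[{mpoly K[2]}]_7) (q : 'rV[K]_2) :
  (trv0 F).@[q 0] = trv0 (eval_curve F q).
Proof. by rewrite /trv0 /zc !mxE; ring. Qed.
Lemma trv1_eval (F : 'rV[{mpoly K[2]}]_7) (q : 'rV[K]_2) :
  (trv1 F).@[q 0] = trv1 (eval_curve F q).
Proof. by rewrite /trv1 /zc !mxE; ring. Qed.
Lemma trv2_eval (F : 'rV[{mpoly K[2]}]_7) (q : 'rV[K]_2) :
  (trv2 F).@[q 0] = trv2 (eval_curve F q).
Proof. by rewrite /trv2 /zc !mxE; ring. Qed.

Lemma sixth_powersE : sixth_powers K =
  row7 ('X_0 ^+ 6) (6 *: ('X_0 ^+ 5 * 'X_1)) (15 *: ('X_0 ^+ 4 * 'X_1 ^+ 2))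
    (20 *: ('X_0 ^+ 3 * 'X_1 ^+ 3)) (15 *: ('X_0 ^+ 2 * 'X_1 ^+ 4))
    (6 *: ('X_0 * 'X_1 ^+ 5)) ('X_1 ^+ 6).
Proof.
rewrite /sixth_powers -coef6_row7; congr coef6.
rewrite -!mul_mpolyC !mpolyC_nat; ring.
Qed.

Lemma sixth_powers_sx (p : 'rV[K]_2) u v :
  sx (eval_curve (sixth_powers K) p) u v = (p 0 0 * u + p 0 1 * v) ^+ 6.
Proof.
rewrite sixth_powersE (row7_eta (eval_curve _ p)) sx_row7 /zc !mxE !inordK //=.
by mev; ring.
Qed.

Lemma mderiv_mon2 (i : 'I_2) a b (p : 'rV[K]_2) :
  ('X_0 ^+ a * 'X_1 ^+ b : {mpoly K[2]})^`M(i).@[p 0] =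
  if i == 0 then a%:R * (p 0 0 ^+ a.-1 * p 0 1 ^+ b)
  else b%:R * (p 0 0 ^+ a * p 0 1 ^+ b.-1).
Proof.
rewrite mon2E mderivX mevalZ mevalX !big_ord_recl big_ord0 mulr1.
have -> : lift ord0 ord0 = 1 :> 'I_2 by apply/val_inj.
rewrite !mnmBE !mnm1E !mnm_tnth.
by move: i; apply: ord2P => /=; rewrite ?subn0 ?subn1.
Qed.

(** The tangent line at a sixth power consists of the sextics with a root of
    multiplicity five at the same place. *)
Lemma tangent_sixth_sx (p : 'rV[K]_2) (i : 'I_2) u v :
  sx (row i (tangent_line (sixth_powers K) p)) u v =
  6 * (if i == 0 then u else v) * (p 0 0 * u + p 0 1 * v) ^+ 5.
Proof.
have e0 a : ('X_0 ^+ a : {mpoly K[2]}) = 'X_0 ^+ a * 'X_1 ^+ 0.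
  by rewrite expr0 mulr1.
have e1 a : ('X_1 ^+ a : {mpoly K[2]}) = 'X_0 ^+ 0 * 'X_1 ^+ a.
  by rewrite expr0 mul1r.
have e2 a : ('X_0 * 'X_1 ^+ a : {mpoly K[2]}) = 'X_0 ^+ 1 * 'X_1 ^+ a by [].
have e3 a : ('X_0 ^+ a * 'X_1 : {mpoly K[2]}) = 'X_0 ^+ a * 'X_1 ^+ 1 by [].
rewrite sixth_powersE (row7_eta (row i _)) sx_row7 /zc !mxE !inordK //=.
rewrite !mderivZ; mev; rewrite (e0 6%N) (e1 6%N) (e2 5%N) (e3 5%N) !mderiv_mon2.
by move: i; apply: ord2P => /=; ring.
Qed.

End Substitution.

(** * Tangency to the one-dimensional orbit *)

Section Tangency.
Variable K : numClosedFieldType.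
Implicit Types (f h b : {mpoly K[2]}) (q p : 'rV[K]_2).

Lemma mderiv_lin q i : (lin q)^`M(i) = (if i == 0 then q 0 1 else - q 0 0)%:MP.
Proof.
rewrite /lin mderivB !mderivZ !mderivX !mnm1E.
have U0 (l : 'I_2) : (U_(l) - U_(l) = 0)%MM by apply/mnmP => k; rewrite !mnmE subnn.
by move: i; apply: ord2P => /=; rewrite U0 mpolyX0 scale0r scale1r scaler0
  ?subr0 ?sub0r -mul_mpolyC mulr1 ?mpolyCN.
Qed.

Lemma mderiv_lin_mul q f i (r : 'rV[K]_2) :
  ((lin q * f)^`M(i)).@[r 0] = (if i == 0 then q 0 1 else - q 0 0) * f.@[r 0]
     + (lin q).@[r 0] * (f^`M(i)).@[r 0].
Proof. by rewrite mderivM mevalD !mevalM mderiv_lin mevalC. Qed.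

(** By Euler's formula, a form whose partial derivatives vanish has a double
    zero; here this is read off the factorization f = lin q * f1. *)
Lemma form_sq_factor n f q : q != 0 -> f \is n.-homog -> f.@[q 0] = 0 ->
  (forall i, (f^`M(i)).@[q 0] = 0) ->
  exists2 h, h \is n.-1.-1.-homog & f = lin q ^+ 2 * h.
Proof.
move=> q0 hf fq dq; have [f1 h1 e1] := form_factor_pred q0 hf fq.
have z1 : f1.@[q 0] = 0.
  have d i := dq i; have d0 := d 0; have d1 := d 1.
  rewrite e1 mderiv_lin_mul lin_self mul0r addr0 /= in d0.
  rewrite e1 mderiv_lin_mul lin_self mul0r addr0 /= mulNr in d1.
  apply/eqP/negPn/negP => nz; move: q0; rewrite (pt_eta q) pt_eq0.
  move/eqP: d0; rewrite mulf_eq0 (negPf nz) orbF => ->.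
  by move/eqP: d1; rewrite oppr_eq0 mulf_eq0 (negPf nz) orbF => ->.
have [f2 h2 e2] := form_factor_pred q0 h1 z1.
by exists f2 => //; rewrite e1 e2; ring.
Qed.

Lemma sq_dvd_mderiv f h q i : f = lin q ^+ 2 * h -> (f^`M(i)).@[q 0] = 0.
Proof.
move=> ->; rewrite expr2 -mulrA mderiv_lin_mul mevalM lin_self.
by rewrite !mul0r mulr0 addr0.
Qed.

Lemma cancel_zero n q f b e : q != 0 -> b \is n.-homog -> f.@[q 0] != 0 ->
  f * b = lin q * e -> exists2 b', b' \is n.-1.-homog & b = lin q * b'.
Proof.
move=> q0 hb fq eb; apply: form_factor_pred => //.
have := congr1 (meval (q 0)) eb; rewrite /= !mevalM lin_self mul0r => /eqP.
by rewrite mulf_eq0 (negPf fq) => /eqP.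
Qed.

(** A curve in the closure of the octahedral orbit that touches the sextics
    u^6 and u^5 v to first order meets the invariant quadric to order four: by
    the transvectant equations the coefficients of u^2 v^4, u v^5 and v^6
    vanish to orders three, four and four. *)
Lemma Qinv_order4 n (F : 'rV[{mpoly K[2]}]_7) q : q != 0 ->
  (forall j, zc F j \is n.-homog) ->
  trv0 F = 0 -> trv1 F = 0 -> trv2 F = 0 ->
  (zc F 0).@[q 0] != 0 ->
  (forall j, (0 < j < 7)%N -> (zc F j).@[q 0] = 0) ->
  (forall i j, (1 < j < 7)%N -> ((zc F j)^`M(i)).@[q 0] = 0) ->
  exists E, Qinv F = lin q ^+ 4 * E.
Proof.
move=> q0 hF; rewrite /trv0 /trv1 /trv2 /Qinv.
have := hF 1; have := hF 2; have := hF 3; have := hF 4; have := hF 5; have := hF 6.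
move=> h6 h5 h4 h3 h2 h1 t0 t1 t2 z0 z d.
have [b1 _ e1] := form_factor_pred q0 h1 (z 1%N isT).
have [b2 _ e2] := form_sq_factor q0 h2 (z 2 isT) (fun i => d i 2 isT).
have [b3 _ e3] := form_sq_factor q0 h3 (z 3 isT) (fun i => d i 3 isT).
have [b4 g4 e4] := form_sq_factor q0 h4 (z 4 isT) (fun i => d i 4 isT).
have [b5 g5 e5] := form_sq_factor q0 h5 (z 5 isT) (fun i => d i 5 isT).
have [b6 g6 e6] := form_sq_factor q0 h6 (z 6 isT) (fun i => d i 6 isT).
move: t0 t1 t2; rewrite e1 e2 e3 e4 e5 e6.
move: z0; move: (zc F 0) => f0 z0 t0 t1 t2.
set L := lin q in e1 e2 e3 e4 e5 e6 t0 t1 t2 *.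
have L0 : L != 0 by apply: lin_neq0.
have fz (k : nat) : (k != 0)%N -> (k%:R * f0).@[q 0] != 0.
  by move=> k0; rewrite mevalM rmorph_nat mulf_neq0 // pnatr_eq0.
have [c4 k4 e4'] : exists2 c4, c4 \is n.-1.-1.-1.-homog & b4 = L * c4.
  apply: (@cancel_zero _ q (10%:R * f0) _ (5 * b1 * b3 - 2 * L * b2 ^+ 2) q0 g4).
    exact: fz.
  apply: (mulfI (expf_neq0 2 L0)); apply/eqP; rewrite -subr_eq0 -[X in _ == X]t0.
  by apply/eqP; rewrite -/L; ring.
rewrite e4' in t1 t2 *.
have [c5 k5 e5'] : exists2 c5, c5 \is n.-1.-1.-1.-homog & b5 = L * c5.
  apply: (@cancel_zero _ q (25%:R * f0) _ (L * (5 * b1 * c4 - b2 * b3)) q0 g5).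
    exact: fz.
  apply: (mulfI (expf_neq0 2 L0)); apply/eqP; rewrite -subr_eq0 -[X in _ == X]t1.
  by apply/eqP; rewrite -/L; ring.
rewrite e5' in t1 *.
have [d5 _ e5''] : exists2 d5, d5 \is n.-1.-1.-1.-1.-homog & c5 = L * d5.
  apply: (@cancel_zero _ q (25%:R * f0) _ (5 * b1 * c4 - b2 * b3) q0 k5).
    exact: fz.
  apply: (mulfI (expf_neq0 3 L0)); apply/eqP; rewrite -subr_eq0 -[X in _ == X]t1.
  by apply/eqP; rewrite -/L; ring.
have [c6 k6 e6'] : exists2 c6, c6 \is n.-1.-1.-1.-homog & b6 = L * c6.
  apply: (@cancel_zero _ q (50%:R * f0) _ (L * (2 * b2 * L * c4 - b3 ^+ 2)) q0 g6).
    exact: fz.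
  apply: (mulfI (expf_neq0 2 L0)); apply/eqP; rewrite -subr_eq0 -[X in _ == X]t2.
  by apply/eqP; rewrite -/L; ring.
rewrite e6' in t2 *.
have [d6 _ e6''] : exists2 d6, d6 \is n.-1.-1.-1.-1.-homog & c6 = L * d6.
  apply: (@cancel_zero _ q (50%:R * f0) _ (2 * b2 * L * c4 - b3 ^+ 2) q0 k6).
    exact: fz.
  apply: (mulfI (expf_neq0 3 L0)); apply/eqP; rewrite -subr_eq0 -[X in _ == X]t2.
  by apply/eqP; rewrite -/L; ring.
exists (120 * f0 * d6 - 20 * b1 * d5 * L + 8 * b2 * c4 * L - 3 * b3 ^+ 2).
by rewrite e5'' e6''; ring.
Qed.

(** Coordinates in which the sixth power at p becomes u^6. *)
Lemma coordinate_form p : p != 0 -> exists a b c d : K,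
  a * d - b * c != 0 /\
  forall u v, p 0 0 * (a * u + b * v) + p 0 1 * (c * u + d * v) = u.
Proof.
move=> p0; have [px|px] := eqVneq (p 0 0) 0.
  have py : p 0 1 != 0.
    by apply: contraNneq p0 => py; rewrite (pt_eta p) px py pt_eq0 eqxx.
  exists 0, 1, (p 0 1)^-1, 0; split.
    by rewrite mul0r sub0r mul1r oppr_eq0 invr_eq0.
  by move=> u v; rewrite px; field.
exists (p 0 0)^-1, (- p 0 1 / p 0 0), 0, 1; split.
  by rewrite mulr0 subr0 mulr1 invr_eq0.
by move=> u v; field.
Qed.

Lemma tangent_subst (F : 'rV[{mpoly K[2]}]_7) (M : 'M[K]_7) q :
  tangent_line (F *m map_mx (@mpolyC 2 K) M) q = tangent_line F q *m M.
Proof.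
apply/matrixP => i j; rewrite [LHS]mxE [(F *m _) 0 j]mxE (raddf_sum (mderiv i)).
rewrite (raddf_sum (meval (q 0))) /= mxE.
apply: eq_bigr => k _; rewrite !mxE mulrC mderiv_mulC mevalM mevalC mulrC.
by [].
Qed.

End Tangency.

Section Exceptional.
Variables (K : numClosedFieldType) (w xi e0 e1 : K).
Hypotheses (w3 : w ^+ 2 + w + 1 = 0) (xi4 : xi ^+ 4 = -1).
Hypotheses (e01 : e0 * e1 = 1) (e01s : (e0 + e1) ^+ 2 = -2).

(** Translating the equivariant curve by the frame turns the standard
    dihedral group on the right into a subgroup of the octahedral group. *)
Definition gD ab := hD ab *m map_mx (@mpolyC 2 K) (frame xi e0).

(** The value at (t, 1) of the second row of the base matrix, up to scale. *)
Definition vt t : 'rV[K]_3 :=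
  \row_i nth 0 [:: al t 1 * be t 1 * (e1 + t); ga t 1 ^+ 3 * (e1 - t);
                   al t 1 ^+ 2 * (e1 - t)] i.

Variables (t : K) (ab : 'M[K]_(2, 3)).
Hypotheses (rab : \rank ab = 2%N) (pab : ab *m (vt t)^T = 0).

Lemma vt_neq0 : vt t != 0.
Proof.
apply/eqP => v0; have v i := congr1 (fun M : 'rV_3 => M 0 i) v0.
have := v 0; have := v 1; have := v (inord 2); rewrite /= !mxE inordK //=.
rewrite /al /be /ga !mulr1 !expr1n => /eqP + /eqP + /eqP.
have [te|te] := eqVneq t e1.
  move=> _ _; rewrite te !mulf_eq0 invr_eq0 pnatr_eq0 !orbF.
  have e6 : e1 ^+ 6 != 1 by apply: (@e0_6 _ e1 e0); rewrite 1?mulrC 1?addrC.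
  have e10 : e1 != 0 by apply: (@e0_neq0 _ e1 e0); rewrite mulrC.
  rewrite -mulr2n mulrn_eq0 /= (negPf e10) orbF -mulf_eq0 -subr_sqr expr1n.
  by rewrite -exprM subr_eq0 (negPf e6).
have et : e1 - t != 0 by rewrite subr_eq0 eq_sym.
rewrite !(mulf_eq0 _ (e1 - t)) (negPf et) !orbF !expf_eq0 /=.
rewrite mulf_eq0 invr_eq0 pnatr_eq0 orbF => /eqP h /eqP t0 _; move: h.
by rewrite t0 expr0n sub0r => /eqP; rewrite oppr_eq0 oner_eq0.
Qed.

Lemma gD_eval q : eval_curve (gD ab) q = eval_curve (hD ab) q *m frame xi e0.
Proof. by rewrite eval_curveM eval_curve_const. Qed.

Lemma gD_homog i j : gD ab i j \is 7.-homog.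
Proof. exact/mul_const_homog/hD_homog. Qed.

Lemma gD_det_homog : \det (gD ab) \is 14.-homog.
Proof. by rewrite det22; apply: rpredB; apply: (@dhomogM _ _ _ 7 _ 7); apply: gD_homog. Qed.

(** The cross product of the rows of ab is proportional to vt t, which puts
    the values of the forms at [t, 1] into the coefficients of the
    determinant. Its zeros are the eight branch points and the orbit of [t,
    1]. *)
Lemma gD_det : exists2 k, k != 0 & forall x y, (\det (gD ab)).@[pt x y 0] =
  k * (x * y * (x ^+ 6 - y ^+ 6)) * ((e1 - t)
    * ((x ^+ 3 - t ^+ 3 * y ^+ 3) * (t ^+ 3 * x ^+ 3 - y ^+ 3))).
Proof.
have [k k0 ek] := cross_perp rab vt_neq0 pab.
exists (- k / 8 * \det (frame xi e0)).
  have := frame_unit xi4 e01 e01s; rewrite unit22 => d0.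
  by rewrite !mulf_neq0 ?oppr_eq0 ?invr_eq0 ?pnatr_eq0.
move=> x y; rewrite det_mulmx mevalM hD_det ek !mxE inordK //=.
by rewrite det_map_mx mevalC /al /be /ga; field.
Qed.

(** One linear factor for each vertex of the octahedron. *)
Lemma sx_f1_frame (M : 'M[K]_2) u v : sx (f1 (M *m frame xi e0)) u v =
  frame_lc xi e0 * \prod_j (v * (M 0 0 + eps w e0 e1 j * M 0 1)
                             - u * (M 1 0 + eps w e0 e1 j * M 1 1)).
Proof.
rewrite f1_octv mulmxA {1}(mx22_eta M) pt_mul (octv_frame_prod w3 xi4 e01 e01s).
by congr (_ * _); apply: eq_bigr => j _; ring.
Qed.

(** The equivariance of the curve and the invariance of the sextic compensate
    each other, so the coefficients of f1 (gD ab) are invariant forms of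
    degree 42 = 6 * 7. *)
Lemma f1_gD_phi : exists2 p : 'rV[{mpoly K[2]}]_7, (forall i j, p i j \is 7.-homog) &
  forall q, f1 (eval_curve (gD ab) q) = eval_curve p (eval_curve (phi_D3 K) q).
Proof.
have w13 := cube_root1 w3.
have inv i : exists2 p : {mpoly K[2]}, p \is 7.-homog &
    forall q : 'rV[K]_2, (f1 (gD ab) 0 i).@[q 0] = p.@[eval_curve (phi_D3 K) q 0].
  have hf : f1 (gD ab) 0 i \is (6 * 7).-homog by apply: f1_homog; apply: gD_homog.
  have ev (q : 'rV[K]_2) : (f1 (gD ab) 0 i).@[q 0] = f1 (eval_curve (gD ab) q) 0 i.
    by rewrite -evE eval_f1.
  have tr (q r : 'rV[K]_2) :
      (forall p : 'rV[K]_2, octv (p *m eval_curve (hD ab) q *m frame xi e0)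
        = octv (p *m eval_curve (hD ab) r *m frame xi e0)) ->
      (f1 (gD ab) 0 i).@[q 0] = (f1 (gD ab) 0 i).@[r 0].
    move=> e; rewrite [LHS]ev [RHS]ev; congr (fun_of_matrix _ 0 i).
    apply: sx_inj => u v; rewrite [LHS]f1_octv [RHS]f1_octv.
    by have := e (pt v (- u)); rewrite -!mulmxA -!gD_eval.
  have h1 x y : (f1 (gD ab) 0 i).@[pt (w * x) y 0] = (f1 (gD ab) 0 i).@[pt x y 0].
    apply: tr => p.
    rewrite [in LHS]hD_rot // !mulmxA [p *m _]pt_eta /dg [_ *m mx22 w _ _ _]pt_mul.
    rewrite [LHS](octv_frame xi4 e01 e01s) [RHS](octv_frame xi4 e01 e01s).
    rewrite !mulr0 addr0 add0r mulr1 [_ * w]mulrC !exprMn w13 mul1r.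
    by rewrite -[6%N]/(3 * 2)%N [w ^+ _]exprM w13 expr1n mul1r.
  have h2 x y : (f1 (gD ab) 0 i).@[pt y x 0] = (f1 (gD ab) 0 i).@[pt x y 0].
    apply: tr => p.
    rewrite [in LHS]hD_swap mulmxN !mulmxA mulNmx -scaleN1r [LHS]octvZ.
    rewrite [p *m _]pt_eta /sw [_ *m mx22 0 1 1 0]pt_mul.
    rewrite [in LHS](octv_frame xi4 e01 e01s) [RHS](octv_frame xi4 e01 e01s); ring.
  exact: (@invariant_form K w 7 _ w3 hf h1 h2).
have [p hp e] := @fin_all_exists2 _ (fun _ => {mpoly K[2]})
  (fun i (p : {mpoly K[2]}) => p \is 7.-homog) (fun i p => forall q : 'rV[K]_2,
     (f1 (gD ab) 0 i).@[q 0] = p.@[eval_curve (phi_D3 K) q 0]) inv.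
exists (\row_i p i) => [i j|q]; first by rewrite mxE.
by rewrite -eval_f1; apply/rowP => i; rewrite !evE e mxE.
Qed.

(** Orthogonality to vt t is the vanishing of the second column at [t, 1],
    that is, of the factor for the vertex e1. *)
Lemma f1_gD_t : f1 (eval_curve (gD ab) (pt t 1)) = 0.
Proof.
have c1 i : eval_curve (gD ab) (pt t 1) i 1 = 0.
  rewrite gD_eval (mx22_eta (eval_curve _ _)) /frame mul22.
  have pi l : ab l 0 * (al t 1 * be t 1 * (e1 + t)) + ab l 1 * (ga t 1 ^+ 3 * (e1 - t))
        + ab l (inord 2) * (al t 1 ^+ 2 * (e1 - t)) = 0.
    have := congr1 (fun M : 'M_(2, 1) => M l 0) pab.
    by rewrite /= !mxE sum3 !mxE inordK.
  have E l : (hD ab l 0).@[pt t 1 0] * (e0 * xi) + (hD ab l 1).@[pt t 1 0] * xi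
      = xi * e0 * (ab l 0 * (al t 1 * be t 1 * (e1 + t)) + ab l 1 * (ga t 1 ^+ 3 * (e1 - t))
        + ab l (inord 2) * (al t 1 ^+ 2 * (e1 - t))).
    have [-> ->] := hD_eval ab t 1 l.
    have e1E : e1 = e0^-1.
      by apply: (mulfI (e0_neq0 e01)); rewrite e01 mulfV // (e0_neq0 e01).
    by rewrite e1E; field; exact: e0_neq0 e01.
  by move: i; apply: ord2P; rewrite [LHS]mxE /= !evE E pi mulr0.
apply: sx_inj => u v; rewrite f1_octv (mx22_eta (eval_curve _ _)) !c1 pt_mul.
rewrite /octv pt1 !mulr0 addr0 /Oc mulr0 mul0r /sx.
by rewrite big1 // => i _; rewrite mxE mul0r.
Qed.

Hypotheses (t0 : t != 0) (t6 : t ^+ 6 != 1) (te : t != e1).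

(** Written out in monomials, the determinant can be differentiated term by
    term. *)
Lemma gD_det_mon : exists2 k, k != 0 & \det (gD ab) =
  k *: (t ^+ 3 *: ('X_0 ^+ 13 * 'X_1 ^+ 1) - (1 + t ^+ 6) *: ('X_0 ^+ 10 * 'X_1 ^+ 4)
   + (1 + t ^+ 6) *: ('X_0 ^+ 4 * 'X_1 ^+ 10) - t ^+ 3 *: ('X_0 ^+ 1 * 'X_1 ^+ 13)).
Proof.
have [k k0 ek] := gD_det; exists (k * (e1 - t)).
  by rewrite mulf_neq0 // subr_eq0 eq_sym.
apply: mpoly_eval_inj => q.
rewrite (pt_eta q).
rewrite [LHS]ek.
mev.
rewrite !pt0 !pt1.
ring.
Qed.

Lemma gD_det_neq0 : \det (gD ab) != 0.
Proof.
have [k k0 ek] := gD_det.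
apply/eqP => d0; have [x x0] : exists x : K,
    x * (x ^+ 6 - 1) * ((x ^+ 3 - t ^+ 3) * (t ^+ 3 * x ^+ 3 - 1)) != 0.
  pose p : {poly K} := 'X * ('X ^+ 6 - 1%:P) * (('X ^+ 3 - (t ^+ 3)%:P) * ((t ^+ 3)%:P * 'X ^+ 3 - 1%:P)).
  have [|x px] := @poly_nonroot K p.
    rewrite !mulf_neq0 ?polyX_eq0 //.
    - by rewrite -size_poly_eq0 size_XnsubC.
    - by rewrite -size_poly_eq0 size_XnsubC.
    - apply/eqP => /(congr1 (fun r : {poly K} => r.[0])).
      by rewrite !(hornerE, hornerXn) => /eqP; rewrite ?expr0n /= ?mulr0 sub0r oppr_eq0 oner_eq0.
  by exists x; move: px; rewrite /p !(hornerE, hornerXn).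
have te' : e1 - t != 0 by rewrite subr_eq0 eq_sym.
have := ek x 1; rewrite d0 meval0 => e; move/eqP: x0; apply.
by apply: (mulfI (mulf_neq0 k0 te')); rewrite mulr0 [RHS]e; ring.
Qed.

Lemma mderiv_mon4 (a b : K) (a1 b1 a2 b2 a3 b3 a4 b4 : nat) (q : 'rV[K]_2) (i : 'I_2) :
  ((a *: ('X_0 ^+ a1 * 'X_1 ^+ b1) - b *: ('X_0 ^+ a2 * 'X_1 ^+ b2)
   + b *: ('X_0 ^+ a3 * 'X_1 ^+ b3) - a *: ('X_0 ^+ a4 * 'X_1 ^+ b4)
     : {mpoly K[2]})^`M(i)).@[q 0] =
  if i == 0 then
    a * (a1%:R * (q 0 0 ^+ a1.-1 * q 0 1 ^+ b1)) - b * (a2%:R * (q 0 0 ^+ a2.-1 * q 0 1 ^+ b2))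
    + b * (a3%:R * (q 0 0 ^+ a3.-1 * q 0 1 ^+ b3)) - a * (a4%:R * (q 0 0 ^+ a4.-1 * q 0 1 ^+ b4))
  else
    a * (b1%:R * (q 0 0 ^+ a1 * q 0 1 ^+ b1.-1)) - b * (b2%:R * (q 0 0 ^+ a2 * q 0 1 ^+ b2.-1))
    + b * (b3%:R * (q 0 0 ^+ a3 * q 0 1 ^+ b3.-1)) - a * (b4%:R * (q 0 0 ^+ a4 * q 0 1 ^+ b4.-1)).
Proof.
rewrite mderivB mderivD mderivB !mderivZ mevalB mevalD mevalB !mevalZ !mderiv_mon2.
by case: ifP.
Qed.

(** Simplicity of the zeros is where t^6 = 1 and t = 0 have to be excluded:
    for these parameters the orbit of [t, 1] consists of branch points. *)
Lemma gD_det_simple (q : 'rV[K]_2) : q != 0 -> (\det (gD ab)).@[q 0] = 0 ->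
  exists i, ((\det (gD ab))^`M(i)).@[q 0] != 0.
Proof.
move=> q0 Dq; have [k k0 ek] := gD_det_mon.
have d i : ((\det (gD ab))^`M(i)).@[q 0] = k * (if i == 0
   then 13 * t ^+ 3 * q 0 0 ^+ 12 * q 0 1 - 10 * (1 + t ^+ 6) * q 0 0 ^+ 9 * q 0 1 ^+ 4
     + 4 * (1 + t ^+ 6) * q 0 0 ^+ 3 * q 0 1 ^+ 10 - t ^+ 3 * q 0 1 ^+ 13
   else t ^+ 3 * q 0 0 ^+ 13 - 4 * (1 + t ^+ 6) * q 0 0 ^+ 10 * q 0 1 ^+ 3
     + 10 * (1 + t ^+ 6) * q 0 0 ^+ 4 * q 0 1 ^+ 9 - 13 * t ^+ 3 * q 0 0 * q 0 1 ^+ 12).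
  rewrite ek mderivZ mevalZ; congr (_ * _).
  rewrite [LHS]mderiv_mon4.
  by move: i; apply: ord2P => /=; ring.
suff : exists i : 'I_2, (if i == 0
   then 13 * t ^+ 3 * q 0 0 ^+ 12 * q 0 1 - 10 * (1 + t ^+ 6) * q 0 0 ^+ 9 * q 0 1 ^+ 4
     + 4 * (1 + t ^+ 6) * q 0 0 ^+ 3 * q 0 1 ^+ 10 - t ^+ 3 * q 0 1 ^+ 13
   else t ^+ 3 * q 0 0 ^+ 13 - 4 * (1 + t ^+ 6) * q 0 0 ^+ 10 * q 0 1 ^+ 3
     + 10 * (1 + t ^+ 6) * q 0 0 ^+ 4 * q 0 1 ^+ 9 - 13 * t ^+ 3 * q 0 0 * q 0 1 ^+ 12) != 0.
  by move=> [i hi]; exists i; rewrite d mulf_neq0.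
have [k' k'0 ek'] := gD_det; move: Dq q0; rewrite (pt_eta q) ek' pt_eq0 !pt0 !pt1.
move: (q 0 0) (q 0 1) => x y Dq xy0.
have t30 : t ^+ 3 != 0 by rewrite expf_neq0.
have [x0|x0] := eqVneq x 0.
  have y0 : y != 0 by move: xy0; rewrite x0 eqxx.
  exists 0 => /=; rewrite x0 !expr0n /= !mulr0 !mul0r subr0 add0r sub0r oppr_eq0.
  by rewrite mulf_neq0 ?expf_neq0.
have [y0|y0] := eqVneq y 0.
  exists 1 => /=; rewrite y0 !expr0n /= !mulr0 !subr0 addr0.
  by rewrite mulf_neq0 ?expf_neq0.
exists 0 => /=.
have x30 : x ^+ 3 != 0 by rewrite expf_neq0.
have y30 : y ^+ 3 != 0 by rewrite expf_neq0.
have e61 : t ^+ 6 - 1 = (t ^+ 3 - 1) * (t ^+ 3 + 1) by ring.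
have t61 : (t ^+ 3 - 1) * (t ^+ 3 + 1) != 0 by rewrite -e61 subr_eq0.
move: (t61); rewrite mulf_eq0 negb_or => /andP[t3m t3p].
have n3 : (3 : K) != 0 by rewrite pnatr_eq0.
have n6 : (6 : K) != 0 by rewrite pnatr_eq0.
set E := (_ - _ : K).
suff : x * E != 0 by apply: contraNneq => ->; rewrite mulr0.
have te' : e1 - t != 0 by rewrite subr_eq0 eq_sym.
have : (x ^+ 6 - y ^+ 6) * ((x ^+ 3 - t ^+ 3 * y ^+ 3) * (t ^+ 3 * x ^+ 3 - y ^+ 3)) = 0.
  apply: (mulfI (mulf_neq0 (mulf_neq0 k'0 te') (mulf_neq0 x0 y0))).
  by rewrite mulr0 -[RHS]Dq; ring.
move=> /eqP; rewrite mulf_eq0 (mulf_eq0 (x ^+ 3 - _)) => /or3P[] /eqP h.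
- have : (x ^+ 3 - y ^+ 3) * (x ^+ 3 + y ^+ 3) = 0 by rewrite -[RHS]h; ring.
  move=> /eqP; rewrite mulf_eq0 subr_eq0 addr_eq0 => /orP[] /eqP e.
  + have -> : x * E = - (6 * (t ^+ 3 - 1) ^+ 2 * x * y * (y ^+ 3) ^+ 4).
      by rewrite /E; ring: e.
    by rewrite oppr_eq0 !mulf_neq0 ?expf_neq0.
  + have -> : x * E = 6 * (t ^+ 3 + 1) ^+ 2 * x * y * (y ^+ 3) ^+ 4.
      by rewrite /E; ring: e.
    by rewrite !mulf_neq0 ?expf_neq0.
- have e : x ^+ 3 = t ^+ 3 * y ^+ 3 by apply/eqP; rewrite -subr_eq0 h.
  have -> : x * E = 3 * t ^+ 3 * ((t ^+ 3 - 1) * (t ^+ 3 + 1)) ^+ 2 * x * y * (y ^+ 3) ^+ 4.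
    by rewrite /E; ring: e.
  by rewrite !mulf_neq0 ?expf_neq0 ?t61.
- have e : y ^+ 3 = t ^+ 3 * x ^+ 3 by apply/esym/eqP; rewrite -subr_eq0 h.
  have -> : x * E = 3 * t ^+ 3 * ((t ^+ 3 - 1) * (t ^+ 3 + 1)) ^+ 2 * x * y * (x ^+ 3) ^+ 4.
    by rewrite /E; ring: e.
  by rewrite !mulf_neq0 ?expf_neq0 ?t61.
Qed.

Lemma mderiv_sq_cube (a b : K) (f h : {mpoly K[2]}) (q : 'rV[K]_2) i :
  ((a *: (f ^+ 2) + b *: (h ^+ 3))^`M(i)).@[q 0] =
    2 * a * f.@[q 0] * (f^`M(i)).@[q 0] + 3 * b * h.@[q 0] ^+ 2 * (h^`M(i)).@[q 0].
Proof.
rewrite mderivD !mderivZ mevalD !mevalZ !exprS !expr0 !mulr1.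
by rewrite !mderivM !(mevalD, mevalM); ring.
Qed.

(** The covering is ramified at the branch points, so the linear form that
    vanishes at the image pulls back to a form with a double zero. *)
Lemma covering_branch_sq (nu : 'M[K]_2) (phi : 'rV[{mpoly K[2]}]_2) q0 q k :
  (forall r, eval_curve phi r = eval_curve (phi_D3 K) r *m nu^T) ->
  (forall i j, phi i j \is 6.-homog) -> nocz phi -> nu \in unitmx ->
  q != 0 -> k != 0 -> eval_curve phi q = k *: q0 ->
  q 0 0 * q 0 1 * (q 0 0 ^+ 6 - q 0 1 ^+ 6) = 0 ->
  exists h, q0 0 1 *: phi 0 0 - q0 0 0 *: phi 0 1 = lin q ^+ 2 * h.
Proof.
move=> ephi hphi nphi unu qn0 k0 eq0 br.
set psi := _ - _.
have hpsi : psi \is 6.-homog by rewrite rpredB // rpredZ.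
have psiq : psi.@[q 0] = 0.
  rewrite mevalB !mevalZ -!evE eq0 !mxE; ring.
have [a [b eab]] : exists a b, psi = a *: (alpha3 K ^+ 2) + b *: (gamma K ^+ 3).
  exists (- (q0 0 1 * nu 0 0 - q0 0 0 * nu 1 0)), (q0 0 1 * nu 0 1 - q0 0 0 * nu 1 1).
  apply: mpoly_eval_inj => r.
  rewrite /psi; mev; rewrite -!evE ephi !mxE !sum2 !mxE /=; mev.
  ring.
have dpsi i : (psi^`M(i)).@[q 0] =
    2 * a * (alpha3 K).@[q 0] * ((alpha3 K)^`M(i)).@[q 0]
    + 3 * b * (gamma K).@[q 0] ^+ 2 * ((gamma K)^`M(i)).@[q 0].
  by rewrite eab mderiv_sq_cube.
have alE := alpha3_eval (q 0 0) (q 0 1); have gaE := gamma_eval (q 0 0) (q 0 1).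
rewrite -pt_eta in alE gaE.
have psiv : a * al (q 0 0) (q 0 1) ^+ 2 + b * ga (q 0 0) (q 0 1) ^+ 3 = 0.
  by rewrite -psiq eab mevalD !mevalZ !mevalXn alE gaE.
suff dz i : (psi^`M(i)).@[q 0] = 0.
  by have [h _ eh] := form_sq_factor qn0 hpsi psiq dz; exists h.
have nz : al (q 0 0) (q 0 1) = 0 -> ga (q 0 0) (q 0 1) = 0 -> False.
  move=> a0 g0; have := @phi_D3_nocz K q qn0; rewrite {1}(pt_eta q) phi_D3_eval.
  by rewrite a0 g0 !expr0n /= oppr0 pt_eq0 eqxx.
move: br => /eqP; rewrite mulf_eq0 => /orP[/eqP g0|/eqP br].
  have a2 : a = 0.
    move: psiv; rewrite /ga g0 expr0n mulr0 addr0 => /eqP; rewrite mulf_eq0 expf_eq0 /=.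
    by case/orP => /eqP // /nz; rewrite /ga g0 => /(_ erefl).
  by rewrite dpsi gaE /ga g0 a2; ring.
have : al (q 0 0) (q 0 1) * be (q 0 0) (q 0 1) = 0.
  transitivity ((q 0 0 ^+ 6 - q 0 1 ^+ 6) / 4); last by rewrite br mul0r.
  by rewrite /al /be; field.
move=> /eqP; rewrite mulf_eq0 => /orP[] /eqP ab0.
  have b0 : b = 0.
    move: psiv; rewrite ab0 expr0n mulr0 add0r => /eqP; rewrite mulf_eq0 expf_eq0 /=.
    by case/orP => /eqP // /(nz ab0).
  by rewrite dpsi alE ab0 b0; ring.
have eb : b = a.
  have ga0 : ga (q 0 0) (q 0 1) != 0.
    apply/eqP => g0; apply: nz => //.
    suff /eqP : al (q 0 0) (q 0 1) ^+ 2 = 0 by rewrite expf_eq0 => /eqP.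
    transitivity (be (q 0 0) (q 0 1) ^+ 2 - ga (q 0 0) (q 0 1) ^+ 3).
      by rewrite /al /be /ga; field.
    by rewrite ab0 g0; ring.
  apply/eqP; rewrite -subr_eq0; apply/eqP/(mulIf (expf_neq0 3 ga0)).
  rewrite mul0r -[RHS]psiv.
  have -> : al (q 0 0) (q 0 1) ^+ 2 = be (q 0 0) (q 0 1) ^+ 2 - ga (q 0 0) (q 0 1) ^+ 3.
    by rewrite /al /be /ga; field.
  by rewrite ab0; ring.
have psiB : psi = a *: (beta3 K ^+ 2).
  rewrite eab eb; apply: mpoly_eval_inj => r; rewrite (pt_eta r).
  rewrite mevalD !mevalZ 3!mevalXn alpha3_eval beta3_eval gamma_eval.
  by rewrite /al /be /ga; field.
rewrite psiB mderivZ mevalZ expr2 mderivM mevalD !mevalM.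
have -> : (beta3 K).@[q 0] = 0 by rewrite (pt_eta q) beta3_eval.
by ring.
Qed.

(** A product of linear forms in u and v vanishes only with one of its
    factors. *)
Lemma f1_frame_zero (M : 'M[K]_2) : f1 (M *m frame xi e0) = 0 ->
  exists j, forall i, M i 0 + eps w e0 e1 j * M i 1 = 0.
Proof.
move=> f0.
case: (pickP (fun j => (M 0 0 + eps w e0 e1 j * M 0 1 == 0)
                    && (M 1 0 + eps w e0 e1 j * M 1 1 == 0))).
  by move=> j /andP[/eqP a /eqP b]; exists j; apply: ord2P.
move=> nz; have [l|x] := @prod_lin_neq0 K 'I_6
  (fun j => M 0 0 + eps w e0 e1 j * M 0 1) (fun j => M 1 0 + eps w e0 e1 j * M 1 1).
  by have /negbT := nz l; rewrite negb_and.
move=> /negP[]; have := sx_f1_frame M x 1.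
rewrite f0 /sx big1 => [|l _]; last by rewrite mxE mul0r.
move=> /esym/eqP; rewrite mulf_eq0 (negPf (frame_lc_neq0 xi4 e01)) /=.
by move=> /eqP e; apply/eqP; rewrite -[RHS]e; apply: eq_bigr => l _; ring.
Qed.

(** Where the sextic f1 (gD ab) vanishes identically, exactly one of its six
    linear factors does, because the determinant has simple zeros; removing
    the common zero leaves a sextic with one root of multiplicity five. *)
Lemma vertex_factor N h (Z : 'rV[{mpoly K[2]}]_7) (q : 'rV[K]_2) :
  q != 0 -> (\det (gD ab)).@[q 0] = 0 -> h \is N.-homog -> h.@[q 0] = 0 ->
  (forall r, f1 (eval_curve (gD ab) r) = h.@[r 0] *: eval_curve Z r) ->
  exists C a0 a1 c0 c1 d : K, [/\ C != 0, a0 * c1 - a1 * c0 != 0 &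
    forall u v, C * ((v * a0 - u * a1) * (v * c0 - u * c1) ^+ 5)
      = d * sx (eval_curve Z q) u v].
Proof.
move=> qn0 Dq hh hq eF; have [i di] := gD_det_simple qn0 Dq.
have f10 : f1 (eval_curve (gD ab) q) = 0 by rewrite eF hq scale0r.
pose G j i := hD ab i 0 + eps w e0 e1 j *: hD ab i 1.
have GE j l : (G j l).@[q 0] = eval_curve (hD ab) q l 0
    + eps w e0 e1 j * eval_curve (hD ab) q l 1.
  by rewrite !evE mevalD mevalZ.
have hG j l : G j l \is 7.-homog by apply: rpredD; [|apply: rpredZ]; apply: hD_homog.
have [j Gj] : exists j, forall i, (G j i).@[q 0] = 0.
  have [|j vj] := @f1_frame_zero (eval_curve (hD ab) q); first by rewrite -gD_eval.
  by exists j => l; rewrite GE.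
have [g0 _ eg0] := form_factor_pred qn0 (hG j 0) (Gj 0).
have [g1 _ eg1] := form_factor_pred qn0 (hG j 1) (Gj 1).
have [h' _ eh'] := form_factor_pred qn0 hh hq.
pose c0 : K := (hD ab 0 1).@[q 0]; pose c1 : K := (hD ab 1 1).@[q 0].
pose a0 : K := g0.@[q 0]; pose a1 : K := g1.@[q 0].
have ac : a0 * c1 - a1 * c0 != 0.
  have eD : \det (gD ab) = lin q * ((g0 * hD ab 1 1 - hD ab 0 1 * g1)
                           * (\det (frame xi e0))%:MP).
    rewrite det_mulmx det_map_mx mulrA; congr (_ * _).
    rewrite mulrBr mulrA -eg0 mulrCA -eg1 /G det22 -!mul_mpolyC; ring.
  apply: contraNneq di => acz; rewrite eD mderiv_lin_mul lin_self mul0r addr0.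
  by mev; rewrite -/c0 -/c1 -/a0 -/a1 [c0 * a1]mulrC acz mul0r mulr0.
have col l : (G l 0).@[q 0] = (eps w e0 e1 l - eps w e0 e1 j) * c0
   /\ (G l 1).@[q 0] = (eps w e0 e1 l - eps w e0 e1 j) * c1.
  have := Gj 0; have := Gj 1; rewrite !GE !evE -/c0 -/c1 => z1 z0.
  split.
    transitivity ((hD ab 0 0).@[q 0] + eps w e0 e1 l * c0
        - ((hD ab 0 0).@[q 0] + eps w e0 e1 j * c0)); last by ring.
    by rewrite z0 subr0.
  transitivity ((hD ab 1 0).@[q 0] + eps w e0 e1 l * c1
        - ((hD ab 1 0).@[q 0] + eps w e0 e1 j * c1)); last by ring.
  by rewrite z1 subr0.
pose B u v : {mpoly K[2]} := \sum_(i < 7) (u ^+ (6 - i) * v ^+ i) *: Z 0 i.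
have BE u v (r : 'rV[K]_2) : (B u v).@[r 0] = sx (eval_curve Z r) u v.
  by rewrite raddf_sum; apply: eq_bigr => l _ /=; rewrite mevalZ evE mulrC.
have prodE u v : frame_lc xi e0 *: ((v *: g0 - u *: g1)
     * \prod_(l | l != j) (v *: G l 0 - u *: G l 1)) = h' * B u v.
  apply: (mulfI (lin_neq0 qn0)); rewrite mulrA -eh' -scalerAr mulrA.
  have -> : lin q * (v *: g0 - u *: g1) = v *: G j 0 - u *: G j 1.
    by rewrite eg0 eg1 mulrBr !scalerAr.
  have -> : (v *: G j 0 - u *: G j 1) * \prod_(l | l != j) (v *: G l 0 - u *: G l 1)
     = \prod_l (v *: G l 0 - u *: G l 1) by rewrite [RHS](bigD1 j).
  apply: mpoly_eval_inj => r; rewrite mevalZ mevalM BE -sxZ -eF gD_eval sx_f1_frame.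
  congr (_ * _); rewrite rmorph_prod; apply: eq_bigr => l _ /=.
  by rewrite !evE /G; mev; ring.
pose C : K := frame_lc xi e0 * \prod_(l | l != j) (eps w e0 e1 l - eps w e0 e1 j).
have C0 : C != 0.
  rewrite mulf_neq0 ?(frame_lc_neq0 xi4 e01) //; apply/prodf_neq0 => l lj.
  by rewrite subr_eq0 (inj_eq (eps_inj w3 e01 e01s)).
exists C, a0, a1, c0, c1, h'.@[q 0]; split=> // u v.
rewrite -BE -mevalM -prodE mevalZ mevalM mevalB !mevalZ -/a0 -/a1 rmorph_prod /=.
rewrite (eq_bigr (fun l => (eps w e0 e1 l - eps w e0 e1 j) * (v * c0 - u * c1))).
  by rewrite big_split /= prodr_const cardC1 card_ord /C; ring.
by move=> l lj; rewrite mevalB !mevalZ; have [-> ->] := col l; ring.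
Qed.

(** At a branch point tangency would give the pullback of the invariant
    quadric a zero of order eight, but by the invariance of the quadric it is
    the sixth power of a form with simple zeros. At the remaining zeros of the
    determinant exactly one of the six linear factors of the sextic differs
    from the others, so that the sextic is not a sixth power. *)
Lemma not_ramified (nu : 'M[K]_2) (phi : 'rV[{mpoly K[2]}]_2)
    (F : 'rV[{mpoly K[2]}]_7) n h :
  nu \in unitmx ->
  (forall r, eval_curve phi r = eval_curve (phi_D3 K) r *m nu^T) ->
  (forall i j, phi i j \is 6.-homog) -> nocz phi ->
  (forall i j, F i j \is n.-homog) -> nocz F ->
  h \is 6.-homog ->
  (forall q, f1 (eval_curve (gD ab) q)
     = h.@[q 0] *: eval_curve F (eval_curve phi q)) ->
  ~ generally_ramified F.
Proof.
move=> unu ephi hphi nphi hF nF hh eF [q0 [p0 [[q0n p0n] _ [kp kp0 Fp] tang]]].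
have [q [k [qn0 k0 eq0]]] := curve_onto hphi nphi q0n.
have FqE : eval_curve F (eval_curve phi q) =
    (k ^+ n * kp) *: eval_curve (sixth_powers K) p0.
  by rewrite eq0 (eval_curve_scale _ _ hF) Fp scalerA.
have Q6 : Qinv (eval_curve (sixth_powers K) p0) = 0.
  by rewrite -Qinv_eval sixth_powersE /Qinv !zc_row7 //=; mev; ring.
have h0 : h != 0.
  apply: contraNneq gD_det_neq0 => h0; apply/eqP/mpoly_eval0 => r.
  by rewrite eval_curve_det Qinv_f1_eq0 // eF h0 meval0 QinvZ expr0n mul0r.
have Dq : (\det (gD ab)).@[q 0] = 0.
  by rewrite eval_curve_det Qinv_f1_eq0 // eF FqE scalerA QinvZ Q6 mulr0.
have [i di] := gD_det_simple qn0 Dq.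
have [E _ eE] := form_factor_pred qn0 gD_det_homog Dq.
have Eq0 : E.@[q 0] != 0.
  apply: contraNneq di => Eq; rewrite eE mderiv_lin_mul Eq lin_self.
  by rewrite mulr0 mul0r addr0.
have [br|nbr] := eqVneq (q 0 0 * q 0 1 * (q 0 0 ^+ 6 - q 0 1 ^+ 6)) 0.
  have [b eb] := covering_branch_sq ephi hphi nphi unu qn0 k0 eq0 br.
  have [a1 [b1 [c1 [d1 [dA ep0]]]]] := coordinate_form p0n.
  have [M eM] := sx_subst a1 b1 c1 d1.
  pose A := mx22 d1 (- b1) (- c1) a1.
  pose F' := F *m map_mx (@mpolyC 2 K) M.
  have F'E r : eval_curve F' r = eval_curve F r *m M.
    by rewrite eval_curveM eval_curve_const.
  have fF' r : f1 (A *m eval_curve (gD ab) r) =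
      h.@[r 0] *: eval_curve F' (eval_curve phi r).
    by rewrite -(f1_subst _ eM) eF F'E scalemxAl.
  have hF' j : zc F' j \is n.-homog by apply: mul_const_homog.
  have onto (T : {mpoly K[2]}) N : T \is N.-homog ->
      (forall r : 'rV[K]_2, h.@[r 0] ^+ 2 * T.@[eval_curve phi r 0] = 0) -> T = 0.
    move=> hT zT; pose P := T \mPo (mktuple (phi 0)).
    have PE (r : 'rV[K]_2) : P.@[r 0] = T.@[eval_curve phi r 0].
      rewrite comp_mpoly_meval; apply: meval_eq => l.
      by rewrite tnth_mktuple mxE.
    have P0 : P = 0.
      apply: (mulfI (expf_neq0 2 h0)); rewrite mulr0.
      by apply: mpoly_eval0 => r; rewrite mevalM mevalXn PE.
    apply: (form_eval0 hT) => z; have [->|z0] := eqVneq z 0.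
      case: N hT => [|N] hT; last by rewrite -[0](scale0r q) (form_scale _ _ hT) expr0n mul0r.
      have [c ec] := form_const hT; have := PE 0; rewrite P0 meval0 ec !mevalC.
      by [].
    have [r [l [r0 l0 er]]] := curve_onto hphi nphi z0.
    have := PE r; rewrite P0 meval0 er (form_scale _ _ hT) => /esym/eqP.
    by rewrite mulf_eq0 expf_eq0 (negPf l0) andbF => /eqP.
  have zz i' j' (m : nat) : (m%:R * zc F' i' * zc F' j') \is (n + n).-homog.
    rewrite -mulrA -[m%:R * _]/(m%:R * _) mulr_natl rpredMn // dhomogM //.
  have zz1 i' j' : (zc F' i' * zc F' j') \is (n + n).-homog by rewrite dhomogM.
  have t0z : trv0 F' = 0.
    apply: (onto _ (n + n)%N) => [|r].
      by rewrite /trv0 expr2 mulrA; repeat first [exact: zz | exact: zz1 | apply: rpredB | apply: rpredD].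
    by rewrite trv0_eval -trv0Z -fF' trv0_f1.
  have t1z : trv1 F' = 0.
    apply: (onto _ (n + n)%N) => [|r].
      by rewrite /trv1; repeat first [exact: zz | exact: zz1 | apply: rpredB | apply: rpredD].
    by rewrite trv1_eval -trv1Z -fF' trv1_f1.
  have t2z : trv2 F' = 0.
    apply: (onto _ (n + n)%N) => [|r].
      by rewrite /trv2 expr2 ?mulrA; repeat first [exact: zz | exact: zz1 | apply: rpredB | apply: rpredD].
    by rewrite trv2_eval -trv2Z -fF' trv2_f1.
  have F'q : eval_curve F' q0 = kp *: row7 1 0 0 0 0 0 0.
    apply: sx_inj => u v; rewrite F'E Fp -scalemxAl !sxZ eM sixth_powers_sx ep0.
    by rewrite sx_row7; ring.
  have [E4 eE4] : exists E4, Qinv F' = lin q0 ^+ 4 * E4.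
    apply: (Qinv_order4 q0n hF' t0z t1z t2z).
    - rewrite /zc -evE F'q mxE -/(zc _ 0) zc_row7 //= mulr1 //.
    - move=> j /andP[j0 j7]; rewrite /zc -evE F'q mxE -/(zc _ j) zc_row7 //.
      by move: j j0 j7 => [|[|[|[|[|[|[|]]]]]]] //= _ _; rewrite mulr0.
    move=> l j /andP[j1 j7].
    have -> : ((zc F' j)^`M(l)).@[q0 0] = tangent_line F' q0 l (inord j) by rewrite mxE.
    rewrite tangent_subst.
    have /submxP[W eW] : (tangent_line F q0 <= tangent_line (sixth_powers K) p0)%MS.
      by case/andP: tang.
    rewrite eW -mulmxA mxE big1 // => s _.
    have -> : (tangent_line (sixth_powers K) p0 *m M) s (inord j) =
        zc (row s (tangent_line (sixth_powers K) p0) *m M) j.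
      by rewrite -row_mul /zc [RHS]mxE.
    have rs u v : sx (row s (tangent_line (sixth_powers K) p0) *m M) u v =
       sx (if s == 0 then row7 (6 * a1) (6 * b1) 0 0 0 0 0
           else row7 (6 * c1) (6 * d1) 0 0 0 0 0) u v.
      rewrite eM tangent_sixth_sx ep0; case: ifP => _; rewrite sx_row7; ring.
    have -> := sx_inj rs; case: ifP => _; rewrite zc_row7 //;
    by move: j j1 j7 => [|[|[|[|[|[|[|]]]]]]] //= _ _; rewrite mulr0.
  (* The left-hand side is h^2 times Qinv F' pulled back to the source, of
     order eight at q, with the zero of order six of det^6 cancelled; on the
     right E does not vanish at q. *)
  have key : lin q ^+ 2 * (b ^+ 4 * (E4 \mPo (mktuple (phi 0))) * h ^+ 2)
     = (20 * (\det A) ^+ 6) *: E ^+ 6.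
    apply: (mulfI (expf_neq0 6 (lin_neq0 qn0))).
    transitivity ((lin q ^+ 2 * b) ^+ 4 * (E4 \mPo (mktuple (phi 0))) * h ^+ 2).
      by ring.
    rewrite -eb -scalerAr -exprMn -eE; apply: mpoly_eval_inj => r.
    rewrite !(mevalM, mevalXn, mevalZ) eval_curve_det.
    transitivity (Qinv (f1 (A *m eval_curve (gD ab) r))); last first.
      by rewrite Qinv_f1 det_mulmx; ring.
    rewrite fF' QinvZ mulrC; congr (_ * _).
    have -> : Qinv (eval_curve F' (eval_curve phi r)) = (Qinv F').@[eval_curve phi r 0].
      by rewrite Qinv_eval.
    rewrite eE4 mevalM mevalXn lin_eval !evE; congr (_ * _).
      by rewrite mevalB !mevalZ.
    rewrite comp_mpoly_meval; apply: meval_eq => l.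
    by rewrite tnth_mktuple mxE.
  have := congr1 (meval (q 0)) key; rewrite /= mevalM mevalXn lin_self expr0n mul0r.
  move=> /esym/eqP; rewrite mevalZ mevalXn mulf_eq0 expf_eq0 (negPf Eq0) /= orbF.
  rewrite mulf_eq0 pnatr_eq0 expf_eq0 /= det_22.
  have -> : d1 * a1 - - b1 * - c1 = a1 * d1 - b1 * c1 by ring.
  by rewrite (negPf dA).
have H0 : (q 0 0 ^+ 3 - t ^+ 3 * q 0 1 ^+ 3) * (t ^+ 3 * q 0 0 ^+ 3 - q 0 1 ^+ 3) = 0.
  have [k' k'0 ek'] := gD_det; have := ek' (q 0 0) (q 0 1); rewrite -pt_eta Dq.
  move=> /esym/eqP; rewrite mulf_eq0 (mulf_eq0 k') (negPf k'0) (negPf nbr) /=.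
  by rewrite mulf_eq0 subr_eq0 eq_sym (negPf te) /= => /eqP.
have f10 : f1 (eval_curve (gD ab) q) = 0.
  have [p hp ep] := f1_gD_phi; rewrite ep.
  have tn : eval_curve (phi_D3 K) (pt t 1) != 0.
    by apply: phi_D3_nocz; rewrite pt_eq0 oner_eq0 andbF.
  have [l el] : exists l, eval_curve (phi_D3 K) q = l *: eval_curve (phi_D3 K) (pt t 1).
    apply: lin_eval_eq0 => //; rewrite lin_eval (pt_eta q) !phi_D3_eval !pt0 !pt1.
    transitivity (- ((q 0 0 ^+ 3 - t ^+ 3 * q 0 1 ^+ 3)
        * (t ^+ 3 * q 0 0 ^+ 3 - q 0 1 ^+ 3)) / 4); last by rewrite H0 oppr0 mul0r.
    by rewrite /al /ga; field.
  by rewrite el (eval_curve_scale _ _ hp) -ep f1_gD_t scaler0.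
have hq : h.@[q 0] = 0.
  have := eF q; rewrite f10 => /esym/eqP; rewrite scaler_eq0 => /orP[/eqP //|].
  by rewrite (negPf (nF _ (nphi _ qn0))).
pose Z := precomp F phi.
have ZE r : eval_curve Z r = eval_curve F (eval_curve phi r) by rewrite eval_precomp.
have [|C [a0 [a1 [c0 [c1 [d [C0 ac valE0]]]]]]] := vertex_factor qn0 Dq hh hq (Z := Z).
  by move=> r; rewrite ZE.
have valE u v : C * ((v * a0 - u * a1) * (v * c0 - u * c1) ^+ 5) =
    d * (k ^+ n * kp) * (p0 0 0 * u + p0 0 1 * v) ^+ 6.
  by rewrite valE0 ZE FqE sxZ sixth_powers_sx mulrA.
set C' := d * (k ^+ n * kp) in valE.
have C'0 : C' != 0.
  apply/eqP => z; have := valE (a0 + c0) (a1 + c1); rewrite z mul0r => /eqP.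
  rewrite mulf_eq0 (negPf C0) /=.
  have -> : (a1 + c1) * a0 - (a0 + c0) * a1 = a0 * c1 - a1 * c0 by ring.
  have -> : (a1 + c1) * c0 - (a0 + c0) * c1 = - (a0 * c1 - a1 * c0) by ring.
  by rewrite mulf_eq0 expf_eq0 oppr_eq0 (negPf ac).
have root u v : (v * a0 - u * a1) * (v * c0 - u * c1) ^+ 5 = 0 ->
    p0 0 0 * u + p0 0 1 * v = 0.
  move=> z; have := valE u v; rewrite z mulr0 => /esym/eqP.
  by rewrite mulf_eq0 (negPf C'0) /= expf_eq0 => /eqP.
have ra : p0 0 0 * a0 + p0 0 1 * a1 = 0 by apply: root; ring.
have rc : p0 0 0 * c0 + p0 0 1 * c1 = 0 by apply: root; ring.
have px : p0 0 0 = 0.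
  apply: (mulIf ac); rewrite mul0r.
  transitivity ((p0 0 0 * a0 + p0 0 1 * a1) * c1 - (p0 0 0 * c0 + p0 0 1 * c1) * a1).
    by ring.
  by rewrite ra rc !mul0r subrr.
have py : p0 0 1 = 0.
  apply: (mulIf ac); rewrite mul0r.
  transitivity ((p0 0 0 * c0 + p0 0 1 * c1) * a0 - (p0 0 0 * a0 + p0 0 1 * a1) * c0).
    by ring.
  by rewrite ra rc !mul0r subrr.
by move: p0n; rewrite (pt_eta p0) px py pt_eq0 eqxx.
Qed.

End Exceptional.

(** * The dihedral deck group *)

(** The relation that y inverts x is written without inverses, as x y x = y,
    to survive the passage to matrices up to scale. *)
Lemma dihedral6_gen : exists x y : 'D_6,
  [/\ x != 1, x * x * x = 1 & x * y * x = y]%g.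
Proof.
have G6 : [set: 'D_6]%g \isog [set: 'D_6]%g by apply: isog_refl.
have card : #|[set: 'D_6]%g| = 6%N by rewrite (@card_dihedral 3 isT).
have := @Grp_dihedral 3 isT.
move/(_ _ [set: 'D_6]%G); rewrite homg_refl => /esym/existsP[[x y]] /=.
rewrite !xpair_eqE => /and4P[/eqP gen /eqP x3 /eqP y2 /eqP xy].
exists x, y; split.
- apply/eqP => x1; move: card; rewrite -gen x1 cycle1 joing1G -orderE => oy.
  by have := order_dvdn y 2; rewrite y2 eqxx oy.
- by rewrite -x3 !expgS expg0 mulg1 mulgA.
by rewrite (conjgC x y) xy -mulgA mulVg mulg1.
Qed.

Section Deck.
Variable K : numClosedFieldType.

(** In PGL_2, S has order three and T inverts it; then T is an involution. *)
Definition D3_pair (S T : 'M[K]_2) :=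
  [/\ S \in unitmx, T \in unitmx, ~ (exists k, S = k%:M),
      proj_eq (S *m S *m S) 1%:M & proj_eq (S *m T *m S) T].

Lemma proj_eq_cancel (A B : 'M[K]_2) : A \in unitmx ->
  proj_eq A (A *m B) -> proj_eq B 1%:M.
Proof.
move=> uA [c c0 e]; exists c^-1; first by rewrite invr_eq0.
have : A *m (1%:M - c *: B) = 0 by rewrite mulmxBr mulmx1 -scalemxAr -e subrr.
move=> /(congr1 (mulmx (invmx A))); rewrite mulKmx // mulmx0 => /eqP.
by rewrite subr_eq0 => /eqP ->; rewrite scalerA mulVf // scale1r.
Qed.

Lemma deck_dihedral_pair (phi : 'rV[{mpoly K[2]}]_2) : deck_group_isog 'D_6 phi ->
  exists S T, [/\ deck phi S, deck phi T & D3_pair S T].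
Proof.
move=> [rho [dk inj _] mor]; have [x [y [x1 x3 xyx]]] := dihedral6_gen.
have ur a : rho a \in unitmx by case: (dk a).
have r1 : proj_eq (rho 1%g) 1%:M.
  by apply: (proj_eq_cancel (ur 1%g)); have := mor 1%g 1%g; rewrite mulg1.
have m3 a b c : proj_eq (rho a *m rho b *m rho c) (rho (a * b * c)%g).
  apply: proj_eq_sym; apply: proj_eq_trans (mor _ _) _.
  by apply: proj_eq_mul (mor _ _) (proj_eq_refl _).
exists (rho x), (rho y); split => //; split => //.
- move=> [k ek]; move/eqP: x1; apply; apply: inj.
  apply: proj_eq_trans (proj_eq_sym r1); exists k; last by rewrite scalemx1.
  by apply: contraTneq (ur x) => k0; rewrite ek k0 unitmxE det_scalar expr0n unitr0.
- by apply: proj_eq_trans (m3 _ _ _) _; rewrite x3.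
- by have := m3 x y x; rewrite xyx.
Qed.

Lemma deck_eval n (phi : 'rV[{mpoly K[2]}]_2) s : holcurve n phi -> deck phi s ->
  exists2 c, c != 0 & forall q, eval_curve phi (q *m s^T) = c *: eval_curve phi q.
Proof.
move=> hc [us rm]; have [hphi _] := hc.
have [c c0 ec] := ratmap_homog_eq (precomp_mobius_homog s hphi) hphi (nocf_nocz hc) rm.
by exists c => // q; rewrite -eval_precomp_mobius ec eval_curveZ mevalC.
Qed.

(** Coordinates in which S and T become the standard generators. *)
Definition adapted w (Q S T : 'M[K]_2) := [/\ Q \in unitmx,
  exists2 k, k != 0 & Q *m S = k *: dg w *m Q
  & exists2 k, k != 0 & Q *m T = k *: sw K *m Q].

Lemma adaptedP w (Q S T : 'M[K]_2) : adapted w Q S T ->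
  (exists2 k, k != 0 & forall x y, pt (w * x) y *m Q = k *: (pt x y *m Q *m S)) /\
  (exists2 k, k != 0 & forall x y, pt y x *m Q = k *: (pt x y *m Q *m T)).
Proof.
move=> [uQ [k k0 ek] [l l0 el]]; split; [exists k^-1|exists l^-1];
  rewrite ?invr_eq0 // => x y.
- rewrite -mulmxA ek -scalemxAl -scalemxAr scalerA mulVf // scale1r mulmxA /dg pt_mul.
  by congr (pt _ _ *m _); ring.
rewrite -mulmxA el -scalemxAl -scalemxAr scalerA mulVf // scale1r mulmxA /sw pt_mul.
by congr (pt _ _ *m _); ring.
Qed.

(** The change of sign of the second coordinate commutes with the rotation,
    and with the swap up to sign. It is the freedom left in the choice of
    coordinates, and exchanges the two square roots of -2 in [octa_D3_form]. *)
Lemma adapted_flip w (Q S T : 'M[K]_2) : adapted w Q S T ->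
  adapted w (mx22 1 0 0 (-1) *m Q) S T.
Proof.
move=> [uQ [k k0 ek] [l l0 el]]; split.
- by rewrite unitmx_mul uQ andbT unit22 det_22 mul1r mulr0 subr0 oppr_eq0 oner_eq0.
- exists k => //; rewrite -mulmxA ek -!scalemxAl -!scalemxAr !mulmxA /dg !mul22.
  by congr (_ *: (mx22 _ _ _ _ *m _)); ring.
exists (- l); first by rewrite oppr_eq0.
rewrite -mulmxA el -!scalemxAl -!scalemxAr !mulmxA /sw !mul22 scaleNr -scalerN -mulNmx.
by rewrite -scaleN1r scale22; congr (_ *: (mx22 _ _ _ _ *m _)); ring.
Qed.

Lemma D3_adapted w (S T : 'M[K]_2) : w ^+ 2 + w + 1 = 0 -> D3_pair S T ->
  exists Q, adapted w Q S T.
Proof. by move=> w3 [uS uT ns s3 sts]; apply: D3_normal. Qed.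

Lemma trmx_proj_eq m k (A B : 'M[K]_(m, k)) : proj_eq A B -> proj_eq A^T B^T.
Proof. by move=> [c c0 ->]; exists c => //; rewrite linearZ. Qed.

Lemma D3_pair_tr (S T : 'M[K]_2) : D3_pair S T -> D3_pair S^T T^T.
Proof.
move=> [uS uT ns s3 sts]; split; rewrite ?unitmx_tr //.
- by move=> [k ek]; apply: ns; exists k; rewrite -[S]trmxK ek tr_scalar_mx.
- by have := trmx_proj_eq s3; rewrite !trmx_mul trmx1 mulmxA.
by have := trmx_proj_eq sts; rewrite !trmx_mul mulmxA.
Qed.

Lemma covering_adapted w (phi : 'rV[{mpoly K[2]}]_2) S T Q :
  w ^+ 2 + w + 1 = 0 -> holcurve 6 phi -> deck phi S -> deck phi T ->
  adapted w Q S^T T^T ->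
  exists2 nu, nu \in unitmx &
    forall q, eval_curve phi (q *m Q) = eval_curve (phi_D3 K) q *m nu^T.
Proof.
move=> w3 hc dS dT ad; have [hphi _] := hc; have uQ : Q \in unitmx by case: ad.
have [c c0 eS] := deck_eval hc dS; have [d d0 eT] := deck_eval hc dT.
have [[k k0 ek] [l l0 el]] := adaptedP ad.
pose psi := precomp phi (mobius Q^T).
have psiE q : eval_curve psi q = eval_curve phi (q *m Q).
  by rewrite eval_precomp_mobius trmxK.
have [] := @covering_normal K w psi (k ^+ 6 * c) (l ^+ 6 * d) w3.
- exact: precomp_mobius_homog.
- by apply: precomp_mobius_nocz; rewrite ?unitmx_tr //; apply: nocf_nocz hc.
- by move=> x y; rewrite !psiE ek (eval_curve_scale _ _ hphi) eS scalerA.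
- by move=> x y; rewrite !psiE el (eval_curve_scale _ _ hphi) eT scalerA.
by move=> nu unu e; exists nu => // q; rewrite -psiE.
Qed.

Lemma covering_ratmap (phi : 'rV[{mpoly K[2]}]_2) Q nu : nu \in unitmx ->
  (forall q, eval_curve phi (q *m Q) = eval_curve (phi_D3 K) q *m nu^T) ->
  ratmap_eq (precomp (mobius (invmx nu)) (precomp phi (mobius Q^T))) (phi_D3 K).
Proof.
move=> unu e; exists 1, 1; split; rewrite ?oner_eq0 // !scale1r.
apply: eval_curve_inj => q.
rewrite eval_precomp eval_mobius eval_precomp_mobius trmxK e -mulmxA -trmx_mul.
by rewrite mulVmx // trmx1 mulmx1.
Qed.

(** * Monodromy of a lift *)

(** Pointwise proportionality off the zeros of a form makes all two by two
    minors of the pair of matrices vanish, and then any nonzero entry of A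
    and of B provides the factors. *)
Lemma prop_ratmap m k (A B : 'M[{mpoly K[2]}]_(m, k)) E :
  E != 0 -> A != 0 -> B != 0 ->
  (forall q : 'rV[K]_2, E.@[q 0] != 0 -> exists c, eval_curve A q = c *: eval_curve B q) ->
  ratmap_eq A B.
Proof.
move=> E0 A0 B0 pr.
have cr i j i' j' : A i j * B i' j' = A i' j' * B i j.
  apply: (mulfI E0); apply: mpoly_eval_inj => q; rewrite mevalM [RHS]mevalM !mevalM.
  have [->|Eq] := eqVneq (E.@[q 0]) 0; first by rewrite !mul0r.
  have [c ec] := pr q Eq; rewrite -!evE ec !mxE; ring.
have [i [j Bij]] : exists i j, B i j != 0.
  case: (pickP (fun ij : 'I_m * 'I_k => B ij.1 ij.2 != 0)) => [[i j] nz|z].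
    by exists i, j.
  move/eqP: B0; case; apply/matrixP => i j; rewrite mxE; apply/eqP.
  by have /negbFE := z (i, j).
exists (B i j), (A i j); split => //.
- apply: contra_neq A0 => Aij; apply/matrixP => i' j'; rewrite mxE.
  by apply: (mulfI Bij); rewrite mulr0 mulrC cr Aij mul0r.
by apply/matrixP => i' j'; rewrite !mxE mulrC cr.
Qed.

(** The defining relation holds at generic points only. Both sides have the
    same degree and no common zeros, so as maps they differ by a constant,
    and the relation extends to all points. *)
Lemma lift_monodromy n (g : 'M[{mpoly K[2]}]_2) (s b : 'M[K]_2) :
  holcurve n g -> \det g != 0 -> s \in unitmx -> b \in unitmx -> monodromy g s b ->
  exists2 c, c != 0 &
    forall q, eval_curve g (q *m s^T) = c *: (eval_curve g q *m invmx b).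
Proof.
move=> hc d0 us ub mon; have [hg _] := hc; have ng := nocf_nocz hc.
pose A := precomp g (mobius s).
pose B := g *m map_mx (@mpolyC 2 K) (invmx b).
have AE q : eval_curve A q = eval_curve g (q *m s^T) by rewrite eval_precomp_mobius.
have BE q : eval_curve B q = eval_curve g q *m invmx b.
  by rewrite eval_curveM eval_curve_const.
have hB i j : B i j \is n.-homog.
  exact: mul_const_homog.
have nB : nocz B.
  move=> q q0; rewrite BE; apply: contra_neq (ng q q0) => z.
  by rewrite -[LHS](mulmxKV ub) z mul0mx.
have nz0 (C : 'M[{mpoly K[2]}]_2) : nocz C -> C != 0.
  move=> nC; have q0 : pt (1 : K) 0 != 0 by rewrite pt_eq0 oner_eq0.
  apply: contra_neq (nC _ q0) => ->; apply/matrixP => i j.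
  by rewrite mxE mxE [RHS]mxE raddf0.
have nA : nocz A by apply: precomp_mobius_nocz.
have detA (q : 'rV[K]_2) : (\det A).@[q 0] = \det (eval_curve g (q *m s^T)).
  by rewrite eval_curve_det AE.
have dA : \det A != 0.
  apply: contra_neq d0 => z; apply: mpoly_eval0 => q; rewrite eval_curve_det.
  have := detA (q *m (invmx s)^T); rewrite z meval0 -mulmxA -trmx_mul mulmxV // trmx1.
  by rewrite mulmx1.
have [c c0 ec] : exists2 c : K, c != 0 & A = c%:MP *: B.
  apply: (@ratmap_homog_eq _ _ _ n) => //.
    exact: precomp_mobius_homog.
  apply: (@prop_ratmap _ _ _ _ (\det g * \det A)); rewrite ?mulf_neq0 ?nz0 // => q.
  rewrite mevalM mulf_eq0 negb_or detA eval_curve_det -!unit22 => /andP[u1 u2].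
  have [l l0 el] := mon q u1 u2; exists l^-1; rewrite AE BE.
  have -> : eval_curve g q = l *: (eval_curve g (q *m s^T) *m b).
    by rewrite scalemxAr -el mulKVmx.
  by rewrite -scalemxAl -mulmxA mulmxV // mulmx1 scalerA mulVf // scale1r.
by exists c => // q; rewrite -AE ec eval_curveZ mevalC BE.
Qed.

Lemma generic_unit (g : 'M[{mpoly K[2]}]_2) : \det g != 0 ->
  exists q, eval_curve g q \in unitmx.
Proof.
move=> d0; case: (classic (exists q, eval_curve g q \in unitmx)) => // h.
move/eqP: d0; case; apply: mpoly_eval0 => q; rewrite eval_curve_det.
by apply/eqP/negPn/negP; rewrite -unit22 => u; apply: h; exists q.
Qed.

(** Relations between S and T carry over to S' and T' because g takes an
    invertible value somewhere. *)
Lemma lift_pair n (g : 'M[{mpoly K[2]}]_2) S T S' T' c d :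
  (forall i j, g i j \is n.-homog) -> \det g != 0 -> c != 0 -> d != 0 ->
  T' \in unitmx ->
  (forall q, eval_curve g (q *m S) = c *: (eval_curve g q *m S')) ->
  (forall q, eval_curve g (q *m T) = d *: (eval_curve g q *m T')) ->
  proj_eq (S *m S *m S) 1%:M -> proj_eq (S *m T *m S) T ->
  proj_eq (S' *m S' *m S') 1%:M /\ proj_eq (S' *m T' *m S') T'.
Proof.
move=> hg d0 c0 dn0 uT' eS eT [k k0 s3] [l l0 sts].
have [q uq] := generic_unit d0.
have canc (X Y : 'M[K]_2) : eval_curve g q *m X = eval_curve g q *m Y -> X = Y.
  by move=> e; rewrite -[X](mulKmx uq) e mulKmx.
split.
- exists (k ^+ n / c ^+ 3); first by rewrite mulf_neq0 ?invr_eq0 ?expf_neq0.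
  apply: canc; apply: (scalerI (expf_neq0 3 c0)).
  transitivity (eval_curve g (q *m S *m S *m S)).
    by rewrite !eS -!scalemxAl !scalerA !mulmxA; congr (_ *: _); ring.
  rewrite -2!mulmxA [S *m (S *m S)]mulmxA s3 -scalemxAr mulmx1.
  rewrite (eval_curve_scale _ _ hg) -scalemxAr mulmx1 scalerA mulrCA mulfV ?mulr1 //.
  exact: expf_neq0.
exists (l ^+ n / c ^+ 2); first by rewrite mulf_neq0 ?invr_eq0 ?expf_neq0.
apply: canc; apply: (scalerI (mulf_neq0 (expf_neq0 2 c0) dn0)).
transitivity (eval_curve g (q *m S *m T *m S)).
  by rewrite !eS !eT !eS -!scalemxAl !scalerA !mulmxA; congr (_ *: _); ring.
rewrite -2!mulmxA [S *m (T *m S)]mulmxA sts -scalemxAr.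
rewrite (eval_curve_scale _ _ hg) eT -scalemxAr !scalerA; congr (_ *: _).
by field.
Qed.

Implicit Types M : 'M[K]_2.

Definition swJ : 'M[K]_2 := mx22 0 1 (-1) 0.

Lemma octv_mul_neq0 M l : M \in unitmx ->
  (forall r : 'rV[K]_2, octv (r *m M) = l * octv r) -> l != 0.
Proof.
(* The point [2, 1] is not a vertex of the octahedron. *)
move=> uM e; apply/eqP => z; have := e (pt 2 1 *m invmx M).
rewrite mulmxKV // z mul0r /octv /Oc pt0 pt1 => /eqP.
have -> : 2 * 1 * (2 ^+ 4 - 1 ^+ 4) = 30%:R :> K by ring.
by rewrite pnatr_eq0.
Qed.

Lemma octa_inv_V M : octa_inv M -> octa_inv (invmx M).
Proof.
move=> [uM [l e]]; split; first by rewrite unitmx_inv.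
have l0 := octv_mul_neq0 uM e.
exists l^-1 => r; apply: (mulfI l0); rewrite -e mulmxKV // [RHS]mulrA mulfV //.
by rewrite mul1r.
Qed.

Lemma mulJT : swJ *m swJ^T = 1%:M.
Proof.
have -> : swJ^T = mx22 0 (-1) 1 0 by apply: mx2P; rewrite !mxE.
by rewrite mul22 one22; congr mx22; ring.
Qed.

Lemma octa_inv_J : octa_inv swJ.
Proof.
split; first by rewrite unit22 det_22 mulr0 sub0r mul1r opprK oner_eq0.
exists 1 => r; rewrite (pt_eta r) pt_mul /octv /Oc !pt0 !pt1; ring.
Qed.

Lemma inv_adj (b : 'M[K]_2) : \det b = 1 -> invmx b = swJ *m b^T *m swJ^T.
Proof.
move=> d1; have ub : b \in unitmx by rewrite unit22 d1 oner_eq0.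
have -> : swJ^T = mx22 0 (-1) 1 0 by apply: mx2P; rewrite !mxE.
have -> : b^T = mx22 (b 0 0) (b 1 0) (b 0 1) (b 1 1) by apply: mx2P; rewrite !mxE.
rewrite -[RHS](mulKmx ub).
suff -> : b *m (swJ *m mx22 (b 0 0) (b 1 0) (b 0 1) (b 1 1) *m mx22 0 (-1) 1 0) = 1%:M.
  by rewrite mulmx1.
rewrite {1}(mx22_eta b) !mul22 one22; have d1' : b 0 0 * b 1 1 = 1 + b 0 1 * b 1 0 by rewrite -d1 det22 subrK.
by congr mx22; ring: d1'.
Qed.

Lemma octa_homog : octa K \is 6.-homog.
Proof.
rewrite /octa; apply: (@dhomogM _ _ _ 2 _ 4).
  by apply: (@dhomogM _ _ _ 1 _ 1); apply: X_homog.
by apply: rpredB; apply/homogX1/X_homog.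
Qed.

(** The action on forms is through the inverse, and row vectors add a
    transposition. *)
Lemma octa_act (b : 'M[K]_2) u v :
  sx (coef6 (Defs.act b (octa K))) u v = octv (pt u v *m (invmx b)^T).
Proof.
rewrite coef6_sx; last first.
  rewrite /Defs.act -[6%N]mul1n; apply: (comp_homog octa_homog) => i.
  by rewrite tnth_mktuple mobius_homog.
rewrite comp_mpoly_meval -eval_mobius.
rewrite /octa; mev; rewrite !tnth_mktuple -!evE.
by rewrite /octv /Oc.
Qed.

Lemma octa_sx u v : sx (coef6 (octa K)) u v = octv (pt u v).
Proof. by rewrite (coef6_sx _ _ octa_homog) /octa; mev; rewrite /octv /Oc. Qed.

Lemma octa_inv_adj (b : 'M[K]_2) : octa_inv b -> octa_inv (swJ *m b *m swJ^T).
Proof.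
move=> ob; have uJ : swJ \in unitmx by case: octa_inv_J.
have -> : swJ^T = invmx swJ by rewrite -[RHS]mulmx1 -mulJT mulKmx.
exact: octa_inv_mul (octa_inv_mul octa_inv_J ob) (octa_inv_V octa_inv_J).
Qed.

(** The contragredient of b is conjugate to b by the quarter turn, which
    preserves the octahedral sextic. *)
Lemma octa_stab_inv (b : 'M[K]_2) : octa_stab b -> octa_inv (invmx b).
Proof.
move=> [d1 [l l0 el]]; have ub : b \in unitmx by rewrite unit22 d1 oner_eq0.
rewrite inv_adj //; apply: octa_inv_adj.
suff : octa_inv ((invmx b)^T) by move/octa_inv_V; rewrite -trmx_inv invmxK.
split; first by rewrite unitmx_tr unitmx_inv.
exists l => r; rewrite (pt_eta r) -octa_act -octa_sx el sxZ.
by [].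
Qed.

Lemma octa_inv_stab (b : 'M[K]_2) : \det b = 1 -> octa_inv b -> octa_stab b.
Proof.
move=> d1 ob; split=> //; have ub : b \in unitmx by rewrite unit22 d1 oner_eq0.
have [uN [l el]] : octa_inv ((invmx b)^T).
  by rewrite inv_adj // !trmx_mul !trmxK mulmxA; apply: octa_inv_adj.
exists l; first exact: octv_mul_neq0 el.
by apply: sx_inj => u v; rewrite sxZ octa_act octa_sx el.
Qed.

End Deck.

(** * The normal form of a lift *)

Section NormalForm.
Variables (K : numClosedFieldType) (w xi e0 e1 : K).
Hypotheses (w3 : w ^+ 2 + w + 1 = 0) (xi4 : xi ^+ 4 = -1).
Hypotheses (e01 : e0 * e1 = 1) (e01s : (e0 + e1) ^+ 2 = -2).
Variables (phi : 'rV[{mpoly K[2]}]_2) (F : 'rV[{mpoly K[2]}]_7).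
Variables (n : nat) (g : 'M[{mpoly K[2]}]_2).

Lemma adapted_inv_form P S' T' : adapted w P S' T' -> octa_inv S' -> octa_inv T' ->
  exists m s, [/\ m != 0, s ^+ 2 = -2 &
    forall x y, octv (pt x y *m P) =
                m * (x ^+ 6 - 5 * s * x ^+ 3 * y ^+ 3 + y ^+ 6)].
Proof.
move=> ad [_ [l el]] [_ [l' el']]; have [[k k0 ek] [k' k'0 ek']] := adaptedP ad.
have uP : P \in unitmx by case: ad.
apply: (octa_D3_form w3 uP).
  by exists (k ^+ 6 * l) => x y; rewrite ek octvZ el mulrA.
by exists (k' ^+ 6 * l') => x y; rewrite ek' octvZ el' mulrA.
Qed.

(** In adapted coordinates the octahedral sextic is one of the two invariant
    sextics of [octa_D3_form]; after a flip if necessary it is the one of the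
    frame. Coordinates with the same sextic differ by a symmetry of the
    octahedron. *)
Lemma adapted_frame S' T' : D3_pair S' T' -> octa_inv S' -> octa_inv T' ->
  exists C, octa_inv C /\ adapted w (frame xi e0 *m C) S' T'.
Proof.
move=> pr oS oT; have [P ad] := D3_adapted w3 pr.
suff [P' ad' [m m0 em]] : exists2 P', adapted w P' S' T' &
    exists2 m, m != 0 & forall x y, octv (pt x y *m P') =
      m * (x ^+ 6 - 5 * (e0 + e1) * x ^+ 3 * y ^+ 3 + y ^+ 6).
  have uf := frame_unit xi4 e01 e01s.
  exists (invmx (frame xi e0) *m P'); rewrite mulKVmx //; split=> //; split.
    by rewrite unitmx_mul unitmx_inv uf; case: ad'.
  exists (m / frame_lc xi e0) => r.
  rewrite mulmxA [r *m _]pt_eta em; set r' := r *m _.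
  have -> : r = pt (r' 0 0) (r' 0 1) *m frame xi e0 by rewrite -pt_eta mulmxKV.
  by rewrite (octv_frame xi4 e01 e01s); field; exact: frame_lc_neq0 xi4 e01.
have [m [s [m0 s2 em]]] := adapted_inv_form ad oS oT.
have : (s - (e0 + e1)) * (s + (e0 + e1)) = 0.
  by rewrite -subr_sqr s2 e01s subrr.
move=> /eqP; rewrite mulf_eq0 subr_eq0 addr_eq0 => /orP[] /eqP es.
  by exists P => //; exists m => // x y; rewrite em es.
exists (mx22 1 0 0 (-1) *m P); first exact: adapted_flip.
exists m => // x y; rewrite mulmxA pt_mul em es; ring.
Qed.

Lemma branchP (q : 'rV[K]_2) : q != 0 -> q 0 0 * q 0 1 * (q 0 0 ^+ 6 - q 0 1 ^+ 6) = 0 ->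
  exists2 k, k != 0 & branch (k *: q).
Proof.
move=> q0 br; rewrite (pt_eta q) in q0 *; move: br q0.
move: (q 0 0) (q 0 1) => x y br q0.
have [y0|y0] := eqVneq y 0.
  have x0 : x != 0 by move: q0; rewrite y0 pt_eq0 eqxx andbT.
  exists x^-1; rewrite ?invr_eq0 // pt_scale y0 mulr0 mulVf //; by left.
exists y^-1; rewrite ?invr_eq0 // pt_scale mulVf //; right; exists (y^-1 * x); split=> //.
move/eqP: br; rewrite !mulf_eq0 (negPf y0) orbF subr_eq0 => /orP[/eqP ->|/eqP e].
  by left; rewrite mulr0.
by right; rewrite exprMn e exprVn mulVf // expf_neq0.
Qed.

(** The dihedral group permutes the six vertices transitively, so the zero of
    a vertex factor can be moved to a zero of the factor for e1; there the
    equations are the orthogonality to vt t. *)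
Lemma vertex_transport ab (q : 'rV[K]_2) j : q 0 0 != 0 -> q 0 1 != 0 ->
  q 0 0 ^+ 6 != q 0 1 ^+ 6 ->
  (forall i, (hD ab i 0).@[q 0] + eps w e0 e1 j * (hD ab i 1).@[q 0] = 0) ->
  exists t, [/\ t != 0, t ^+ 6 != 1 & ab *m (vt e1 t)^T = 0].
Proof.
move=> x0 y0 xy6 z; have w13 := cube_root1 w3; have w0 := cube_root_neq0 w3.
have e10 : e1 != 0 by apply: (@e0_neq0 _ e1 e0); rewrite mulrC.
have perp t : (forall i, (hD ab i 0).@[pt t 1 0] + e1 * (hD ab i 1).@[pt t 1 0] = 0) ->
    ab *m (vt e1 t)^T = 0.
  move=> zt; apply/matrixP => i j'; rewrite mxE sum3 !mxE inordK //= -[RHS](zt i).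
  by have [-> ->] := hD_eval ab t 1 i; ring.
have wk k : w ^+ (3 * k) = 1 by rewrite exprM w13 expr1n.
pose z1 := q 0 0 / q 0 1.
have z10 : z1 != 0 by rewrite mulf_neq0 ?invr_eq0.
have z16 : z1 ^+ 6 != 1.
  rewrite exprMn exprVn; apply: contra_neq xy6 => e.
  by rewrite -[RHS]mul1r -e mulfVK // expf_neq0.
have qE : q = q 0 1 *: pt z1 1.
  by rewrite {1}(pt_eta q) pt_scale mulr1 mulrC mulfVK.
have zz i : (hD ab i 0).@[pt z1 1 0] + eps w e0 e1 j * (hD ab i 1).@[pt z1 1 0] = 0.
  have := z i; rewrite qE !(form_scale _ _ (hD_homog ab _ _)) mulrCA -mulrDr => /eqP.
  by rewrite mulf_eq0 expf_eq0 (negPf y0) /= => /eqP.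
have rot k x i : (hD ab i 0).@[pt (w ^+ k * x) 1 0] = (hD ab i 0).@[pt x 1 0] * w ^+ k
    /\ (hD ab i 1).@[pt (w ^+ k * x) 1 0] = (hD ab i 1).@[pt x 1 0].
  have wk3 : (w ^+ k) ^+ 3 = 1 by rewrite -exprM mulnC wk.
  by rewrite -!evE (hD_rot _ _ _ wk3) !mul_dg.
have w6 k : (w ^+ k) ^+ 6 = 1 by rewrite -exprM mulnC -[(6 * k)%N]/((3 * 2) * k)%N -mulnA wk.
have [k [ej|ej]] := eps_cases w e0 e1 j; rewrite ej in zz.
- exists (w ^+ k * z1^-1); split.
  + by rewrite mulf_neq0 ?invr_eq0 ?expf_neq0.
  + by rewrite exprMn w6 mul1r exprVn invr_eq1.
  apply: perp => i; have [-> ->] := rot k z1^-1 i.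
  have -> : pt z1^-1 1 = z1^-1 *: pt 1 z1 by rewrite pt_scale mulr1 mulVf.
  rewrite !(form_scale _ _ (hD_homog ab _ _)) -!evE hD_swap.
  rewrite ![(- _ : 'M_2) _ _]mxE !mul_sw !evE.
  have := zz i; move: ((hD ab i 0).@[_]) ((hD ab i 1).@[_]) => A B AB.
  transitivity (- (z1^-1 ^+ 7 * e1 * (A + e0 * w ^+ k * B))); last by rewrite AB mulr0 oppr0.
  by ring: e01.
exists (w ^+ (2 * k) * z1); split.
- by rewrite mulf_neq0 ?expf_neq0.
- by rewrite exprMn w6 mul1r.
apply: perp => i; have [-> ->] := rot (2 * k)%N z1 i.
have := zz i; move: ((hD ab i 0).@[_]) ((hD ab i 1).@[_]) => A B AB.
transitivity (w ^+ (2 * k) * (A + e1 * w ^+ k * B)); last by rewrite AB mulr0.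
have wkk : w ^+ (2 * k) * w ^+ k = 1 by rewrite -exprD -mulSnr wk.
by rewrite mulrDr [_ * A]mulrC mulrA [_ * (e1 * _)]mulrCA wkk mulr1.
Qed.

(** The maps F o phi and f1 o g agree, and the former, of degree 36, has no
    common zero. *)
Lemma lift_relation : holcurve 6 phi -> holcurve 6 F -> holcurve n g ->
  ratmap_eq (f1 g) (precomp F phi) ->
  exists h : {mpoly K[2]}, [/\ (36 <= 6 * n)%N, h \is (6 * n - 36).-homog, h != 0 &
    forall r, f1 (eval_curve g r) = h.@[r 0] *: eval_curve F (eval_curve phi r)].
Proof.
move=> hcp hcF [hg _] rm; have [hp _] := hcp; have [hF _] := hcF.
have h1 i j : f1 g i j \is (6 * n).-homog by rewrite (ord1 i) f1_homog.
have h2 := precomp_homog hF hp.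
have nFp : nocz (precomp F phi).
  move=> q q0; rewrite eval_precomp; apply: (nocf_nocz hcF).
  exact: (nocf_nocz hcp).
have [h [le hh h0 e]] := ratmap_homog h1 h2 nFp rm.
exists h; split=> // r.
by rewrite -eval_f1 e eval_curveZ eval_precomp.
Qed.

(** The deck group is standardized by Q, its monodromy image by the frame and
    C. The injectivity of the monodromy serves to keep the image of S
    nontrivial. *)
Lemma lift_frame S T : holcurve n g -> deck phi S -> deck phi T -> D3_pair S T ->
  galois_lift phi F n g ->
  exists Q C, [/\ adapted w Q S^T T^T, octa_inv C &
   exists c c', [/\ c != 0, c' != 0,
    forall x y, eval_curve g (pt (w * x) y *m Q) *m invmx (frame xi e0 *m C)
      = c *: (eval_curve g (pt x y *m Q) *m invmx (frame xi e0 *m C) *m dg w)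
    & forall x y, eval_curve g (pt y x *m Q) *m invmx (frame xi e0 *m C)
      = c' *: (eval_curve g (pt x y *m Q) *m invmx (frame xi e0 *m C) *m sw K)]].
Proof.
move=> hc dS dT pST [_ _ d0 [rho [dr _ inj]]]; have [hg _] := hc.
have [uS uT nS _ _] := pST; have pST' := D3_pair_tr pST; have [_ _ _ S3 STS] := pST'.
have unit_rho s : deck phi s -> rho s \in unitmx.
  by move=> /dr[[d1 _] _]; rewrite unit22 d1 oner_eq0.
have mono s (ds : deck phi s) := lift_monodromy hc d0 (proj1 ds) (unit_rho s ds) (proj2 (dr s ds)).
have [cS cS0 eS] := mono S dS; have [cT cT0 eT] := mono T dT.
have uS' : invmx (rho S) \in unitmx by rewrite unitmx_inv unit_rho.
have uT' : invmx (rho T) \in unitmx by rewrite unitmx_inv unit_rho.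
have [S'3 STS'] := lift_pair hg d0 cS0 cT0 uT' eS eT S3 STS.
have d1 : deck phi 1%:M.
  split; first exact: unitmx1.
  exists 1, 1; split; rewrite ?oner_eq0 // !scale1r; apply: eval_curve_inj => q.
  by rewrite eval_precomp_mobius trmx1 mulmx1.
have pr' : D3_pair (invmx (rho S)) (invmx (rho T)).
  split=> // [[k ek]]; apply: nS.
  have [c c0 e] := mono _ d1; have [q uq] := generic_unit d0.
  have r1 : invmx (rho 1%:M) = c^-1 *: 1%:M.
    apply: (scalerI c0); rewrite scalerA mulfV // scale1r.
    have := e q; rewrite trmx1 mulmx1 scalemxAr => e'.
    by rewrite -[LHS](mulKmx uq) -e' mulVmx.
  have k0 : k != 0.
    by apply: contraTneq uS' => k0; rewrite ek k0 unitmxE det_scalar expr0n unitr0.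
  have rS : rho S = k^-1 *: 1%:M.
    by rewrite -[rho S]invmxK ek invmx_scalar scalemx1.
  have r1' : rho 1%:M = c *: 1%:M.
    by rewrite -[rho _]invmxK r1 scalemx1 invmx_scalar invrK scalemx1.
  have [|l l0 el] := inj S 1%:M dS d1.
    exists (k^-1 / c); first by rewrite mulf_neq0 ?invr_eq0.
    by rewrite rS r1' scalerA divfK.
  by exists l; rewrite el scalemx1.
have [C [oC [uP [kS kS0 eSP] [kT kT0 eTP]]]] :=
  adapted_frame pr' (octa_stab_inv (proj1 (dr S dS))) (octa_stab_inv (proj1 (dr T dT))).
have [Q ad] := D3_adapted w3 pST'; have [[k k0 ek] [l l0 el]] := adaptedP ad.
exists Q, C; split=> //; set P := frame xi e0 *m C in uP eSP eTP *.
have tr s' d kk : P *m s' = kk *: d *m P -> s' *m invmx P = kk *: (invmx P *m d).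
  move=> e; rewrite -[s' *m _](mulKmx uP) [P *m (s' *m _)]mulmxA e -!scalemxAl mulmxK //.
  by rewrite -scalemxAr.
exists (k ^+ n * cS * kS), (l ^+ n * cT * kT); split; rewrite ?mulf_neq0 ?expf_neq0 //.
- move=> x y; rewrite ek (eval_curve_scale _ _ hg) eS -!scalemxAl -mulmxA (tr _ _ _ eSP).
  by rewrite -scalemxAr !scalerA mulmxA.
move=> x y; rewrite el (eval_curve_scale _ _ hg) eT -!scalemxAl -mulmxA (tr _ _ _ eTP).
by rewrite -scalemxAr !scalerA mulmxA.
Qed.

(** The degree is between 6 and 7 by comparison of degrees and
    [equiv_deg_bound], and not divisible by 3. *)
Lemma frame_degree (G : 'M[{mpoly K[2]}]_2) (Z : 'rV[{mpoly K[2]}]_7) h c c' :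
  (forall i j, G i j \is n.-homog) -> nocz G -> c != 0 -> c' != 0 ->
  (forall x y, eval_curve G (pt (w * x) y) = c *: (eval_curve G (pt x y) *m dg w)) ->
  (forall x y, eval_curve G (pt y x) = c' *: (eval_curve G (pt x y) *m sw K)) ->
  \det G != 0 -> (36 <= 6 * n)%N -> h \is (6 * n - 36).-homog -> h != 0 ->
  (forall q, f1 (eval_curve G q *m frame xi e0) = h.@[q 0] *: eval_curve Z q) ->
  n = 7%N.
Proof.
move=> hG nG c0 c'0 eG eG' d0 le hh h0 ef.
have le7 : (n <= 7)%N.
  apply: (@equiv_deg_bound _ _ w3 n G c c' hG nG c0 c'0 eG eG' (eps w e0 e1) h
    (fun u v => (frame_lc xi e0)^-1 *: \sum_(i < 7) (u ^+ (6 - i) * v ^+ i) *: Z 0 i)) => //.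
  - exact: eps_inj w3 e01 e01s.
  - exact: eps_neq0.
  - exact: eps_6.
  move=> u v; apply: mpoly_eval_inj => q.
  rewrite rmorph_prod mevalM mevalZ raddf_sum /=.
  have := sx_f1_frame w3 xi4 e01 e01s (eval_curve G q) u v; rewrite ef sxZ => e.
  apply: (mulfI (frame_lc_neq0 xi4 e01)).
  transitivity (h.@[q 0] * sx (eval_curve Z q) u v).
    rewrite e; congr (_ * _); apply: eq_bigr => i _.
    by rewrite !evE; mev.
  rewrite mulrCA [X in _ = _ * X]mulrA mulfV ?(frame_lc_neq0 xi4 e01) // mul1r; congr (_ * _).
  by apply: eq_bigr => i _; rewrite mevalZ evE mulrC.
have := equiv_deg_mod w3 hG nG c0 c'0 eG eG'.
move: le le7; clear; case: n => [|[|[|[|[|[|[|[|]]]]]]]] //.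
Qed.

(** Both row spaces are the kernel of v^T, by dimension. *)
Lemma perp_unique k (v : 'rV[K]_k.+1) (a b : 'M[K]_(k, k.+1)) : v != 0 ->
  \rank a = k -> a *m v^T = 0 -> \rank b = k -> b *m v^T = 0 -> (b == a)%MS.
Proof.
move=> v0 ra pa rb pb.
have rk : \rank (kermx v^T) = k.
  by rewrite mxrank_ker mxrank_tr rank_rV v0 subn1.
have eqk (c : 'M[K]_(k, k.+1)) : \rank c = k -> c *m v^T = 0 -> (c == kermx v^T)%MS.
  by move=> rc /sub_kermxP s; rewrite -(mxrank_leqif_eq s) rc rk.
have /eqmxP ea := eqk a ra pa; have /eqmxP eb := eqk b rb pb.
by apply/eqmxP; apply: eqmx_trans eb (eqmx_sym ea).
Qed.

(** As n = 7 is 1 modulo 3, the multiplier of the rotation is 1. That of the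
    swap is a sign, which a flip changes because n is odd. So the curve is
    one of the standard equivariant curves, and a zero of h determines t. *)
Lemma lift_normal_form S T : holcurve 6 phi -> holcurve 6 F ->
  deck phi S -> deck phi T -> D3_pair S T -> galois_lift phi F n g ->
  n = 7%N /\ exists Q nu t ab C,
   [/\ Q \in unitmx,
       nu \in unitmx /\
       forall q, eval_curve phi (q *m Q) = eval_curve (phi_D3 K) q *m nu^T,
       \rank ab = 2%N /\ ab *m (vt e1 t)^T = 0,
       octa_inv C /\ forall q, eval_curve g (q *m Q) = eval_curve (gD xi e0 ab) q *m C
     & ~ generally_ramified F].
Proof.
move=> hcp hcF dS dT pST gl; have [hcg rm d0 _] := gl.
have [hg _] := hcg; have [hp _] := hcp; have [hF _] := hcF.
have [Q0 [C [ad oC [c [c' [c0 c'0 eS eT]]]]]] := lift_frame hcg dS dT pST gl.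
set P := frame xi e0 *m C in eS eT.
have uC : C \in unitmx by case: oC.
have uP : P \in unitmx by rewrite unitmx_mul (frame_unit xi4 e01 e01s).
have [h [le hh h0 eh]] := lift_relation hcp hcF hcg rm.
pose G Q := precomp g (mobius Q^T) *m map_mx (@mpolyC 2 K) (invmx P).
have GE Q q : eval_curve (G Q) q = eval_curve g (q *m Q) *m invmx P.
  by rewrite eval_curveM eval_curve_const eval_precomp_mobius trmxK.
have hG Q i j : G Q i j \is n.-homog.
  exact/mul_const_homog/precomp_mobius_homog.
have ng := nocf_nocz hcg.
have nG Q : Q \in unitmx -> nocz (G Q).
  move=> uQ q q0; rewrite GE; have qQ : q *m Q != 0.
    by apply: contra_neq q0 => z; rewrite -[q](mulmxK uQ) z mul0mx.
  by apply: contra_neq (ng _ qQ) => z; rewrite -[LHS](mulmxKV uP) z mul0mx.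
have dG Q : Q \in unitmx -> \det (G Q) != 0.
  move=> uQ; have [q uq] := generic_unit d0.
  apply/eqP => z; have := eval_curve_det (G Q) (q *m invmx Q).
  rewrite z meval0 GE mulmxKV // => /esym/eqP; apply/negP.
  by rewrite -unit22 unitmx_mul uq unitmx_inv.
have [_ [lC elC]] := oC; have lC0 := octv_mul_neq0 uC elC.
pose hQ Q := lC^-1 *: (h \mPo (mktuple (mobius Q^T 0))).
have hQE Q (q : 'rV[K]_2) : (hQ Q).@[q 0] = lC^-1 * h.@[(q *m Q) 0].
  rewrite mevalZ comp_mpoly_meval; congr (_ * _); rewrite -[Q in RHS]trmxK -eval_mobius.
  by apply: meval_eq => l; rewrite tnth_mktuple !mxE.
have hhQ Q : hQ Q \is (6 * n - 36).-homog.
  apply: rpredZ; rewrite -[(6 * n - 36)%N]mul1n; apply: (comp_homog hh) => l.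
  by rewrite tnth_mktuple mobius_homog.
have hQ0 Q : Q \in unitmx -> hQ Q != 0.
  move=> uQ; apply: contra_neq h0 => z; apply: mpoly_eval0 => q.
  have := hQE Q (q *m invmx Q); rewrite z meval0 mulmxKV // => /esym/eqP.
  by rewrite mulf_eq0 invr_eq0 (negPf lC0) => /eqP.
have f1G Q q : f1 (eval_curve (G Q) q *m frame xi e0) =
    (hQ Q).@[q 0] *: eval_curve F (eval_curve phi (q *m Q)).
  have e : eval_curve g (q *m Q) = eval_curve (G Q) q *m frame xi e0 *m C.
    by rewrite -mulmxA -/P GE mulmxKV.
  have := eh (q *m Q); rewrite e (f1_mul_inv _ elC) hQE -scalerA => <-.
  by rewrite scalerA mulVf // scale1r.
have uQ0 : Q0 \in unitmx by case: ad.
pose Z Q := precomp F (precomp phi (mobius Q^T)).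
have ZE Q q : eval_curve (Z Q) q = eval_curve F (eval_curve phi (q *m Q)).
  by rewrite eval_precomp eval_precomp_mobius trmxK.
have GS x y : eval_curve (G Q0) (pt (w * x) y) = c *: (eval_curve (G Q0) (pt x y) *m dg w).
  by rewrite !GE eS.
have GT x y : eval_curve (G Q0) (pt y x) = c' *: (eval_curve (G Q0) (pt x y) *m sw K).
  by rewrite !GE eT.
have n7 : n = 7%N.
  apply: (@frame_degree (G Q0) (Z Q0) (hQ Q0) c c') => //.
  - exact: nG.
  - exact: dG.
  - exact: hQ0.
  by move=> q; rewrite f1G ZE.
split=> //.
have n31 : (n %% 3 = 1)%N by rewrite n7.
have c1 : c = 1 := equiv_deg1 w3 (hG Q0) (nG _ uQ0) c0 c'0 GS GT n31.
have c'2 := equiv_swap_sq (nG _ uQ0) GT.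
have [Q [adQ QS QT]] : exists Q, [/\ adapted w Q S^T T^T,
   forall x y, eval_curve (G Q) (pt (w * x) y) = eval_curve (G Q) (pt x y) *m dg w
  & forall x y, eval_curve (G Q) (pt y x) = - (eval_curve (G Q) (pt x y) *m sw K)].
  have : (c' - 1) * (c' + 1) = 0 by rewrite -subr_sqr_1 c'2 subrr.
  move=> /eqP; rewrite mulf_eq0 subr_eq0 addr_eq0 => /orP[] /eqP ec'; last first.
    exists Q0; split=> // x y; first by rewrite GS c1 scale1r.
    by rewrite GT ec' scaleN1r.
  have GflipE x y : eval_curve (G (mx22 1 0 0 (-1) *m Q0)) (pt x y)
      = eval_curve (G Q0) (pt x (- y)).
    rewrite [LHS]GE [RHS]GE [pt x y *m _]mulmxA pt_mul.
    by rewrite !mulr0 mulr1 addr0 add0r mulrN1.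
  exists (mx22 1 0 0 (-1) *m Q0); split; first exact: adapted_flip.
    by move=> x y; rewrite [in RHS]GflipE [LHS]GflipE GS c1 scale1r.
  move=> x y; rewrite [in RHS]GflipE [LHS]GflipE.
  have -> : pt y (- x) = -1 *: pt (- y) x.
    by rewrite pt_scale mulN1r opprK mulN1r.
  rewrite (eval_curve_scale _ _ (hG Q0)) GT ec' scale1r {1}n7.
  have -> : (-1) ^+ 7 = -1 :> K by ring.
  by rewrite scaleN1r.
have uQ : Q \in unitmx by case: adQ.
have hG7 i j : G Q i j \is 7.-homog by rewrite -n7.
have [ab eab] := hD_normal w3 hG7 QS QT.
have gQ q : eval_curve g (q *m Q) = eval_curve (gD xi e0 ab) q *m C.
  by rewrite gD_eval -mulmxA -/P -eab GE mulmxKV.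
have [nu unu enu] := covering_adapted w3 hcp dS dT adQ.
have dD : \det (gD xi e0 ab) != 0.
  have -> : \det (gD xi e0 ab) = \det (G Q) * \det (map_mx (@mpolyC 2 K) (frame xi e0)).
    by rewrite eab -det_mulmx.
  rewrite mulf_neq0 ?dG // det_map_mx mpolyC_eq0.
  by have := frame_unit xi4 e01 e01s; rewrite unit22.
have h6 : hQ Q \is 6.-homog by have := hhQ Q; rewrite n7.
have fD q : f1 (eval_curve (gD xi e0 ab) q) =
    (hQ Q).@[q 0] *: eval_curve F (eval_curve phi (q *m Q)).
  by rewrite gD_eval -eab f1G.
(* For n = 7 the form h has degree 6, hence a zero: this is where t comes
   from. *)
have [q q0 hq] := form_zero h6.
have [j vj] : exists j, forall i, eval_curve (hD ab) q i 0
      + eps w e0 e1 j * eval_curve (hD ab) q i 1 = 0.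
  by apply: (f1_frame_zero w3 xi4 e01 e01s); rewrite -gD_eval fD hq scale0r.
have nbr : q 0 0 * q 0 1 * (q 0 0 ^+ 6 - q 0 1 ^+ 6) != 0.
  apply/eqP => /(branchP q0)[k k0 br].
  have QS' x y : eval_curve (G Q) (pt (w * x) y) = 1 *: (eval_curve (G Q) (pt x y) *m dg w).
    by rewrite QS scale1r.
  have QT' x y : eval_curve (G Q) (pt y x) = -1 *: (eval_curve (G Q) (pt x y) *m sw K).
    by rewrite QT scaleN1r.
  have N1 : (-1 : K) != 0 by rewrite oppr_eq0 oner_eq0.
  have [i /eqP nz] := branch_vertex w3 hG7 (nG _ uQ) (oner_neq0 _) N1 QS' QT' br
    (eps_neq0 w3 e01 j) (eps_6 w3 e01 e01s j).
  apply: nz; rewrite -!evE (eval_curve_scale _ _ hG7) eab.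
  by rewrite ![(_ *: _ : 'M_2) _ _]mxE mulrCA -mulrDr vj mulr0.
move: nbr; rewrite !mulf_eq0 !negb_or subr_eq0 => /andP[/andP[x0 y0] xy6].
have [|t [t0 t6 pt_]] := @vertex_transport ab q j x0 y0 xy6.
  by move=> i; rewrite -!evE.
have [q1 u1] := generic_unit dD.
have rab : \rank ab = 2%N.
  apply/eqP; rewrite eqn_leq rank_leq_row /=.
  move: u1; rewrite gD_eval /hD eval_curveM eval_curve_const -mulmxA => u1.
  have := mxrankM_maxl ab (eval_curve (Nmx K) q1 *m frame xi e0).
  by rewrite (mxrank_unit u1).
(* For t = e1 the determinant would vanish identically. *)
have te : t != e1.
  apply/eqP => te; have [k k0 ek] := gD_det xi4 e01 e01s rab pt_.
  move/eqP: dD; apply; apply: mpoly_eval0 => r.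
  by rewrite (pt_eta r) ek te subrr mul0r mulr0.
exists Q, nu, t, ab, C; split=> //.
pose psi := precomp phi (mobius Q^T).
have psiE q' : eval_curve psi q' = eval_curve phi (q' *m Q).
  by rewrite eval_precomp_mobius trmxK.
apply: (@not_ramified K w xi e0 e1 w3 xi4 e01 e01s t ab rab pt_ t0 t6 te nu psi F 6 (hQ Q)) => //.
- by move=> r; rewrite psiE enu.
- exact: precomp_mobius_homog.
- by apply: precomp_mobius_nocz; rewrite ?unitmx_tr //; apply: nocf_nocz hcp.
- exact: nocf_nocz hcF.
by move=> r; rewrite fD psiE.
Qed.

End NormalForm.

(** * The sextic curve of a member of the family *)

Section Family.
Variables (K : numClosedFieldType) (w xi e0 e1 : K).
Hypotheses (w3 : w ^+ 2 + w + 1 = 0) (xi4 : xi ^+ 4 = -1).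
Hypotheses (e01 : e0 * e1 = 1) (e01s : (e0 + e1) ^+ 2 = -2).

Lemma mform_scale k d (p : {mpoly K[k]}) (v : 'rV[K]_k) c : p \is d.-homog ->
  p.@[(c *: v) 0] = c ^+ d * p.@[v 0].
Proof.
move=> /dhomogP hp; rewrite !mevalE mulr_sumr; apply: eq_big_seq => m /hp <-.
rewrite (_ : \prod_i _ = c ^+ mdeg m * \prod_i v 0 i ^+ m i); first by rewrite mulrCA.
by rewrite mdegE -prodrXr -big_split /=; apply: eq_bigr => i _; rewrite mxE exprMn.
Qed.

(** Dividing m by a square root of its determinant brings it into SL_2. *)
Lemma f1_orbit (m : 'M[K]_2) : \det m != 0 -> Defs.orbit (octa K) (f1 m).
Proof.
move=> d0; pose s := sqrtC (\det m).
have s0 : s != 0 by rewrite sqrtC_eq0.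
exists (s^-1 *: m); first by rewrite detZ exprVn sqrtCK mulVf.
exists (s ^+ 6); first by rewrite expf_neq0.
have -> : f1 m = s ^+ 6 *: f1 (s^-1 *: m).
  by rewrite f1Z scalerA -exprMn mulfV // expr1n scale1r.
congr (_ *: _); apply: sx_inj => u v; rewrite octa_act f1_octv inv_adj; last first.
  by rewrite detZ exprVn sqrtCK mulVf.
move: (s^-1 *: m) => {d0 s s0}m.
rewrite !trmx_mul !trmxK mulmxA (mx22_eta m).
have -> : (swJ K)^T = mx22 0 (-1) 1 0 by apply: mx2P; rewrite !mxE.
by rewrite !mulmxA !pt_mul /octv /Oc !pt0 !pt1; ring.
Qed.

(** The coefficients of (p u + q v)^5 (r u + s v). *)
Lemma act_quintuple (a : 'M[K]_2) : exists p q r s : K,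
  coef6 (Defs.act a ('X_0 ^+ 5 * 'X_1)) =
  row7 (p ^+ 5 * r) (5 * p ^+ 4 * q * r + p ^+ 5 * s)
    (10 * p ^+ 3 * q ^+ 2 * r + 5 * p ^+ 4 * q * s)
    (10 * p ^+ 2 * q ^+ 3 * r + 10 * p ^+ 3 * q ^+ 2 * s)
    (5 * p * q ^+ 4 * r + 10 * p ^+ 2 * q ^+ 3 * s)
    (q ^+ 5 * r + 5 * p * q ^+ 4 * s) (q ^+ 5 * s).
Proof.
pose b := invmx a; exists (b 0 0), (b 0 1), (b 1 0), (b 1 1).
have h6 : ('X_0 ^+ 5 * 'X_1 : {mpoly K[2]}) \is 6.-homog.
  by apply: (@dhomogM _ _ _ 5 _ 1); [apply/homogX1/X_homog|apply: X_homog].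
apply: sx_inj => u v; rewrite coef6_sx; last first.
  rewrite /Defs.act -[6%N]mul1n; apply: (comp_homog h6) => i.
  by rewrite tnth_mktuple mobius_homog.
rewrite comp_mpoly_meval sx_row7; mev; rewrite !tnth_mktuple -!evE eval_mobius.
by rewrite !mxE !sum2 !mxE /=; ring.
Qed.

Section Member.
Variables (t : K) (ab : 'M[K]_(2, 3)).
Hypotheses (rab : \rank ab = 2%N) (pab : ab *m (vt e1 t)^T = 0).
Hypotheses (t0 : t != 0) (t6 : t ^+ 6 != 1) (te : t != e1).
Let g := gD xi e0 ab.

Let dg0 : \det g != 0.
Proof. exact: (gD_det_neq0 xi4 e01 e01s rab pab te). Qed.

Let simple (q : 'rV[K]_2) : q != 0 -> (\det g).@[q 0] = 0 ->
  exists i, ((\det g)^`M(i)).@[q 0] != 0.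
Proof. exact: (gD_det_simple xi4 e01 e01s rab pab t0 t6 te). Qed.

(** A common zero would be a double zero of the determinant. *)
Lemma gD_nocz : nocz g.
Proof.
move=> q q0; apply/eqP => gq.
have z i j : (g i j).@[q 0] = 0 by rewrite -evE gq mxE.
have dq : (\det g).@[q 0] = 0 by rewrite eval_curve_det gq det0.
have [i /eqP nz] := simple q0 dq; apply: nz.
have [h eh] : exists h, \det g = lin q ^+ 2 * h.
  have fac i' j := form_factor_pred q0 (gD_homog xi e0 ab i' j) (z i' j).
  have [a _ ea] := fac 0 0; have [b _ eb] := fac 0 1.
  have [c _ ec] := fac 1 0; have [d _ ed] := fac 1 1.
  by exists (a * d - b * c); rewrite det22 ea eb ec ed; ring.
exact: sq_dvd_mderiv eh.
Qed.

Let tau := eval_curve (phi_D3 K) (pt t 1).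

Let tau0 : tau != 0.
Proof. by apply: phi_D3_nocz; rewrite pt_eq0 oner_eq0 andbF. Qed.

(** The linear form of the point below [t, 1], pulled back along the
    covering. *)
Definition hm : {mpoly K[2]} := lin tau \mPo (mktuple (phi_D3 K 0)).

Lemma hm_eval (q : 'rV[K]_2) : hm.@[q 0] = (lin tau).@[eval_curve (phi_D3 K) q 0].
Proof.
by rewrite comp_mpoly_meval; apply: meval_eq => l; rewrite tnth_mktuple evE.
Qed.

Lemma hm_homog : hm \is 6.-homog.
Proof.
rewrite -[6%N]muln1; apply: (comp_homog (lin_homog tau)) => i.
by rewrite tnth_mktuple phi_D3_homog.
Qed.

Lemma hm_zero x y : hm.@[pt x y 0] =
  - ((x ^+ 3 - t ^+ 3 * y ^+ 3) * (t ^+ 3 * x ^+ 3 - y ^+ 3)) / 4.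
Proof.
by rewrite hm_eval lin_eval /tau !phi_D3_eval !pt0 !pt1 /al /ga; field.
Qed.

(** The coefficients of f1 g are forms in the components of the covering that
    vanish at the point below [t, 1] ([f1_gD_phi], [f1_gD_t]), so they are
    divisible by the linear form of that point. *)
Lemma family_sextic : exists2 F : 'rV[{mpoly K[2]}]_7,
  (forall i j, F i j \is 6.-homog) &
  forall q, f1 (eval_curve g q) = hm.@[q 0] *: eval_curve F (eval_curve (phi_D3 K) q).
Proof.
have [p hp ep] := f1_gD_phi w3 xi4 e01 e01s ab.
have pz i : (p 0 i).@[tau 0] = 0 by rewrite -evE -ep (f1_gD_t xi e01 pab) mxE.
have fac i : exists2 f : {mpoly K[2]}, f \is 6.-homog & p 0 i = lin tau * f.
  exact: (form_factor tau0 (hp 0 i)).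
have [f hf ef] := @fin_all_exists2 _ (fun _ => {mpoly K[2]})
  (fun i (f : {mpoly K[2]}) => f \is 6.-homog) (fun i f => p 0 i = lin tau * f) fac.
exists (\row_i f i) => [i j|q]; first by rewrite mxE.
apply/rowP => i; rewrite ep evE [RHS]mxE evE mxE ef mevalM hm_eval.
by [].
Qed.

Variable F : 'rV[{mpoly K[2]}]_7.
Hypothesis hF : forall i j, F i j \is 6.-homog.
Hypothesis eF : forall q,
  f1 (eval_curve g q) = hm.@[q 0] *: eval_curve F (eval_curve (phi_D3 K) q).

(** At the branch points no vertex factor vanishes ([branch_vertex]), and the
    remaining zeros of the determinant are those of hm. *)
Lemma f1_zero_hm q : q != 0 -> f1 (eval_curve g q) = 0 -> hm.@[q 0] = 0.
Proof.
move=> q0 f0.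
have dq : (\det g).@[q 0] = 0.
  by rewrite eval_curve_det Qinv_f1_eq0 // f0 -[0](scale0r 0) QinvZ expr0n mul0r.
have nbr : q 0 0 * q 0 1 * (q 0 0 ^+ 6 - q 0 1 ^+ 6) != 0.
  apply/eqP => /(branchP q0)[k k0 br].
  have nh : nocz (hD ab).
    move=> r r0; have := gD_nocz r0; rewrite gD_eval.
    by apply: contra_neq => ->; rewrite mul0mx.
  have S x y : eval_curve (hD ab) (pt (w * x) y) = 1 *: (eval_curve (hD ab) (pt x y) *m dg w).
    by rewrite scale1r hD_rot // cube_root1.
  have T x y : eval_curve (hD ab) (pt y x) = -1 *: (eval_curve (hD ab) (pt x y) *m sw K).
    by rewrite scaleN1r hD_swap.
  have N1 : (-1 : K) != 0 by rewrite oppr_eq0 oner_eq0.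
  have [j vj] := f1_frame_zero w3 xi4 e01 e01s (M := eval_curve (hD ab) q)
    (etrans (congr1 (@f1 K) (esym (gD_eval xi e0 ab q))) f0).
  have [i /eqP nz] := branch_vertex w3 (hD_homog ab) nh (oner_neq0 _) N1 S T br
    (eps_neq0 w3 e01 j) (eps_6 w3 e01 e01s j).
  apply: nz; rewrite -!evE (eval_curve_scale _ _ (hD_homog ab)).
  by rewrite ![(_ *: _ : 'M_2) _ _]mxE mulrCA -mulrDr vj mulr0.
have [k k0 ek] := gD_det xi4 e01 e01s rab pab.
have := ek (q 0 0) (q 0 1); rewrite -pt_eta -/g dq.
move=> /esym/eqP; rewrite mulf_eq0 (mulf_eq0 k) (negPf k0) (negPf nbr) /=.
rewrite mulf_eq0 subr_eq0 eq_sym (negPf te) /= => /eqP h.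
by rewrite (pt_eta q) hm_zero h oppr0 mul0r.
Qed.

Lemma family_onto (z : 'rV[K]_2) : z != 0 ->
  exists q k, [/\ q != 0, k != 0 & eval_curve (phi_D3 K) q = k *: z].
Proof. exact: (curve_onto (@phi_D3_homog K) (@phi_D3_nocz K)). Qed.

(** Over a zero of F the sextic f1 g vanishes, hence hm does, and then
    [vertex_factor] exhibits the value of F as a nonzero sextic. *)
Lemma family_nocz : nocz F.
Proof.
move=> z z0; apply/eqP => Fz; have [q [k [q0 k0 ek]]] := family_onto z0.
have Fq : eval_curve F (eval_curve (phi_D3 K) q) = 0.
  by rewrite ek (eval_curve_scale _ _ hF) Fz scaler0.
have f0 : f1 (eval_curve g q) = 0 by rewrite eF Fq scaler0.
have hq := f1_zero_hm q0 f0.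
have dq : (\det g).@[q 0] = 0.
  by rewrite eval_curve_det Qinv_f1_eq0 // f0 -[0](scale0r 0) QinvZ expr0n mul0r.
have [|C [a [b [c [d [l [C0 ac val]]]]]]] := vertex_factor w3 xi4 e01 e01s rab pab t0 t6 te
  q0 dq hm_homog hq (Z := precomp F (phi_D3 K)).
  by move=> r; rewrite eval_precomp eF.
have := val (a + c) (b + d); rewrite eval_precomp Fq -[0](scale0r 0) sxZ mul0r mulr0.
move=> /eqP; rewrite mulf_eq0 (negPf C0) /=.
have -> : (b + d) * a - (a + c) * b = a * d - b * c by ring.
have -> : (b + d) * c - (a + c) * d = - (a * d - b * c) by ring.
by rewrite mulf_eq0 expf_eq0 oppr_eq0 (negPf ac).
Qed.

Lemma hm_neq0 : hm != 0.
Proof.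
apply: contraNneq dg0 => h0; apply/eqP/mpoly_eval0 => r.
by rewrite eval_curve_det Qinv_f1_eq0 // eF h0 meval0 QinvZ expr0n mul0r.
Qed.

(** Up to scale, the values of F at generic points are those of f1 at
    invertible matrices, and an equation that holds at generic points holds
    everywhere. *)
Lemma family_generic d (p : {mpoly K[7]}) : p \is d.-homog ->
  (forall q, eval_curve g q \in unitmx -> p.@[f1 (eval_curve g q) 0] = 0) ->
  forall z, p.@[eval_curve F z 0] = 0.
Proof.
move=> hp pz.
pose P := p \mPo (mktuple (precomp F (phi_D3 K) 0)).
have PE (q : 'rV[K]_2) : P.@[q 0] = p.@[eval_curve F (eval_curve (phi_D3 K) q) 0].
  rewrite comp_mpoly_meval -eval_precomp; apply: meval_eq => l.
  by rewrite tnth_mktuple -evE.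
have P0 : P = 0.
  apply: (mulfI (mulf_neq0 dg0 (expf_neq0 d hm_neq0))); rewrite mulr0.
  apply: mpoly_eval0 => q; rewrite !mevalM mevalXn PE eval_curve_det -mulrA.
  have [->|dq] := eqVneq (\det (eval_curve g q)) 0; first by rewrite mul0r.
  by rewrite -(mform_scale _ _ hp) -eF pz ?mulr0 // unit22.
move=> z; have [->|z0] := eqVneq z 0; last first.
  have [q [k [q0 k0 ek]]] := family_onto z0.
  have := PE q; rewrite P0 meval0 ek (eval_curve_scale _ _ hF) (mform_scale _ _ hp).
  by move=> /esym/eqP; rewrite mulf_eq0 !expf_eq0 (negPf k0) !andbF => /eqP.
case: d hp pz P P0 PE => [|d] hp pz P P0 PE.
  have [q0 u0] := generic_unit dg0.
  have cst (u v : 'rV[K]_7) : p.@[u 0] = p.@[v 0].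
    by have := mform_scale u 0 hp; have := mform_scale v 0 hp; rewrite !expr0 !mul1r !scale0r => <-.
  by rewrite -(pz q0 u0); apply: cst.
rewrite -[0 : 'rV[K]_2](scale0r 0) (eval_curve_scale _ _ hF) expr0n scale0r.
by rewrite -[0 : 'rV[K]_7](scale0r 0) (mform_scale _ _ hp) expr0n mul0r.
Qed.

Lemma family_octa z : orbit_closure (octa K) (eval_curve F z).
Proof.
move=> d p hp pz; apply: (family_generic hp) => q uq; apply: pz.
by apply: f1_orbit; rewrite -unit22.
Qed.

Definition Qpoly : {mpoly K[7]} := Qinv (\row_i 'X_i).

Lemma Qpoly_eval (z : 'rV[K]_7) : Qpoly.@[z 0] = Qinv z.
Proof.
rewrite /Qpoly -(Qinv_map (meval (z 0))); congr Qinv; apply/rowP => i.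
by rewrite [LHS]mxE [(\row_j _) 0 i]mxE; apply: mevalXU.
Qed.

Lemma Qpoly_homog : Qpoly \is 2.-homog.
Proof.
have x2 i j : zc (\row_i 'X_i : 'rV[{mpoly K[7]}]_7) i * zc (\row_i 'X_i) j \is 2.-homog.
  rewrite /zc !mxE -[2%N]/(1 + 1)%N.
  by apply: dhomogM; rewrite dhomogX; apply/eqP/mdeg1.
have x2n (m i j : nat) : m%:R * zc (\row_i 'X_i : 'rV[{mpoly K[7]}]_7) i * zc (\row_i 'X_i) j \is 2.-homog.
  by rewrite -mulrA mulr_natl rpredMn.
rewrite /Qpoly /Qinv expr2 mulrA.
by repeat first [exact: x2n | apply: rpredB | apply: rpredD].
Qed.

(** The invariant quadric contains the sextics with a quintuple root, but not
    the generic point of F, where it is a power of the determinant. *)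
Lemma family_not_boundary :
  ~ forall q, q != 0 -> orbit_closure ('X_0 ^+ 5 * 'X_1) (eval_curve F q).
Proof.
move=> h; move/eqP: dg0; apply; apply: mpoly_eval0 => q.
have [->|q0] := eqVneq q 0.
  rewrite -[0 : 'rV[K]_2](scale0r 0) (@form_scale _ 14) ?expr0n ?mul0r //.
  exact: gD_det_homog.
have := h _ (phi_D3_nocz q0) 2%N Qpoly Qpoly_homog.
rewrite Qpoly_eval => Q0.
have {}Q0 : Qinv (eval_curve F (eval_curve (phi_D3 K) q)) = 0.
  apply: Q0 => z' [a da [c c0 ->]]; rewrite Qpoly_eval QinvZ.
  have [p [r [l [m ez]]]] := act_quintuple a; rewrite ez.
  by rewrite /Qinv !zc_row7 //=; ring.
by rewrite eval_curve_det Qinv_f1_eq0 // eF QinvZ Q0 mulr0.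
Qed.

End Member.
End Family.

(** * Linear fullness *)

Section Full.
Variables (K : numClosedFieldType) (xi e0 e1 : K).
Hypotheses (xi4 : xi ^+ 4 = -1).
Hypotheses (e01 : e0 * e1 = 1) (e01s : (e0 + e1) ^+ 2 = -2).

Lemma sx_subst_unit (a b c d : K) (M : 'M[K]_7) : a * d - b * c != 0 ->
  (forall z u v, sx (z *m M) u v = sx z (a * u + b * v) (c * u + d * v)) ->
  M \in unitmx.
Proof.
move=> dt eM; set e := a * d - b * c in dt.
have [M' eM'] := sx_subst (d / e) (- b / e) (- c / e) (a / e).
have zMM (z : 'rV[K]_7) : z *m (M *m M') = z.
  apply: sx_inj => u v; rewrite mulmxA eM' eM; congr sx; rewrite /e; field; exact: dt.
suff : M *m M' = 1%:M by case/mulmx1_unit.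
by apply/row_matrixP => i; rewrite -[X in row i X = _]mul1mx row_mul zMM.
Qed.

(** Up to the factor 4, the coordinates of vt e1 t as polynomials in t. *)
Definition V1 : {poly K} := ('X ^+ 6 - 1) * ('X + e1%:P).
Definition V2 : {poly K} := (4%:R)%:P * 'X ^+ 3 * (e1%:P - 'X).
Definition V3 : {poly K} := ('X ^+ 3 - 1) ^+ 2 * (e1%:P - 'X).

Lemma V1E t : V1.[t] = (t ^+ 6 - 1) * (t + e1).
Proof. by rewrite /V1 !(hornerE, hornerXn). Qed.
Lemma V2E t : V2.[t] = 4 * t ^+ 3 * (e1 - t).
Proof. by rewrite /V2 !(hornerE, hornerXn). Qed.
Lemma V3E t : V3.[t] = (t ^+ 3 - 1) ^+ 2 * (e1 - t).
Proof. by rewrite /V3 !(hornerE, hornerXn, horner_exp). Qed.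

(** A basis of the plane orthogonal to (V1, V2, V3), with entries polynomial
    in the parameter. *)
Definition plane : 'M[{poly K}]_(2, 3) :=
  \matrix_(i, j) nth 0 (if i == 0 then [:: - V2; V1; 0] else [:: - V3; 0; V1]) j.

Definition Wmx (k : nat) : 'M[K]_(3, 2) :=
  eval_curve (Nmx K) (pt k%:R 1) *m frame xi e0.

(** Seven points of the sextic curve, those below the points [k, 1] for k =
    2, ..., 8, with coefficients polynomial in t. These points avoid the
    branch points, and lie over distinct points of the target ([qp_ratio]). *)
Definition fullmx : 'M[{poly K}]_7 :=
  \matrix_(i, j) f1 (plane *m map_mx polyC (Wmx i.+2)) 0 j.

Lemma fullmx_horner t i : row i (map_mx (horner_eval t) fullmx) =
  f1 (map_mx (horner_eval t) plane *m Wmx i.+2).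
Proof.
have -> : map_mx (horner_eval t) plane *m Wmx i.+2
    = map_mx (horner_eval t) (plane *m map_mx polyC (Wmx i.+2)).
  rewrite map_mxM; congr (_ *m _); rewrite -map_mx_comp.
  by apply/matrixP => a b; rewrite [RHS]mxE /= /horner_eval hornerC.
by rewrite -f1_map; apply/rowP => j; rewrite !mxE.
Qed.

Lemma V1e1 : V1.[e1] != 0.
Proof.
have e6 : e1 ^+ 6 != 1 by apply: (@e0_6 _ e1 e0); rewrite 1?mulrC 1?addrC.
have e10 : e1 != 0 by apply: (@e0_neq0 _ e1 e0); rewrite mulrC.
rewrite /V1 !(hornerE, hornerXn) mulf_neq0 ?subr_eq0 //.
by rewrite -mulr2n mulrn_eq0.
Qed.

Let qp k : 'rV[K]_2 := pt (- al k%:R 1 ^+ 2) (ga k%:R 1 ^+ 3).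

Lemma plane_hD t k : map_mx (horner_eval t) plane *m Wmx k =
  eval_curve (hD (map_mx (horner_eval t) plane)) (pt k%:R 1) *m frame xi e0.
Proof. by rewrite /Wmx mulmxA /hD eval_curveM eval_curve_const. Qed.

(** At t = e1 the forms V2 and V3 vanish, so that the rows of the plane
    become (0, V1, 0) and (0, 0, V1) and the matrix has rank one: its six
    linear factors coincide. *)
Lemma plane_e1 k u v : pt v (- u) *m (map_mx (horner_eval e1) plane *m Wmx k) =
  (V1.[e1] * (v * ga k%:R 1 ^+ 3 - u * al k%:R 1 ^+ 2)) *: (pt (- k%:R) 1 *m frame xi e0).
Proof.
rewrite plane_hD mulmxA scalemxAl; congr (_ *m _).
have V20 : V2.[e1] = 0 by rewrite /V2 !(hornerE, hornerXn) subrr mulr0.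
have V30 : V3.[e1] = 0 by rewrite /V3 !(hornerE, hornerXn) subrr mulr0.
set ab := map_mx _ _.
have abE i j : ab i j = (plane i j).[e1] by rewrite mxE.
have [E00 E01] := hD_eval ab k%:R 1 0; have [E10 E11] := hD_eval ab k%:R 1 1.
rewrite (mx22_eta (eval_curve _ _)) !evE E00 E01 E10 E11 !abE !mxE !inordK //=.
rewrite !hornerN V20 V30 horner0 pt_mul pt_scale.
by congr pt; ring.
Qed.

(** The scalar is the value of the invariant sextic at [- x, 1]. It is
    nonzero for integral x, since a zero would make 25 (e0 + e1)^2 x^6 = - 50
    x^6 the square of the integer x^6 + 1. *)
Lemma fullmx_e1 i : exists2 c, c != 0 &
  row i (map_mx (horner_eval e1) fullmx) = c *: eval_curve (sixth_powers K) (qp i.+2).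
Proof.
pose x : K := i.+2%:R.
exists (V1.[e1] ^+ 6 * (frame_lc xi e0 * (x ^+ 6 + 5 * (e0 + e1) * x ^+ 3 + 1))).
  apply: mulf_neq0; first exact: expf_neq0 V1e1.
  apply: mulf_neq0; first exact: frame_lc_neq0 xi4 e01.
  apply/eqP => z; have e : 5 * (e0 + e1) * x ^+ 3 = - (x ^+ 6 + 1).
    transitivity (x ^+ 6 + 5 * (e0 + e1) * x ^+ 3 + 1 - (x ^+ 6 + 1)); first by ring.
    by rewrite z sub0r.
  have : (5 * (e0 + e1) * x ^+ 3) ^+ 2 = - 50 * x ^+ 6.
    transitivity (25 * (e0 + e1) ^+ 2 * x ^+ 6); first by ring.
    by rewrite e01s; ring.
  rewrite e sqrrN => /eqP; rewrite -subr_eq0 => /eqP e'.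
  have : ((i.+2 ^ 12 + 52 * i.+2 ^ 6 + 1)%N)%:R = 0 :> K.
    by rewrite -[RHS]e' !natrD natrM !natrX -/x; ring.
  by move/eqP; rewrite pnatr_eq0 addn1.
apply: sx_inj => u v; rewrite fullmx_horner f1_octv plane_e1 octvZ.
rewrite (octv_frame xi4 e01 e01s) sxZ sixth_powers_sx /qp !pt0 !pt1 -/x; ring.
Qed.

(** Equality of the images means that k^3 and l^3 are equal or inverse to
    each other. *)
Lemma qp_ratio k l : (1 < k)%N -> (1 < l)%N ->
  - al k%:R 1 ^+ 2 / ga k%:R 1 ^+ 3 = - al l%:R 1 ^+ 2 / ga l%:R 1 ^+ 3 :> K -> k = l.
Proof.
move=> k1 l1.
have k0 : (k%:R : K) != 0 by rewrite pnatr_eq0 -lt0n ltnW.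
have l0 : (l%:R : K) != 0 by rewrite pnatr_eq0 -lt0n ltnW.
rewrite /al /ga !mulr1 !expr1n => e.
have e2 : (k%:R ^+ 3 - 1) ^+ 2 * l%:R ^+ 3 = (l%:R ^+ 3 - 1) ^+ 2 * k%:R ^+ 3 :> K.
  transitivity (- ((k%:R ^+ 3 - 1) / 2) ^+ 2 / k%:R ^+ 3 * (-4 * (k%:R ^+ 3 * l%:R ^+ 3)) : K).
    by field.
  by rewrite e; field.
have : (k%:R ^+ 3 * l%:R ^+ 3 - 1) * (k%:R ^+ 3 - l%:R ^+ 3) = 0 :> K.
  transitivity ((k%:R ^+ 3 - 1) ^+ 2 * l%:R ^+ 3 - (l%:R ^+ 3 - 1) ^+ 2 * k%:R ^+ 3 : K).
    by ring.
  by rewrite e2 subrr.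
move=> /eqP; rewrite mulf_eq0 !subr_eq0 -!natrX -natrM => /orP[].
  rewrite pnatr_eq1 muln_eq1 => /andP[/eqP h _].
  by have := ltn_expl 3 k1; rewrite h.
by rewrite eqr_nat eqn_exp2r // => /eqP.
Qed.

Lemma sixth_powers_eval (q : 'rV[K]_2) : eval_curve (sixth_powers K) q =
  row7 (q 0 0 ^+ 6) (6 * q 0 0 ^+ 5 * q 0 1) (15 * q 0 0 ^+ 4 * q 0 1 ^+ 2)
    (20 * q 0 0 ^+ 3 * q 0 1 ^+ 3) (15 * q 0 0 ^+ 2 * q 0 1 ^+ 4)
    (6 * q 0 0 * q 0 1 ^+ 5) (q 0 1 ^+ 6).
Proof. by apply: sx_inj => u v; rewrite sixth_powers_sx sx_row7; ring. Qed.

(** It suffices to specialize t to e1, where the rows are sixth powers of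
    distinct linear forms. A linear relation between the columns would be a
    polynomial of degree six with seven roots. *)
Lemma det_fullmx : \det fullmx != 0.
Proof.
apply/eqP => d0.
have : \det (map_mx (horner_eval e1) fullmx)^T == 0.
  by rewrite det_tr det_map_mx d0 /= /horner_eval horner0.
move=> /det0P[v v0 ev]; move/eqP: v0; apply.
(* The binomial coefficients of (x u + y v)^6; the coefficient of x^(6 - j)
   y^j is entry j of v, so p is the reversed polynomial. *)
pose c k := nth (0 : K) [:: 1; 6; 15; 20; 15; 6; 1] k.
pose p : {poly K} := \poly_(k < 7) (c k * v 0 (inord (6 - k))).
have root_p (i : 'I_7) : root p (- al i.+2%:R 1 ^+ 2 / ga i.+2%:R 1 ^+ 3).
  have [d dn0 ed] := fullmx_e1 i.
  have := congr1 (fun r : 'rV_7 => r 0 i) ev; rewrite [LHS]mxE [RHS]mxE.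
  have nE j : map_mx (horner_eval e1) fullmx i j =
      d * row7 ((qp i.+2 0 0) ^+ 6) (6 * (qp i.+2 0 0) ^+ 5 * (qp i.+2 0 1))
        (15 * (qp i.+2 0 0) ^+ 4 * (qp i.+2 0 1) ^+ 2)
        (20 * (qp i.+2 0 0) ^+ 3 * (qp i.+2 0 1) ^+ 3)
        (15 * (qp i.+2 0 0) ^+ 2 * (qp i.+2 0 1) ^+ 4)
        (6 * (qp i.+2 0 0) * (qp i.+2 0 1) ^+ 5) ((qp i.+2 0 1) ^+ 6) 0 j.
    have := congr1 (fun r : 'rV_7 => r 0 j) ed; rewrite [LHS]mxE [RHS]mxE => ->.
    by rewrite sixth_powers_eval.
  set x := qp _ 0 0 in nE *; set y := qp _ 0 1 in nE.
  have y0 : y != 0 by rewrite /y pt1 /ga mulr1 expf_neq0 // pnatr_eq0.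
  have -> : - al i.+2%:R 1 ^+ 2 / ga i.+2%:R 1 ^+ 3 = x / y by rewrite /x /y pt0 pt1.
  rewrite (eq_bigr (fun j : 'I_7 => d * (v 0 (inord j) * nth 0 [:: x ^+ 6;
     6 * x ^+ 5 * y; 15 * x ^+ 4 * y ^+ 2; 20 * x ^+ 3 * y ^+ 3;
     15 * x ^+ 2 * y ^+ 4; 6 * x * y ^+ 5; y ^+ 6] j))); last first.
    by move=> j _; rewrite mxE nE mxE inord_val; ring.
  rewrite -mulr_sumr => /eqP; rewrite mulf_eq0 (negPf dn0) /= => /eqP sz.
  apply/rootP/(mulIf (expf_neq0 6 y0)); rewrite mul0r -[RHS]sz horner_poly.
  rewrite !big_ord_recr !big_ord0 /= /c /=; field.
  exact: y0.
have p0 : p = 0.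
  pose rs := [seq - al (nat_of_ord i).+2%:R 1 ^+ 2 / ga (nat_of_ord i).+2%:R 1 ^+ 3 : K
    | i <- enum 'I_7].
  apply: (@roots_geq_poly_eq0 _ _ rs).
  - by apply/allP => z /mapP[i _ ->].
  - by rewrite map_inj_uniq ?enum_uniq // => i j /qp_ratio h; apply/val_inj; case: (h isT isT).
  - by rewrite size_map size_enum_ord size_poly.
apply/rowP => j; rewrite [RHS]mxE.
have : p`_(6 - j) = 0 by rewrite p0 coef0.
rewrite coef_poly ltnS leq_subr subKn; last by rewrite -ltnS.
rewrite inord_val => /eqP; rewrite mulf_eq0 => /orP[|/eqP //].
by case: j => [[|[|[|[|[|[|[|//]]]]]]] ?] /=; rewrite /c /= ?oner_eq0 ?pnatr_eq0.
Qed.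

Lemma plane_span t (ab : 'M[K]_(2, 3)) : V1.[t] != 0 -> \rank ab = 2%N ->
  ab *m (vt e1 t)^T = 0 ->
  exists2 A : 'M[K]_2, A \in unitmx & ab = A *m map_mx (horner_eval t) plane.
Proof.
move=> v10 rab pab; pose v1 := V1.[t].
pose A := mx22 (ab 0 1 / v1) (ab 0 (inord 2) / v1) (ab 1 1 / v1) (ab 1 (inord 2) / v1).
have eA : ab = A *m map_mx (horner_eval t) plane.
  have pi l : ab l 0 * V1.[t] + ab l 1 * V2.[t] + ab l (inord 2) * V3.[t] = 0.
    have := congr1 (fun M : 'M_(2, 1) => M l 0) pab.
    rewrite /= !mxE sum3 !mxE inordK //= => e.
    by rewrite -[RHS](mulr0 4) -[in RHS]e V1E V2E V3E /al /be /ga; field.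
  apply/matrixP => i j; rewrite [RHS]mxE sum2 /A.
  have -> : mx22 (ab 0 1 / v1) (ab 0 (inord 2) / v1) (ab 1 1 / v1) (ab 1 (inord 2) / v1) i 0
     = ab i 1 / v1 by move: i; apply: ord2P; rewrite mxE.
  have -> : mx22 (ab 0 1 / v1) (ab 0 (inord 2) / v1) (ab 1 1 / v1) (ab 1 (inord 2) / v1) i 1
     = ab i (inord 2) / v1 by move: i; apply: ord2P; rewrite mxE.
  apply: (mulIf v10); rewrite -/v1 mulrDl.
  rewrite mulrAC divfK // mulrAC divfK // !mxE /=.
  move: j; apply: ord3P; rewrite ?inordK //= /horner_eval ?hornerN ?horner0 ?mulr0 ?add0r ?addr0 //.
  by have /eqP := pi i; rewrite -addrA addr_eq0 => /eqP ->; ring.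
exists A => //; rewrite -row_full_unit /row_full eqn_leq rank_leq_row /=.
by rewrite -{1}rab {1}eA mxrankM_maxl.
Qed.

(** Row operations on ab act on sextics by invertible substitutions, so that
    linear relations between the values on the plane of [plane] and on the
    row space of ab correspond. *)
Lemma full_generic t (ab : 'M[K]_(2, 3)) (l : 'cV[K]_7) : V1.[t] != 0 ->
  (\det fullmx).[t] != 0 -> \rank ab = 2%N -> ab *m (vt e1 t)^T = 0 ->
  (forall q, q != 0 -> f1 (eval_curve (gD xi e0 ab) q) *m l = 0) -> l = 0.
Proof.
move=> v10 dN rab pab fl; have [A uA eA] := plane_span v10 rab pab.
have [M eM] := sx_subst (A 1 1) (- A 0 1) (- A 1 0) (A 0 0).
have uM : M \in unitmx.
  apply: sx_subst_unit eM.
  by rewrite mulrNN mulrC -det22 -unit22.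
have fM (m : 'M[K]_2) : f1 (A *m m) = f1 m *m M.
  by rewrite (f1_subst _ eM) !opprK -mx22_eta.
have uN : map_mx (horner_eval t) fullmx \in unitmx.
  by rewrite unitmxE det_map_mx unitfE.
suff : map_mx (horner_eval t) fullmx *m (M *m l) = 0.
  by move=> /(canRL (mulKmx uN)); rewrite mulmx0 => /(canRL (mulKmx uM)); rewrite mulmx0.
apply/row_matrixP => i; rewrite row_mul row0 fullmx_horner mulmxA -fM mulmxA -eA.
have q0 : pt (i.+2%:R : K) 1 != 0 by rewrite pt_eq0 oner_eq0 andbF.
have := fl _ q0; rewrite gD_eval /hD eval_curveM eval_curve_const -mulmxA.
by [].
Qed.

End Full.

(** * The family consists of Galois lifts *)

Section Lift.
Variables (K : numClosedFieldType) (w xi e0 e1 : K).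
Hypotheses (w3 : w ^+ 2 + w + 1 = 0) (xi4 : xi ^+ 4 = -1).
Hypotheses (e01 : e0 * e1 = 1) (e01s : (e0 + e1) ^+ 2 = -2).

Lemma phi_D3_holcurve : holcurve 6 (phi_D3 K).
Proof. exact: nocz_nocf (@phi_D3_homog K) (@phi_D3_nocz K). Qed.

Lemma cube_ratio (a d : K) : d != 0 -> a ^+ 3 = d ^+ 3 -> exists j, a = d * w ^+ j.
Proof.
move=> d0 e; have [|j ej] := cube_roots w3 (x := a / d).
  by rewrite exprMn exprVn e mulfV // expf_neq0.
by exists j; rewrite -ej mulrCA mulfV // mulr1.
Qed.

(** Preservation of gamma^3 up to scale means that s preserves the points 0
    and infinity as a set, and then alpha_3^2 fixes the cube of the remaining
    ratio. *)
Lemma deck_D3 s : deck (phi_D3 K) s -> exists k j, k != 0 /\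
  (s^T = k *: dg (w ^+ j) \/ s^T = k *: (sw K *m dg (w ^+ j))).
Proof.
move=> ds; have us : s^T \in unitmx by rewrite unitmx_tr; case: ds.
have [c c0 ec] := deck_eval phi_D3_holcurve ds.
move: ec us; rewrite (mx22_eta s^T).
move: (s^T 0 0) (s^T 0 1) (s^T 1 0) (s^T 1 1) => a b e f ec.
rewrite unit22 det_22 => dt.
have ev x y : (al (x * a + y * e) (x * b + y * f) ^+ 2 = c * al x y ^+ 2) /\
    (ga (x * a + y * e) (x * b + y * f) ^+ 3 = c * ga x y ^+ 3).
  have := ec (pt x y); rewrite pt_mul !phi_D3_eval pt_scale => h.
  have := congr1 (fun r : 'rV_2 => r 0 0) h; have := congr1 (fun r : 'rV_2 => r 0 1) h.
  by rewrite /= !pt0 !pt1 mulrN => -> /oppr_inj ->.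
have [A1 G1] := ev 1 0; have [A2 G2] := ev 0 1.
rewrite !mul1r !mul0r !addr0 in A1 G1; rewrite !mul1r !mul0r !add0r in A2 G2.
have ab : a * b = 0.
  move: G1; rewrite /ga mulr0 expr0n mulr0 => /eqP.
  by rewrite expf_eq0 /= => /eqP.
have ef : e * f = 0.
  move: G2; rewrite /ga mul0r expr0n mulr0 => /eqP.
  by rewrite expf_eq0 /= => /eqP.
have [_ G3] := ev 1 1; rewrite !mul1r in G3.
have [A4 _] := ev 1 1; rewrite !mul1r in A4.
have a40 : (4 : K) != 0 by rewrite pnatr_eq0.
have [a0|a0] := eqVneq a 0.
  have b0 : b != 0 by apply: contraNneq dt => b0; rewrite a0 b0 !mul0r subrr.
  have e0' : e != 0 by apply: contraNneq dt => z; rewrite a0 z mul0r mulr0 subrr.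
  have f0 : f = 0 by apply/eqP; move/eqP: ef; rewrite mulf_eq0 (negPf e0').
  move: G3; rewrite a0 f0 add0r addr0 /ga !mulr1 expr1n mulr1 exprMn => ce.
  have e3 : e ^+ 3 = b ^+ 3.
    move: A1; rewrite a0 -ce /al !expr1n expr0n /= => A1.
    apply: (mulIf (expf_neq0 3 b0)); rewrite ce.
    rewrite -ce; transitivity (4 * (e ^+ 3 * b ^+ 3 * ((1 - 0) / 2) ^+ 2)); first by field.
    by rewrite -A1; field.
  have [j ej] := cube_ratio b0 e3; exists b, j; split=> //; right.
  by rewrite ?a0 ?f0 ej /sw /dg mul22 scale22; congr mx22; ring.
have b0 : b = 0 by apply/eqP; move/eqP: ab; rewrite mulf_eq0 (negPf a0).
have f0 : f != 0 by apply: contraNneq dt => z; rewrite b0 z mul0r mulr0 subrr.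
have e0' : e = 0 by apply/eqP; move/eqP: ef; rewrite mulf_eq0 (negPf f0) orbF.
move: G3; rewrite b0 e0' add0r addr0 /ga !mulr1 expr1n mulr1 exprMn => ce.
have a3 : a ^+ 3 = f ^+ 3.
  move: A1; rewrite b0 -ce /al !expr1n expr0n /= => A1.
  apply: (mulfI (expf_neq0 3 a0)).
  transitivity (4 * ((a ^+ 3 - 0) / 2) ^+ 2); first by field.
  by rewrite A1; field.
have [j ej] := cube_ratio f0 a3; exists f, j; split=> //; left.
by rewrite ?b0 ?e0' ej /dg scale22; congr mx22; ring.
Qed.

(** The equivariance under the two generators, for all elements of the deck
    group at once. *)
Lemma hD_deck ab s : deck (phi_D3 K) s ->
  exists2 c, c != 0 & forall q, eval_curve (hD ab) (q *m s^T) =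
    c *: (eval_curve (hD ab) q *m s^T).
Proof.
move=> ds; have [k [j [k0 es]]] := deck_D3 ds.
have wj3 : (w ^+ j) ^+ 3 = 1 by rewrite -exprM mulnC exprM cube_root1 // expr1n.
case: es => ->.
  exists (k ^+ 6); first exact: expf_neq0.
  move=> q; rewrite -scalemxAr (eval_curve_scale _ _ (hD_homog ab)) {1}(pt_eta q) /dg pt_mul.
  have -> : pt (q 0 0 * w ^+ j + q 0 1 * 0) (q 0 0 * 0 + q 0 1 * 1)
     = pt (w ^+ j * q 0 0) (q 0 1) by congr pt; ring.
  by rewrite hD_rot // -pt_eta -scalemxAr scalerA -exprSr.
exists (- k ^+ 6); first by rewrite oppr_eq0 expf_neq0.
move=> q; rewrite -scalemxAr (eval_curve_scale _ _ (hD_homog ab)) {1}(pt_eta q) mulmxA /sw pt_mul /dg pt_mul.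
have -> : pt ((q 0 0 * 0 + q 0 1 * 1) * w ^+ j + (q 0 0 * 1 + q 0 1 * 0) * 0)
      ((q 0 0 * 0 + q 0 1 * 1) * 0 + (q 0 0 * 1 + q 0 1 * 0) * 1)
   = pt (w ^+ j * q 0 1) (q 0 0) by congr pt; ring.
rewrite hD_rot // hD_swap -pt_eta -scalemxAr scalerA mulNr -exprSr mulNmx scalerN scaleNr.
by rewrite mulmxA.
Qed.

Lemma octv_deck s : deck (phi_D3 K) s -> exists l, forall r,
  octv (r *m s^T *m frame xi e0) = l * octv (r *m frame xi e0).
Proof.
move=> ds; have [k [j [k0 es]]] := deck_D3 ds; exists (k ^+ 6) => r.
have wj3 : (w ^+ j) ^+ 3 = 1 by rewrite -exprM mulnC exprM cube_root1 // expr1n.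
have wj6 : (w ^+ j) ^+ 6 = 1 by rewrite -[6%N]/(3 * 2)%N exprM wj3 expr1n.
have oF := octv_frame xi4 e01 e01s.
case: es => ->; rewrite -scalemxAr -scalemxAl octvZ; congr (_ * _).
  rewrite {1}(pt_eta r) /dg [pt _ _ *m mx22 (w ^+ j) _ _ _]pt_mul [in RHS](pt_eta r) !oF.
  rewrite !mulr0 addr0 add0r mulr1 !exprMn wj3 wj6; ring.
rewrite {1}(pt_eta r) mulmxA /sw [pt _ _ *m mx22 0 1 1 0]pt_mul /dg.
rewrite [pt _ _ *m mx22 (w ^+ j) _ _ _]pt_mul [in RHS](pt_eta r) !oF.
rewrite !mulr0 !addr0 !add0r !mulr1 !exprMn wj3 wj6; ring.
Qed.

(** The monodromy of gD ab is the contragredient of the deck transformation,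
    conjugated by the frame; the square root normalizes the determinant to
    one. *)
Definition lift_rho (s : 'M[K]_2) : 'M[K]_2 :=
  sqrtC (\det s) *: (invmx (frame xi e0) *m invmx s^T *m frame xi e0).

Let P := frame xi e0.
Let uP : P \in unitmx. Proof. exact: frame_unit xi4 e01 e01s. Qed.

Let conj_inv (M : 'M[K]_2) : M \in unitmx ->
  (invmx P *m M *m P) *m (invmx P *m invmx M *m P) = 1%:M.
Proof. by move=> uM; rewrite !mulmxA mulmxK // mulmxK // mulVmx. Qed.

Lemma lift_rho_stab s : deck (phi_D3 K) s -> octa_stab (lift_rho s).
Proof.
move=> ds; have us : s^T \in unitmx by rewrite unitmx_tr; case: ds.
have ds0 : \det s != 0 by rewrite -det_tr -unit22.
have q0 : sqrtC (\det s) != 0 by rewrite sqrtC_eq0.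
have dP : \det P != 0 by rewrite -unit22.
apply: octa_inv_stab.
  rewrite detZ sqrtCK !det_mulmx !det_inv det_tr -/P.
  by field; rewrite ds0 dP.
apply: octa_inv_scale => //.
have -> : invmx (frame xi e0) *m invmx s^T *m frame xi e0 = invmx (invmx P *m s^T *m P).
  by rewrite -[RHS]mulmx1 -(conj_inv us) mulKmx // !unitmx_mul unitmx_inv uP us.
apply: octa_inv_V; split; first by rewrite !unitmx_mul unitmx_inv uP us.
have [l el] := octv_deck ds; exists l => r.
by have := el (r *m invmx P); rewrite -/P !mulmxA mulmxKV.
Qed.

Lemma lift_rho_monodromy ab s : deck (phi_D3 K) s ->
  monodromy (gD xi e0 ab) s (lift_rho s).
Proof.
move=> ds; have us : s^T \in unitmx by rewrite unitmx_tr; case: ds.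
have ds0 : \det s != 0 by rewrite -det_tr -unit22.
have q0 : sqrtC (\det s) != 0 by rewrite sqrtC_eq0.
have [c c0 ec] := hD_deck ab ds => q; set A := eval_curve _ q; set B := eval_curve _ _ => uA uB.
have eB : B = c *: (A *m (invmx P *m s^T *m P)).
  by rewrite /B /A !gD_eval ec -/P !mulmxA mulmxK // -!scalemxAl.
exists (c * sqrtC (\det s))^-1; first by rewrite invr_eq0 mulf_neq0.
have eA : A = B *m ((c * sqrtC (\det s))^-1 *: lift_rho s).
  rewrite eB /lift_rho scalerA invfM -mulrA mulVf // mulr1 -/P -scalemxAr -scalemxAl.
  by rewrite scalerA mulVf // scale1r -[A *m _ *m _]mulmxA conj_inv // mulmx1.
by rewrite {1}eA mulKmx.
Qed.

Lemma lift_rho_mul s s' : deck (phi_D3 K) s -> deck (phi_D3 K) s' ->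
  proj_eq (lift_rho (s *m s')) (lift_rho s *m lift_rho s').
Proof.
move=> [us _] [us' _].
have q0 : sqrtC (\det s) != 0 by rewrite sqrtC_eq0 -unit22.
have q0' : sqrtC (\det s') != 0 by rewrite sqrtC_eq0 -unit22.
have q1 : sqrtC (\det (s *m s')) != 0 by rewrite sqrtC_eq0 -unit22 unitmx_mul us.
exists (sqrtC (\det (s *m s')) / (sqrtC (\det s) * sqrtC (\det s'))).
  by rewrite !mulf_neq0 ?invr_eq0 ?mulf_neq0.
have us1 : s^T \in unitmx by rewrite unitmx_tr.
have us1' : s'^T \in unitmx by rewrite unitmx_tr.
have eV : invmx (s *m s')^T = invmx s^T *m invmx s'^T.
  have e : (s *m s')^T *m (invmx s^T *m invmx s'^T) = 1%:M.
    by rewrite trmx_mul !mulmxA mulmxK // mulmxV.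
  by rewrite -[LHS]mulmx1 -e mulKmx // unitmx_tr unitmx_mul us.
rewrite /lift_rho -/P eV -!scalemxAl -!scalemxAr !scalerA !mulmxA mulmxK //.
by congr (_ *: _); field; rewrite q0 q0'.
Qed.

Lemma lift_rho_inj s s' : deck (phi_D3 K) s -> deck (phi_D3 K) s' ->
  proj_eq (lift_rho s) (lift_rho s') -> proj_eq s s'.
Proof.
move=> [us _] [us' _] [c c0 e].
have q0 : sqrtC (\det s) != 0 by rewrite sqrtC_eq0 -unit22.
have q0' : sqrtC (\det s') != 0 by rewrite sqrtC_eq0 -unit22.
have ut : s^T \in unitmx by rewrite unitmx_tr.
have ut' : s'^T \in unitmx by rewrite unitmx_tr.
pose d := (sqrtC (\det s))^-1 * c * sqrtC (\det s').
have d0 : d != 0 by rewrite !mulf_neq0 ?invr_eq0.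
have e' : invmx s^T = d *: invmx s'^T.
  have : P *m lift_rho s *m invmx P = c *: (P *m lift_rho s' *m invmx P).
    by rewrite e -scalemxAr -scalemxAl.
  rewrite /lift_rho -/P -!scalemxAr -!scalemxAl !mulmxA mulmxV // !mul1mx !mulmxK // => h.
  apply: (scalerI q0); rewrite h !scalerA; congr (_ *: _).
  by rewrite /d !mulrA mulfV // mul1r.
exists d^-1; first by rewrite invr_eq0.
apply: trmx_inj; rewrite linearZ /= -[s^T]invmxK e' invmxZ ?invmxK //.
by rewrite unitmxZ ?unitfE ?unitmx_inv.
Qed.

(** * Coincidences in the family *)

Lemma form_zeros n (f : {mpoly K[2]}) : f \is n.-homog -> f != 0 ->
  exists Z : seq 'rV[K]_2, forall q : 'rV[K]_2, q != 0 -> f.@[q 0] = 0 ->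
    exists z k, [/\ z \in Z, k != 0 & q = k *: z].
Proof.
elim: n f => [|n IH] f hf f0.
  exists [::] => q q0 fq; have [c ec] := form_const hf.
  by move/eqP: f0; case; move: fq; rewrite ec mevalC => ->; rewrite mpolyC0.
have [z z0 fz] := form_zero hf; have [h hh eh] := form_factor z0 hf fz.
have h0 : h != 0 by apply: contraNneq f0 => h0; rewrite eh h0 mulr0.
have [Z hZ] := IH h hh h0; exists (z :: Z) => q q0.
rewrite eh mevalM => /eqP; rewrite mulf_eq0 => /orP[] /eqP e.
  have [k ek] := lin_eval_eq0 z0 e; exists z, k; rewrite inE eqxx; split=> //.
  by apply: contra_neq q0 => k0; rewrite ek k0 scale0r.
have [z' [k [z'Z k0 ek]]] := hZ q q0 e; exists z', k.
by rewrite inE z'Z orbT.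
Qed.

Definition bracket (p q : 'rV[K]_2) : K := p 0 0 * q 0 1 - p 0 1 * q 0 0.

Lemma bracket_mul p q (M : 'M[K]_2) : bracket (p *m M) (q *m M) = \det M * bracket p q.
Proof. by rewrite /bracket det22 !mxE !sum2; ring. Qed.

Lemma bracketZ a b p q : bracket (a *: p) (b *: q) = a * b * bracket p q.
Proof. by rewrite /bracket !mxE; ring. Qed.

Definition cross_ratio (p : 'rV[K]_2 * 'rV[K]_2 * 'rV[K]_2 * 'rV[K]_2) : K :=
  let: (z0, z1, z2, z3) := p in
  bracket z3 z1 * bracket z0 z2 / (bracket z0 z3 * bracket z2 z1).

(** If zero, infinity, one and t' are zeros of a form f' that is projectively
    equivalent to f, then t' is a cross ratio of zeros of f. *)
Lemma cross_ratio_fibre n (f : {mpoly K[2]}) : f \is n.-homog -> f != 0 ->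
  exists T : seq K, forall t' (f' : {mpoly K[2]}) (M : 'M[K]_2), M \in unitmx ->
    (forall q : 'rV[K]_2, f'.@[(q *m M) 0] = 0 -> f.@[q 0] = 0) ->
    f'.@[pt 1 0 0] = 0 -> f'.@[pt 0 1 0] = 0 -> f'.@[pt 1 1 0] = 0 ->
    f'.@[pt t' 1 0] = 0 -> t' \in T.
Proof.
move=> hf f0; have [Z hZ] := form_zeros hf f0.
exists [seq cross_ratio p | p <- [seq (q, d) | q <- [seq (q, c) | q <- [seq (a, b)
   | a <- Z, b <- Z], c <- Z], d <- Z]].
move=> t' f' M uM eD r0 r1 r2 r3.
have zer x y : pt x y != 0 -> f'.@[pt x y 0] = 0 ->
    exists z l, [/\ z \in Z, l != 0 & pt x y *m invmx M = l *: z].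
  move=> p0 d0; apply: hZ; last by apply: eD; rewrite mulmxKV.
  by apply: contra_neq p0 => z; rewrite -[pt x y](mulmxKV uM) z mul0mx.
have nz x : pt x 1 != 0 :> 'rV[K]_2 by rewrite pt_eq0 oner_eq0 andbF.
have nz1 : pt 1 0 != 0 :> 'rV[K]_2 by rewrite pt_eq0 oner_eq0.
have [z0 [l0 [Z0 l00 E0]]] := zer _ _ nz1 r0.
have [z1 [l1 [Z1 l10 E1]]] := zer _ _ (nz 0) r1.
have [z2 [l2 [Z2 l20 E2]]] := zer _ _ (nz 1) r2.
have [z3 [l3 [Z3 l30 E3]]] := zer _ _ (nz t') r3.
have dM : \det (invmx M) != 0 by rewrite -unit22 unitmx_inv.
have br p q a b z z' : a != 0 -> b != 0 -> p *m invmx M = a *: z -> q *m invmx M = b *: z' ->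
    bracket z z' = \det (invmx M) * bracket p q / (a * b).
  move=> a0 b0 ep eq; rewrite -bracket_mul ep eq bracketZ [_ * bracket z z']mulrC mulfK //.
  by rewrite mulf_neq0.
have -> : t' = cross_ratio (z0, z1, z2, z3).
  rewrite /cross_ratio (br _ _ _ _ _ _ l30 l10 E3 E1) (br _ _ _ _ _ _ l00 l20 E0 E2).
  rewrite (br _ _ _ _ _ _ l00 l30 E0 E3) (br _ _ _ _ _ _ l20 l10 E2 E1).
  by rewrite /bracket !pt0 !pt1; field; rewrite l00 l10 l20 l30 dM.
apply: map_f; apply/allpairsP; exists ((z0, z1, z2), z3); split=> //.
apply/allpairsP; exists ((z0, z1), z2); split=> //.
by apply/allpairsP; exists (z0, z1).
Qed.

(** By [gD_det] the determinant has zeros 0, infinity, 1 and the parameter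
    itself. *)
Lemma family_fibre t : t != 0 -> t ^+ 6 != 1 -> t != e1 ->
  exists T : seq K, forall t' (ab ab' : 'M[K]_(2, 3)) (M : 'M[K]_2) (k : K),
    \rank ab = 2%N -> ab *m (vt e1 t)^T = 0 ->
    \rank ab' = 2%N -> ab' *m (vt e1 t')^T = 0 ->
    M \in unitmx -> k != 0 ->
    (forall q : 'rV[K]_2, (\det (gD xi e0 ab')).@[(q *m M) 0] = k * (\det (gD xi e0 ab)).@[q 0]) ->
    t' \in T.
Proof.
move=> t0 t6 te.
case: (classic (exists ab : 'M[K]_(2, 3), \rank ab = 2%N /\ ab *m (vt e1 t)^T = 0)); last first.
  by move=> h; exists [::] => t' ab ab' M k rab pab; case: h; exists ab.
move=> [ab0 [rab0 pab0]].
have D0 := gD_det_neq0 xi4 e01 e01s rab0 pab0 te.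
have [T hT] := cross_ratio_fibre (gD_det_homog xi e0 ab0) D0.
have [k0 k00 ek0] := gD_det xi4 e01 e01s rab0 pab0.
exists T => t' ab ab' M k rab pab rab' pab' uM kn0 eD.
have [k1 k10 ek1] := gD_det xi4 e01 e01s rab pab.
have [k2 k20 ek2] := gD_det xi4 e01 e01s rab' pab'.
apply: (hT t' (\det (gD xi e0 ab')) M uM).
- move=> q; rewrite (eD q) => /eqP; rewrite mulf_eq0 (negPf kn0) /= => /eqP z.
  have E1 := ek1 (q 0 0) (q 0 1); have E0 := ek0 (q 0 0) (q 0 1).
  rewrite -pt_eta in E1; rewrite -pt_eta in E0.
  move: (etrans (esym E1) z) => /eqP.
  rewrite -!mulrA (mulf_eq0 k1) (negPf k10) /= => /eqP e.
  by rewrite [LHS]E0 -!mulrA e mulr0.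
- by rewrite [LHS]ek2; ring.
- by rewrite [LHS]ek2; ring.
- by rewrite [LHS]ek2; ring.
by rewrite [LHS]ek2; ring.
Qed.

Lemma poly_roots_seq (p : {poly K}) : p != 0 ->
  exists E : seq K, forall t, t \notin E -> p.[t] != 0.
Proof.
move=> p0; have [r er] := closed_field_poly_normal p; exists r => t.
apply: contraNneq; rewrite er hornerZ => /eqP; rewrite mulf_eq0 lead_coef_eq0 (negPf p0) /=.
by rewrite -[_ == 0]/(root _ t) root_prod_XsubC.
Qed.

(** The exceptional parameters are the roots of one polynomial: they make the
    determinant degenerate, or the seven points of [fullmx] dependent. *)
Lemma family_generic_lift : exists E : seq K, forall t, t \notin E ->
  [/\ t != 0, t ^+ 6 != 1, t != e1 &
  forall ab : 'M[K]_(2, 3), \rank ab = 2%N -> ab *m (vt e1 t)^T = 0 ->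
   exists F, [/\ sextic_curve F, galois_lift (phi_D3 K) F 7 (gD xi e0 ab)
     & exceptional_transversal F]].
Proof.
pose p := 'X * ('X ^+ 6 - 1) * ('X - e1%:P) * V1 e1 * \det (fullmx xi e0 e1).
have V10 : V1 e1 != 0.
  by apply: contraTneq (V1e1 e01 e01s) => ->; rewrite horner0 eqxx.
have p0 : p != 0.
  rewrite mulf_neq0 ?(det_fullmx xi4 e01 e01s) //; apply: mulf_neq0 => //.
  rewrite !mulf_neq0 ?polyX_eq0 ?polyXsubC_eq0 //.
  by rewrite -size_poly_eq0 size_Xn_sub_1.
have [E hE] := poly_roots_seq p0; exists E => t /hE.
rewrite /p !hornerM !hornerXsubC hornerX !mulf_eq0 !negb_or.
move=> /andP[/andP[/andP[/andP[t0 t6] te] v1] dN].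
have {}t6 : t ^+ 6 != 1.
  by apply: contraNneq t6 => e; rewrite hornerD hornerN hornerXn hornerC e subrr.
have {}te : t != e1 by rewrite -subr_eq0.
have {}v1 : (V1 e1).[t] != 0 by rewrite hornerM mulf_eq0 negb_or.
split=> // ab rab pab.
have [F hF eF] := family_sextic w3 xi4 e01 e01s pab.
have nF := family_nocz w3 xi4 e01 e01s rab pab t0 t6 te hF eF.
have nphi := @phi_D3_nocz K.
exists F; split.
- split.
  + exact: nocz_nocf hF nF.
  + by move=> q _; apply: (family_octa xi4 e01 e01s rab pab te hF eF).
  + move=> l hl; apply: (full_generic v1 dN rab pab) => q q0.
    by rewrite eF -scalemxAl hl ?scaler0 // nphi.
  exact: (family_not_boundary xi4 e01 e01s rab pab te eF).
- split.
  + apply: nocz_nocf (gD_homog xi e0 ab) _.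
    exact: (gD_nocz xi4 e01 e01s rab pab t0 t6 te).
  + exists 1, (hm t); split; rewrite ?oner_eq0 //.
      exact: (hm_neq0 xi4 e01 e01s rab pab te eF).
    apply: eval_curve_inj => q; rewrite !eval_curveZ mevalC scale1r eval_f1 eF.
    by rewrite eval_precomp.
  + exact: (gD_det_neq0 xi4 e01 e01s rab pab te).
  exists lift_rho; split.
  + by move=> s ds; split; [apply: lift_rho_stab|apply: lift_rho_monodromy].
  + by move=> s s' ds ds'; apply: lift_rho_mul ds ds'.
  by move=> s s' ds ds'; apply: lift_rho_inj ds ds'.
apply: (@not_ramified K w xi e0 e1 w3 xi4 e01 e01s t ab rab pab t0 t6 te 1%:M (phi_D3 K) F 6 (hm t)) => //.
- exact: unitmx1.
- by move=> r; rewrite trmx1 mulmx1.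
- exact: phi_D3_homog.
exact: hm_homog.
Qed.

End Lift.

(** * The constants *)

Section Radicals.
Variables (F : numFieldType) (i x s : F).
Hypotheses (i2 : i ^+ 2 = -1) (x2 : x ^+ 2 = i) (s2 : s ^+ 2 = 3).

Lemma radical_neq0 : [/\ i != 0, x != 0, 1 - s != 0 & 1 + s != 0].
Proof.
have n2 : (2 : F) != 0 by rewrite pnatr_eq0.
have i0 : i != 0.
  by apply: contraTneq (oner_neq0 F) => z; move: i2; rewrite z expr0n => /eqP; rewrite eq_sym oppr_eq0 => ->.
have e : (1 - s) * (1 + s) = - 2.
  by transitivity (1 - s ^+ 2); [ring|rewrite s2; ring].
have : (1 - s) * (1 + s) != 0 by rewrite e oppr_eq0.
rewrite mulf_eq0 negb_or => /andP[? ?]; split=> //.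
by apply: contraNneq i0 => z; rewrite -x2 z expr0n.
Qed.

Lemma radical_mul : (-1 + i) / (1 - s) / x * ((-1 + i) / (1 + s) / x) = 1.
Proof.
have [i0 x0 m0 p0] := radical_neq0; have n2 : (2 : F) != 0 by rewrite pnatr_eq0.
transitivity ((-1 + i) ^+ 2 / ((1 - s ^+ 2) * x ^+ 2)).
  field; rewrite x0 m0 p0 /=.
  have -> : 1 - s ^+ 2 = (1 - s) * (1 + s) by ring.
  by rewrite mulf_neq0.
rewrite s2 x2; have -> : (-1 + i) ^+ 2 = -2 * i by ring: i2.
have -> : 1 - 3 = - 2 :> F by ring.
by rewrite divff // mulf_neq0 ?oppr_eq0.
Qed.

Lemma radical_sum : ((-1 + i) / (1 - s) / x + (-1 + i) / (1 + s) / x) ^+ 2 = -2.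
Proof.
have [i0 x0 m0 p0] := radical_neq0; have n2 : (2 : F) != 0 by rewrite pnatr_eq0.
transitivity ((2 * (-1 + i)) ^+ 2 / ((1 - s ^+ 2) ^+ 2 * x ^+ 2)).
  field; rewrite x0 m0 p0 /=.
  have -> : 1 - s ^+ 2 = (1 - s) * (1 + s) by ring.
  by rewrite mulf_neq0.
rewrite s2 x2; have -> : (2 * (-1 + i)) ^+ 2 = -8 * i by ring: i2.
have -> : 1 - 3 = - 2 :> F by ring.
have -> : -8 * i = - 2 * ((- 2) ^+ 2 * i) by ring.
by rewrite mulfK // mulf_neq0 ?expf_neq0 ?oppr_eq0.
Qed.

Lemma radical_cube_root : ((-1 + i * s) / 2) ^+ 2 + (-1 + i * s) / 2 + 1 = 0.
Proof.
have n2 : (2 : F) != 0 by rewrite pnatr_eq0.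
transitivity ((3 + i ^+ 2 * s ^+ 2) / 4); first by field.
by rewrite i2 s2; field.
Qed.

End Radicals.

Section Constants.
Variable R : realType.
Local Notation K := (R[i] : numClosedFieldType).

Lemma expiD (a b : R) : expi (a + b) = expi a * expi b.
Proof.
rewrite /expi; simpc; rewrite trigo.cosD trigo.sinD; congr (_ +i* _)%C.
by rewrite addrC [trigo.cos _ * _]mulrC.
Qed.

Lemma xi1_sq : xi1 R ^+ 2 = 'i%C.
Proof.
rewrite expr2 /xi1 -expiD.
have -> : trigo.pi / 4 + trigo.pi / 4 = trigo.pi / 2 :> R by field.
by rewrite /expi trigo.cos_pihalf trigo.sin_pihalf.
Qed.

Lemma xi1_4 : xi1 R ^+ 4 = -1.
Proof. by rewrite -[4%N]/(2 * 2)%N exprM xi1_sq sqr_i. Qed.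

Lemma sqrt3_sq : (Num.sqrt 3 : R)%:C%C ^+ 2 = 3 :> R[i].
Proof. by rewrite -rmorphXn /= sqr_sqrtr // rmorph_nat. Qed.

Definition eps0 : R[i] := nu1 R / xi1 R.
Definition eps1 : R[i] := nu2 R / xi1 R.
Definition omega : R[i] := (-1 + 'i%C * (Num.sqrt 3 : R)%:C%C) / 2.

Lemma eps01 : eps0 * eps1 = 1.
Proof. exact: radical_mul (sqr_i R) xi1_sq sqrt3_sq. Qed.

Lemma eps01s : (eps0 + eps1) ^+ 2 = -2.
Proof. exact: radical_sum (sqr_i R) xi1_sq sqrt3_sq. Qed.

Lemma omega3 : omega ^+ 2 + omega + 1 = 0.
Proof. exact: radical_cube_root (sqr_i R) sqrt3_sq. Qed.

Lemma nu1E : nu1 R = eps0 * xi1 R.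
Proof. by rewrite /eps0 divfK // (xi_neq0 xi1_4). Qed.

(** Entry by entry, this amounts to nu1 = e0 xi and nu1 e1 = xi. *)
Lemma base_frame : (base_mx R)^T =
  Nmx R[i] *m map_mx (@mpolyC 2 R[i]) (frame (xi1 R) eps0).
Proof.
have e1E : nu1 R * eps1 = xi1 R by rewrite nu1E mulrAC eps01 mul1r.
rewrite /base_mx /base_row /Nmx -/eps0 -/eps1.
move: (alpha3 _) (beta3 _) (gamma _) => A B G.
apply/matrixP => i j; rewrite [LHS]mxE [RHS]mxE sum2; apply: mpoly_eval_inj => q.
rewrite ![map_mx _ _ _ _]mxE ![(\matrix_(_, _) _) i _]mxE.
move: j; apply: ord2P; rewrite !mxE /=.
  move: i; apply: ord3P; rewrite ?inordK //=; mev; ring.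
rewrite -nu1E -[xi1 R]e1E; move: (nu1 R) eps0 eps1 eps01 => n a b ab.
by move: i; apply: ord3P; rewrite ?inordK //=; mev; ring: ab.
Qed.

Lemma g_D3E ab : g_D3 ab = gD (xi1 R) eps0 ab.
Proof. by rewrite /g_D3 base_frame mulmxA. Qed.

Lemma perp_planeE t ab : perp_plane t ab <-> \rank ab = 2%N /\ ab *m (vt eps1 t)^T = 0.
Proof.
have n0 : nu1 R != 0 by rewrite nu1E mulf_neq0 ?(e0_neq0 eps01) ?(xi_neq0 xi1_4).
rewrite /perp_plane; set v := eval_curve _ _.
have -> : v = nu1 R *: vt eps1 t.
  rewrite /v -/(pt t 1); apply/rowP => i; rewrite evE [RHS]mxE !mxE /=.
  by move: i; rewrite -/eps1; apply: ord3P; rewrite ?inordK //=; mev;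
    rewrite ?alpha3_eval ?beta3_eval ?gamma_eval ?pt0 ?pt1; ring.
split=> -[-> e]; split=> //.
  by apply: (scalerI n0); rewrite scaler0 -[RHS]e linearZ /= -scalemxAr.
by rewrite linearZ /= -scalemxAr e scaler0.
Qed.

Lemma expiN (a : R) : expi a * expi (- a) = 1.
Proof. by rewrite -expiD subrr /expi trigo.cos0 trigo.sin0. Qed.

(** The group acts on the right by transposed matrices, so it is the
    transposed generators that are matched with [octa_inv_gen]. *)
Lemma S4star_octa (M : 'M[R[i]]_2) : octa_inv M ->
  exists2 c, c != 0 & S4star (c *: M)^T.
Proof.
pose k : R[i] := ((Num.sqrt 2 : R)^-1)%:C%C.
have k2 : k ^+ 2 * 2 = 1.
  rewrite /k -rmorphXn /= exprVn sqr_sqrtr // -[2 in X in _ * X](rmorph_nat (real_complex R)) -rmorphM /=.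
  by rewrite mulVf ?pnatr_eq0.
have k0 : k != 0.
  by apply: contraTneq (oner_neq0 R[i]) => z; rewrite -k2 z expr0n mul0r eqxx.
have x0 := xi_neq0 xi1_4.
apply: (@octa_inv_gen R[i] (xi1 R) k (fun M => S4star M^T) xi1_4 k0).
- have -> : (mx22 (xi1 R) 0 0 (xi1 R)^-1)^T = \matrix_(i, j) if i == j then
              (if i == 0 then expi (trigo.pi / 4) else expi (- (trigo.pi / 4))) else 0.
    have -> : (xi1 R)^-1 = expi (- (trigo.pi / 4)).
      by apply: (mulfI x0); rewrite mulfV // expiN.
    by apply: mx2P; rewrite !mxE.
  exact: S4star_diag.
- pose E : 'M[R[i]]_2 := k *: \matrix_(i, j) if (i == 0) && (j == 1) then -1 else 1.
  have -> : (k *: mx22 1 (-1) 1 1)^T = invmx E.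
    have eE : E = k *: mx22 1 (-1) 1 1 by congr (_ *: _); apply: mx2P; rewrite !mxE.
    have eT : (k *: mx22 1 (-1) 1 1)^T = k *: mx22 1 1 (-1) 1 by apply: mx2P; rewrite !mxE.
    have e : E *m (k *: mx22 1 1 (-1) 1) = 1%:M.
      by rewrite eE !scale22 mul22 one22; congr mx22; ring: k2.
    have [uE _] := mulmx1_unit e.
    by rewrite eT -[RHS]mulmx1 -e mulKmx.
  exact/S4star_inv/S4star_rot.
- by rewrite trmx1; apply: S4star_one.
- by move=> A B sA sB; rewrite trmx_mul; apply: S4star_mul.
by move=> A sA; rewrite trmx_inv; apply: S4star_inv.
Qed.

Lemma psl2_equiv_family (g : 'M[{mpoly R[i][2]}]_2) (Q C : 'M[R[i]]_2) ab : octa_inv C ->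
  (forall q, eval_curve g (q *m Q) = eval_curve (g_D3 ab) q *m C) ->
  psl2_equiv (precomp g (mobius Q^T)) (g_D3 ab).
Proof.
move=> oC eg; have [c c0 Sb] := S4star_octa (octa_inv_V oC); have [uC _] := oC.
exists 1%:M, (c *: invmx C)^T; split=> //; first by rewrite det1.
move: (g_D3 ab) eg => d eg.
exists 1, c%:MP; split; [exact: oner_neq0|by rewrite mpolyC_eq0|rewrite scale1r].
apply: eval_curve_inj => q; rewrite !eval_curveM eval_curve_tr !eval_curve_const trmxK mul1mx.
rewrite eval_precomp_mobius trmxK eg eval_curveZ mevalC -scalemxAr -mulmxA mulmxV //.
by rewrite mulmx1.
Qed.

(** Multiplication by constant matrices and a change of the source variable
    preserve the determinant up to scale. *)
Lemma psl2_equiv_det (g g' : 'M[{mpoly R[i][2]}]_2) (mu : 'M[R[i]]_2) n :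
  (forall i j, g i j \is n.-homog) -> (forall i j, g' i j \is n.-homog) ->
  nocz g -> \det g != 0 -> psl2_equiv (precomp g' (mobius mu)) g ->
  exists2 k, k != 0 & forall q : 'rV[R[i]]_2,
    (\det g').@[(q *m mu^T) 0] = k * (\det g).@[q 0].
Proof.
move=> hg hg' ng d0 [a [b [da _ rm]]].
have h1 : forall i j, (map_mx (@mpolyC 2 R[i]) a *m precomp g' (mobius mu)
    *m (map_mx (@mpolyC 2 R[i]) b)^T) i j \is n.-homog.
  rewrite map_trmx; apply: mul_const_homog => i j; rewrite mxE; apply: rpred_sum => l _.
  by rewrite [map_mx _ a _ _]mxE mul_mpolyC rpredZ // precomp_mobius_homog.
have [c c0 ec] := ratmap_homog_eq h1 hg ng rm.
have ev (q : 'rV[R[i]]_2) : (\det g').@[(q *m mu^T) 0] * \det b = c ^+ 2 * (\det g).@[q 0].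
  have := congr1 (fun m => \det (eval_curve m q)) ec => /=.
  rewrite !eval_curveM eval_curve_tr !eval_curve_const eval_curveZ mevalC !det_mulmx da mul1r.
  by rewrite det_tr detZ eval_precomp_mobius -!eval_curve_det.
have b0 : \det b != 0.
  apply: contraNneq d0 => z; apply/eqP/mpoly_eval0 => q; have := ev q.
  by rewrite z mulr0 => /esym/eqP; rewrite mulf_eq0 expf_eq0 (negPf c0) => /eqP.
exists (c ^+ 2 / \det b); first by rewrite mulf_neq0 ?invr_eq0 ?expf_neq0.
by move=> q; apply: (mulIf b0); rewrite ev [RHS]mulrAC divfK.
Qed.

End Constants.

Theorem theorem9p1 (R : realType) :
  (forall phi : 'rV[{mpoly R[i][2]}]_2,
    galois_covering 6 phi ->
    deck_group_isog 'D_6 phi ->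
    (exists mu nu : 'M[R[i]]_2,
      [/\ mu \in unitmx, nu \in unitmx
        & ratmap_eq (precomp (mobius nu) (precomp phi (mobius mu)))
                    (phi_D3 R[i])])
    /\
    (forall (F : 'rV[{mpoly R[i][2]}]_7) (n : nat) (g : 'M[{mpoly R[i][2]}]_2),
      sextic_curve F ->
      galois_lift phi F n g ->
      [/\ n = 7%N,
          exists (mu nu : 'M[R[i]]_2) (t : R[i]) (ab : 'M[R[i]]_(2, 3)),
            [/\ mu \in unitmx /\ nu \in unitmx,
                ratmap_eq (precomp (mobius nu) (precomp phi (mobius mu)))
                          (phi_D3 R[i]),
                the_perp_plane t ab
              & psl2_equiv (precomp g (mobius mu)) (g_D3 ab)]
        & exceptional_transversal F]))
  /\
  (exists E : seq R[i], forall t : R[i], t \notin E ->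
    (forall ab : 'M[R[i]]_(2, 3), perp_plane t ab ->
      exists F : 'rV[{mpoly R[i][2]}]_7,
        [/\ sextic_curve F, galois_lift (phi_D3 R[i]) F 7 (g_D3 ab)
          & exceptional_transversal F])
    /\
    (exists T : seq R[i], forall (t' : R[i]) (ab ab' : 'M[R[i]]_(2, 3)),
      perp_plane t ab -> perp_plane t' ab' ->
      (exists2 mu : 'M[R[i]]_2, mu \in unitmx
         & psl2_equiv (precomp (g_D3 ab') (mobius mu)) (g_D3 ab)) ->
      t' \in T)).
Proof.
have w3 := omega3 R; have x4 := xi1_4 R; have e01 := eps01 R; have e01s := eps01s R.
split.
  move=> phi [hp _] dg; have [S [T [dS dT pST]]] := deck_dihedral_pair dg; split.
    have [Q ad] := D3_adapted w3 (D3_pair_tr pST); have [uQ _ _] := ad.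
    have [nu unu enu] := covering_adapted w3 hp dS dT ad.
    exists Q^T, (invmx nu); rewrite unitmx_tr unitmx_inv; split=> //.
    exact: covering_ratmap.
  move=> F n g [hF _ _ _] gl.
  have [n7 [Q [nu [t [ab [C [uQ [unu enu] [rab pab] [oC eg] ex]]]]]]] :=
    lift_normal_form w3 x4 e01 e01s hp hF dS dT pST gl.
  split=> //; exists Q^T, (invmx nu), t, ab; rewrite unitmx_tr unitmx_inv; split=> //.
  - exact: covering_ratmap.
  - split; first exact/perp_planeE.
    move=> ab' /perp_planeE[rab' pab'].
    exact: perp_unique (vt_neq0 e01 e01s t) rab pab rab' pab'.
  by apply: (psl2_equiv_family oC) => q; rewrite g_D3E.
have [E hE] := family_generic_lift w3 x4 e01 e01s.
exists E => t /hE[t0 t6 te fam]; split.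
  by move=> ab /perp_planeE[rab pab]; rewrite g_D3E; apply: fam.
have [T hT] := family_fibre x4 e01 e01s t0 t6 te.
exists T => t' ab ab' /perp_planeE[rab pab] /perp_planeE[rab' pab'] [mu umu].
rewrite !g_D3E => eqv.
have [k k0 ek] := psl2_equiv_det (gD_homog _ _ ab) (gD_homog _ _ ab')
  (gD_nocz x4 e01 e01s rab pab t0 t6 te) (gD_det_neq0 x4 e01 e01s rab pab te) eqv.
by apply: hT rab pab rab' pab' _ k0 ek; rewrite unitmx_tr.
Qed.
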